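(* Let $\mu_0\neq\mu_1$ be two Hölder Gibbs probabilities on $\Omega=\{1,\dots,d\}^{\mathbb{N}}$ with Hölder Jacobians $J_0$ and $J_1$, and let $S_n$ and $c^-<c^+$ be as in the context. Put $$E^{NP}:=\int \log J_0\,d\mu_0-\int\log J_1\,d\mu_0 ,$$ and let $(u_n)$ be a sequence of real numbers with $u_n\to E^{NP}$. Let $(\tilde u_n)$ be any sequence of real numbers converging to some $E\in(c^-,c^+)$ with $E\neq E^{NP}$, and such that for every $n$ $$\mu_0\left(S_n<\tilde u_n\right)\le \mu_0\left(S_n<u_n\right).$$ Then the following limits exist and $$\lim_{n\to\infty}\frac1n\log \mu_1\left(S_n>\tilde u_n\right)\;>\;\lim_{n\to\infty}\frac1n\log\mu_1\left(S_n>u_n\right)=-\left(\int\log J_0\,d\mu_0-\int\log J_1\,d\mu_0\right)=-E^{NP}.$$ (That is, among such threshold tests, the one with $u_n\to E^{NP}$ minimizes the exponential rate of the type II error probability.)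
   Context: Let $d\ge 2$ and let $\Omega=\{1,\dots,d\}^{\mathbb{N}}$ carry its product topology, with a usual metric such as $\mathrm{dist}(x,y)=2^{-\min\{k:\,x_k\ne y_k\}}$ (Hölder continuity refers to it). Let $\sigma:\Omega\to\Omega$, $\sigma(b_0,b_1,b_2,\dots)=(b_1,b_2,\dots)$, be the shift. For a Hölder function $A:\Omega\to\mathbb{R}$ the pressure is $P(A)=\sup_{\mu}\{\int A\,d\mu+h(\mu)\}$, the supremum over $\sigma$-invariant Borel probabilities $\mu$, where $h(\mu)$ is the Kolmogorov–Sinai entropy; it is attained at a unique $\mu$, the equilibrium probability of $A$. A Hölder Jacobian is a function $J:\Omega\to(0,\infty)$ with $\log J$ Hölder and $\sum_{a=1}^d J(a,b_0,b_1,\dots)=1$ for all $(b_0,b_1,\dots)\in\Omega$; then $P(\log J)=0$ and the equilibrium probability of $\log J$ is called the Hölder Gibbs probability with Jacobian $J$. Given $\mu_0,\mu_1$ with Jacobians $J_0,J_1$, set $$S_n(y)=\frac1n\sum_{i=0}^{n-1}\log\frac{J_0(\sigma^i(y))}{J_1(\sigma^i(y))},\qquad y\in\Omega,$$ $P_1(t)=P\left(t(\log J_0-\log J_1)+\log J_1\right)$ for $t\in\mathbb{R}$ (an analytic function), and $c^-=\inf_{t\in\mathbb{R}}P_1'(t)$, $c^+=\sup_{t\in\mathbb{R}}P_1'(t)$. Test interpretation: a test with threshold sequence $u_n$ announces $H_1$ (the process is described by $\mu_1$) on the rejection region $\{S_n<u_n\}$ and otherwise announces $H_0$ (the process is described by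 $\mu_0$); $\mu_0(S_n<u_n)$ is its size (type I error), and $\mu_1(S_n>u_n)$ is the type II error probability. *)

(* Defs.v *)
From HB Require Import structures.
From mathcomp Require Import all_boot all_order all_algebra.
From mathcomp Require Import all_classical all_reals all_analysis.

Set Implicit Arguments.
Unset Strict Implicit.
Unset Printing Implicit Defensive.

Import Order.TTheory GRing.Theory Num.Theory.
Import numFieldNormedType.Exports.

Local Open Scope classical_set_scope.
Local Open Scope ring_scope.

(* One-sided full shift on d = k.+2 letters, so that k : nat ranges over
   exactly the alphabets with d >= 2.  The letters are numbered from 0. *)
Definition letter (k : nat) : Type := discrete_topology 'I_k.+2.
HB.instance Definition _ k := DiscreteTopology.on (letter k).
HB.instance Definition _ k := isPointed.Build (letter k) (@ord0 k.+1).

Definition Omega (k : nat) : Type := prod_topology (fun _ : nat => letter k).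
HB.instance Definition _ k := Pointed.on (Omega k).
HB.instance Definition _ k := Topological.on (Omega k).

HB.instance Definition _ k :=
  Measurable.copy (Omega k) (g_sigma_algebraType (@open (Omega k))).

Definition shift_map k (x : Omega k) : Omega k := fun n => x n.+1.

Definition scons k (a : 'I_k.+2) (x : Omega k) : Omega k :=
  fun n => if n is m.+1 then x m else a.

Section Entropy.
Context {d : measure_display} {T : measurableType d} {R : realType}.
Variables (mu : probability T R) (f : T -> T).

Definition invariant_measure : Prop :=
  forall B : set T, measurable B -> mu (f @^-1` B) = mu B.

(* A finite measurable partition is represented by its labelling function
   xi : T -> 'I_m, whose fibres are the atoms (possibly empty).  The sets
   [itinerary xi w] are then the atoms of the join of the partitions
   f^{-i} xi for i < n. *)
Definition itinerary m (xi : T -> 'I_m) n (w : {ffun 'I_n -> 'I_m}) : set T :=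
  [set x | forall i : 'I_n, xi (iter i f x) = w i].

(* ln 0 = 0, whence the usual convention 0 log 0 = 0. *)
Definition join_entropy m (xi : T -> 'I_m) (n : nat) : R :=
  - \sum_(w : {ffun 'I_n -> 'I_m})
      fine (mu (itinerary xi w)) * ln (fine (mu (itinerary xi w))).

Definition partition_entropy m (xi : T -> 'I_m) : R :=
  limn (fun n : nat => n%:R^-1 * join_entropy xi n).

(* Kolmogorov-Sinai entropy *)
Definition ks_entropy : \bar R :=
  ereal_sup [set h | exists m, exists xi : T -> 'I_m,
    (forall j, measurable (xi @^-1` [set j])) /\
    h = (partition_entropy xi)%:E].

End Entropy.

Section Thermodynamics.
Context {R : realType} {k : nat}.
Implicit Types (A J : Omega k -> R) (mu : probability (Omega k) R).

Lemma ex_diff_letter (x y : Omega k) : x <> y -> exists n, x n != y n.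
Proof.
move=> xy; apply: contrapT => /forallNP h; apply: xy; apply: funext => n.
by apply/eqP; apply: contrapT => /negP; exact: h.
Qed.

Definition dist (x y : Omega k) : R :=
  match pselect (x = y) with
  | left _ => 0
  | right xy => 2 ^- ex_minn (ex_diff_letter xy)
  end.

Definition holder A : Prop :=
  exists C alpha : R, [/\ 0 <= C, 0 < alpha &
    forall x y, `|A x - A y| <= C * (dist x y `^ alpha)].

Definition pressure A : \bar R :=
  ereal_sup [set p | exists mu, invariant_measure mu (@shift_map k) /\
    p = (\int[mu]_x (A x)%:E + ks_entropy mu (@shift_map k))%E].

Definition equilibrium A mu : Prop :=
  invariant_measure mu (@shift_map k) /\
  (\int[mu]_x (A x)%:E + ks_entropy mu (@shift_map k))%E = pressure A.

Definition holder_jacobian J : Prop :=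
  [/\ forall x, 0 < J x,
      holder (fun x => ln (J x)) &
      forall x, \sum_(a < k.+2) J (scons a x) = 1].

Definition gibbs J mu : Prop :=
  holder_jacobian J /\ equilibrium (fun x => ln (J x)) mu.

Definition Sn J0 J1 (n : nat) (y : Omega k) : R :=
  n%:R^-1 * \sum_(i < n)
    ln (J0 (iter i (@shift_map k) y) / J1 (iter i (@shift_map k) y)).

Definition P1 J0 J1 (t : R) : R :=
  fine (pressure (fun x => t * (ln (J0 x) - ln (J1 x)) + ln (J1 x))).

Definition cminus J0 J1 : \bar R :=
  ereal_inf (range (fun t : R => (derive1 (P1 J0 J1) t)%:E)).

Definition cplus J0 J1 : \bar R :=
  ereal_sup (range (fun t : R => (derive1 (P1 J0 J1) t)%:E)).

Definition E_NP J0 J1 mu0 : R :=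
  (\int[mu0]_x ln (J0 x) - \int[mu0]_x ln (J1 x))%R.

(* (1/n) log mu(B) in the extended reals, with log 0 = -oo. *)
Definition log_rate mu (n : nat) (B : set (Omega k)) : \bar R :=
  ((n%:R^-1)%:E * lne (mu B))%E.

(* Measures are functions on all subsets, and only their values on measurable
   sets are significant; two measures are different when they disagree on
   some measurable set. *)
Definition distinct_measures mu0 mu1 : Prop :=
  exists B : set (Omega k), measurable B /\ mu0 B <> mu1 B.

End Thermodynamics.

(* Main.v *)
(* Put A_i = ln J_i, f = A_0 - A_1 and e = E_NP = int f dmu_0.  Bounded distortion
   makes the iterates of the transfer operator of a normalized potential contract
   oscillations, which produces a Gibbs measure; coding itineraries with it gives
   int A dmu + h(mu) <= 0 for every invariant mu, hence zero pressure.  An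
   equilibrium state of A is a tangent functional of the pressure, so perturbing A
   among the normalized potentials shows that it is fixed by the dual transfer
   operator: it is the Gibbs measure, it is quasi-Bernoulli and mixing, and e > 0
   since mu_0 <> mu_1.  By quasi-Bernoulli concatenation the rate r(a) of
   mu_1(S_n > a) exists and is convex below the essential supremum of S_n, which
   exceeds e: otherwise f - e would have bounded Birkhoff sums, against
   int exp(n S_n) dmu_1 = 1.  The likelihood ratio and the law of large numbers for
   mu_0 give r(e) = e, and since r vanishes near -oo, convexity gives r(E) < e for
   E < e.  Finally E > e is incompatible with the size condition: as E < c^+, some
   cylinder, of positive mu_0-measure, lies in {u_n <= S_n < v_n} for large n. *)

Require Import Defs.
From HB Require Import structures.
From mathcomp Require Import all_boot all_order all_algebra.
From mathcomp Require Import all_classical all_reals all_analysis.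
From mathcomp Require Import measurable_realfun ring lra.

Import Order.TTheory GRing.Theory Num.Theory.
Import numFieldNormedType.Exports.

Set Implicit Arguments.
Unset Strict Implicit.
Unset Printing Implicit Defensive.

Local Open Scope classical_set_scope.
Local Open Scope ring_scope.

(** * Transfer operators *)

(** Events are replaced by unions of cylinders of length n, for which the n-th iterate of the
    transfer operator is a finite sum over words. Distortion then costs a factor independent of n,
    invisible to exponential rates; this is the origin of the events [robust] and of the constants
    D. Decay is expressed by the predicate [rate], that some n attains a given bound, so that levels
    of probability zero need no infinite values. The delicate point is that u_n may approach e from
    above, so the value r(e) = e must persist slightly to the right of e. Convexity provides this
    once r is finite at some level beyond e, which is the purpose of the claim on the essential
    supremum. The law of large numbers is a Chebyshev bound: correlations decay because L^n g
    becomes constant. The number c^+ enters through a difference quotient of P_1 at one parameter: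
    the pressure being a supremum over invariant measures, a slope above E forces values of S_n
    above E for every n, and changing one letter at a time from a low point to a high one reaches
    the window between the two thresholds. *)

Section Transfer.
Context {R : realType} {k : nat}.
Implicit Types (A B f phi psi : Omega k -> R) (x y z : Omega k) (n p : nat).

Local Notation sh := (@shift_map k).

Definition agree n x y := forall i, (i < n)%N -> x i = y i.

Definition birkhoff f n y : R := \sum_(i < n) f (iter i sh y).

(* The Ruelle operator of the potential A = ln J. *)
Definition transfer A phi x : R :=
  \sum_(a < k.+2) expR (A (scons a x)) * phi (scons a x).

Definition normalized A := forall x, \sum_(a < k.+2) expR (A (scons a x)) = 1.

(* Hoelder continuity of exponent alpha, with t = 2 ^ - alpha. *)
Definition lip (t C : R) phi :=
  forall n x y, agree n x y -> `|phi x - phi y| <= C * t ^+ n.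

Lemma iter_shiftE i x j : iter i sh x j = x (i + j)%N.
Proof. by elim: i j => [//|i IH] j; rewrite iterS /shift_map IH addnS. Qed.

Lemma agree0 x y : agree 0 x y. Proof. by []. Qed.

Lemma agreexx n x : agree n x x. Proof. by []. Qed.

Lemma agree_sym n x y : agree n x y -> agree n y x.
Proof. by move=> h i /h. Qed.

Lemma agreeW n p x y : (p <= n)%N -> agree n x y -> agree p x y.
Proof. by move=> pn h i ip; apply: h; apply: leq_trans pn. Qed.

Lemma agree_trans n x y z : agree n x y -> agree n y z -> agree n x z.
Proof. by move=> h1 h2 i ni; rewrite h1// h2. Qed.

Lemma agree_iter n p x y : agree (n + p) x y -> agree p (iter n sh x) (iter n sh y).
Proof. by move=> h i ip; rewrite !iter_shiftE h// ltn_add2l. Qed.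

Lemma agree_catP n p x y :
  agree (n + p) x y <-> agree n x y /\ agree p (iter n sh x) (iter n sh y).
Proof.
split=> [h|[h1 h2] i ip].
  by split; [apply: agreeW h; exact: leq_addr|exact: agree_iter].
have [/h1//|ni] := ltnP i n.
have := h2 (i - n)%N; rewrite !iter_shiftE subnKC// => -> //.
by rewrite ltn_subLR.
Qed.

Lemma birkhoff0 f y : birkhoff f 0 y = 0.
Proof. by rewrite /birkhoff big_ord0. Qed.

Lemma birkhoffSr f n y : birkhoff f n.+1 y = birkhoff f n y + f (iter n sh y).
Proof. by rewrite /birkhoff big_ord_recr. Qed.

Lemma birkhoffD f n p y :
  birkhoff f (n + p) y = birkhoff f n y + birkhoff f p (iter n sh y).
Proof.
elim: p => [|p IH]; first by rewrite addn0 birkhoff0 addr0.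
by rewrite addnS !birkhoffSr IH addrA -iterD addnC.
Qed.

Lemma birkhoff_bound f (M : R) n y :
  (forall x, `|f x| <= M) -> `|birkhoff f n y| <= M *+ n.
Proof.
move=> h; apply: (le_trans (ler_norm_sum _ _ _)).
by rewrite -[n in leRHS]card_ord -sumr_const ler_sum.
Qed.

Lemma birkhoffB f g n y :
  birkhoff (fun x => f x - g x) n y = birkhoff f n y - birkhoff g n y.
Proof. by rewrite /birkhoff sumrB. Qed.

Lemma lip_bounded t C phi x : lip t C phi -> forall y, `|phi y| <= `|phi x| + C.
Proof.
move=> h y; have := h 0%N y x (agree0 y x).
by rewrite expr0 mulr1 => h'; have := ler_normD (phi y - phi x) (phi x); rewrite subrK; lra.
Qed.

Lemma lip_ge0 t C phi : lip t C phi -> 0 <= C.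
Proof.
move=> h; have := h 0%N (fun=> ord0) (fun=> ord0) (@agreexx _ _).
by rewrite subrr normr0 expr0 mulr1.
Qed.

(** Lets two potentials with different Hölder exponents share the larger ratio t. *)
Lemma lip_le t t' C phi : 0 <= t <= t' -> lip t C phi -> lip t' C phi.
Proof.
move=> /andP[t0 tt] h n x y /h /le_trans; apply; apply: ler_wpM2l.
  exact: lip_ge0 h.
by apply: lerXn2r => //; rewrite nnegrE // (le_trans t0).
Qed.

Lemma lip_eq t C f g : f =1 g -> lip t C f -> lip t C g.
Proof. by move=> fg h n x y /h; rewrite !fg. Qed.

Lemma lipB t C C' f g : lip t C f -> lip t C' g -> lip t (C + C') (fun x => f x - g x).
Proof.
move=> hf hg n x y xy; rewrite (_ : _ - _ = (f x - f y) - (g x - g y)); last by ring.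
by apply: (le_trans (ler_normB _ _)); rewrite mulrDl lerD ?hf ?hg.
Qed.

Lemma lipD t C C' f g : lip t C f -> lip t C' g -> lip t (C + C') (fun x => f x + g x).
Proof.
move=> hf hg n x y xy; rewrite (_ : _ - _ = (f x - f y) + (g x - g y)); last by ring.
by apply: (le_trans (ler_normD _ _)); rewrite mulrDl lerD ?hf ?hg.
Qed.

Lemma lipZ t C c f : lip t C f -> lip t (`|c| * C) (fun x => c * f x).
Proof.
by move=> hf n x y /hf h; rewrite -mulrBr normrM -mulrA ler_wpM2l.
Qed.

Lemma lip_cst t c : lip t 0 (fun=> c).
Proof. by move=> n x y _; rewrite subrr normr0 mul0r. Qed.

(** For n < N one has t ^+ n >= t ^+ N, so the constant covers the crude bound 2 M; from depth N on
    the difference vanishes. *)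
Lemma lip_cylinder t N (M : R) phi : 0 < t <= 1 -> (forall x, `|phi x| <= M) ->
  (forall x y, agree N x y -> phi x = phi y) -> lip t (2 * M / t ^+ N) phi.
Proof.
move=> /andP[t0 t1] hM h n x y xy; have t0' := ltW t0.
have M0 : 0 <= M by apply: le_trans (hM x).
have [Nn|nN] := leqP N n.
  rewrite (h x y) ?subrr ?normr0; last exact: agreeW xy.
  by rewrite mulr_ge0 ?divr_ge0 ?mulr_ge0 ?exprn_ge0.
have : `|phi x - phi y| <= 2 * M.
  by apply: (le_trans (ler_normB _ _)); have := hM x; have := hM y; lra.
move=> /le_trans; apply; rewrite -mulrA ler_peMr ?mulr_ge0//.
rewrite ler_pdivlMl ?exprn_gt0// mulr1.
by apply: ler_wiXn2l => //; exact: ltnW.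
Qed.

(* Bounded distortion: t (2 - t) <= 1 makes the constant C / (1 - t) inductive. *)
Lemma birkhoff_distortion t C A n p x y : 0 < t < 1 -> lip t C A ->
  agree (n + p) x y ->
  `|birkhoff A n x - birkhoff A n y| <= C / (1 - t) * t ^+ p.
Proof.
move=> /andP[t0 t1] hA; have C0 := lip_ge0 hA; have t0' := ltW t0.
have t1' : 0 < 1 - t by lra.
have D0 : 0 <= C / (1 - t) by rewrite divr_ge0// ltW.
elim: n p => [|n IH] p xy.
  by rewrite !birkhoff0 subrr normr0 mulr_ge0// exprn_ge0.
rewrite !birkhoffSr opprD addrACA.
apply: (le_trans (ler_normD _ _)).
have h1 : agree (n + p.+1) x y by rewrite addnS -addSn.
have h2 := hA _ _ _ (agree_iter h1).
apply: le_trans (lerD (IH _ h1) h2) _.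
rewrite -mulrDl exprS mulrA; apply: ler_wpM2r; first exact: exprn_ge0.
rewrite ler_pdivlMr// mulrDl mulrAC mulrDl divfK ?gt_eqF//.
have : C * (1 - t * (2 - t)) >= 0 by rewrite mulr_ge0//; nra.
lra.
Qed.

Lemma transferZ A phi c x : transfer A (fun z => c * phi z) x = c * transfer A phi x.
Proof. by rewrite /transfer mulr_sumr; apply: eq_bigr => a _; rewrite mulrCA. Qed.

Lemma transferD A phi psi x :
  transfer A (fun z => phi z + psi z) x = transfer A phi x + transfer A psi x.
Proof. by rewrite /transfer -big_split; apply: eq_bigr => a _; rewrite mulrDr. Qed.

Lemma eq_transfer A phi psi : phi =1 psi -> transfer A phi =1 transfer A psi.
Proof. by move=> h x; apply: eq_bigr => a _; rewrite h. Qed.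

Lemma eq_iter_transfer A n phi psi :
  phi =1 psi -> iter n (transfer A) phi =1 iter n (transfer A) psi.
Proof. by move=> h; elim: n => [//|n IH] x; exact: eq_transfer. Qed.

Lemma iter_transferZ A n phi c x :
  iter n (transfer A) (fun z => c * phi z) x = c * iter n (transfer A) phi x.
Proof.
elim: n x => [//|n IH] x.
by rewrite !iterS (eq_transfer _ IH) transferZ.
Qed.

Lemma iter_transferD A n phi psi x :
  iter n (transfer A) (fun z => phi z + psi z) x =
  iter n (transfer A) phi x + iter n (transfer A) psi x.
Proof.
elim: n x => [//|n IH] x.
by rewrite !iterS (eq_transfer _ IH) transferD.
Qed.

Lemma iter_transfer_cst A n c x : normalized A -> iter n (transfer A) (fun=> c) x = c.
Proof.
move=> nA; elim: n x => [//|n IH] x.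
by rewrite iterS (eq_transfer _ IH) /transfer /= -mulr_suml nA mul1r.
Qed.

Lemma transfer_shift A phi x : normalized A -> transfer A (phi \o sh) x = phi x.
Proof.
move=> nA; transitivity (\sum_(a < k.+2) expR (A (scons a x)) * phi x); first by [].
by rewrite -mulr_suml nA mul1r.
Qed.

(** Unfolded, the n-th iterate at x is the sum over words w of length n of exp (S_n A (wx)) phi
    (wx). The branches wx and wy share their first n letters, so a comparison of paired terms sums
    to a comparison of the iterates, even for two potentials and two base points. *)
Lemma transfer_le A B n phi psi x y :
  (forall z z', iter n sh z = x -> iter n sh z' = y -> agree n z z' ->
     expR (birkhoff A n z) * phi z <= expR (birkhoff B n z') * psi z') ->
  iter n (transfer A) phi x <= iter n (transfer B) psi y.
Proof.
elim: n phi psi x y => [|n IH] phi psi x y h.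
  by have := h x y erefl erefl (agree0 x y); rewrite !birkhoff0 expR0 !mul1r.
(* The outermost branch a becomes the letter of index n of the preimages; its weight is moved inside
   the remaining n iterates. *)
rewrite !iterS; apply: ler_sum => a _; rewrite -!iter_transferZ.
apply: IH => z z' zx zy zz; have := h z z'.
rewrite !birkhoffSr !iterS zx zy !expRD => /(_ erefl erefl); rewrite !mulrA; apply.
move=> i; rewrite ltnS leq_eqVlt => /orP[/eqP->|]; last exact: zz.
by have := congr1 (@^~ 0%N) zx; have := congr1 (@^~ 0%N) zy; rewrite !iter_shiftE !addn0 => -> ->.
Qed.

Lemma iter_transfer_mono A n phi psi x : (forall z, phi z <= psi z) ->
  iter n (transfer A) phi x <= iter n (transfer A) psi x.
Proof.
elim: n x => [//|n IH] x h; rewrite !iterS.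
by apply: ler_sum => a _; rewrite ler_wpM2l ?expR_ge0 ?IH.
Qed.

(** Paired branches carry equal values of phi and weights within the factor exp D: the n-th iterate
    of a function of n letters is constant up to that factor. *)
Lemma transfer_comparable A D n phi x y : 
  (forall z z', agree n z z' -> `|birkhoff A n z - birkhoff A n z'| <= D) ->
  (forall z, 0 <= phi z) -> (forall z z', agree n z z' -> phi z = phi z') ->
  iter n (transfer A) phi x <= expR D * iter n (transfer A) phi y.
Proof.
move=> hD phi0 hphi; rewrite -iter_transferZ; apply: transfer_le => z z' _ _ zz.
rewrite (hphi _ _ zz) mulrA; apply: ler_wpM2r => //.
rewrite -expRD ler_expR; have := hD _ _ zz; rewrite ler_norml; lra.
Qed.

End Transfer.

(** * Contraction of oscillations by the transfer operator *)

Section Contraction.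
Context {R : realType} {k : nat}.
Variables (t C : R) (A : Omega k -> R).
Hypotheses (t01 : 0 < t < 1) (lipA : lip t C A) (nA : normalized A).
Implicit Types (f phi psi : Omega k -> R) (x y z : Omega k) (n p : nat).

Local Notation sh := (@shift_map k).
Local Notation L := (transfer A).
Local Notation D := (C / (1 - t)).

Let t0 : 0 < t. Proof. by case/andP: t01. Qed.
Let t1 : t < 1. Proof. by case/andP: t01. Qed.

Let tn n : 0 < t ^+ n <= 1.
Proof. by rewrite exprn_gt0//= exprn_ile1// ltW. Qed.

Lemma distortion_ge0 : 0 <= D.
Proof. by rewrite divr_ge0 ?(lip_ge0 lipA)// subr_ge0 ltW. Qed.

Lemma distortion n z z' : agree n z z' -> `|birkhoff A n z - birkhoff A n z'| <= D.
Proof.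
move=> zz; have := @birkhoff_distortion _ _ t C A n 0 z z' t01 lipA.
by rewrite addn0 expr0 mulr1; exact.
Qed.

Lemma iter_transfer_bounds n m M phi x : (forall z, m <= phi z <= M) ->
  m <= iter n L phi x <= M.
Proof.
move=> h; rewrite -{1}(iter_transfer_cst n m x nA) -(iter_transfer_cst n M x nA).
by apply/andP; split; apply: iter_transfer_mono => z; case/andP: (h z).
Qed.

(** For phi >= 0 the comparison can be multiplicative: over base points that agree on p letters,
    paired weights have ratio at most exp s with s = D t^p, and the values of phi differ by at most
    K t^p. The inequality exp s - 1 <= s exp s turns this into an additive bound that does not
    involve n. *)
Let iter_transfer_lip_ge0 n M K phi : (forall z, 0 <= phi z <= M) -> lip t K phi ->
  lip t (expR D * (D * M + K)) (iter n L phi).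
Proof.
move=> hM hK.
have K0 := lip_ge0 hK; have D0 := distortion_ge0.
have M0 : 0 <= M by have /andP[h1 h2] := hM (fun=> ord0); exact: le_trans h2.
suff h p x y : agree p x y ->
    iter n L phi x - iter n L phi y <= expR D * (D * M + K) * t ^+ p.
  move=> p x y xy; rewrite ler_norml h// andbT lerNl opprB h//.
  exact: agree_sym.
move=> xy; have /andP[tp0 tp1] := tn p.
set s := D * t ^+ p; have s0 : 0 <= s by rewrite mulr_ge0// ltW.
have : iter n L phi x <= expR s * (iter n L phi y + K * t ^+ p).
  rewrite -[K * _](iter_transfer_cst n _ y nA) -iter_transferD -iter_transferZ.
  apply: transfer_le => z z' zx zy zz.
  have zz' : agree (n + p) z z' by apply/agree_catP; rewrite zx zy.
  rewrite mulrA -expRD; apply: ler_pM.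
  - exact: expR_ge0.
  - by case/andP: (hM z).
  - rewrite ler_expR; have := birkhoff_distortion t01 lipA zz'.
    by rewrite -/s ler_norml; lra.
  - have := hK _ _ _ zz'; rewrite ler_norml exprD.
    have : K * (t ^+ n * t ^+ p) <= K * t ^+ p.
      apply: ler_wpM2l => //; rewrite ler_piMl ?(ltW tp0)//.
      by case/andP: (tn n).
    by lra.
have /andP[Y0 YM] := iter_transfer_bounds n y hM.
set X := iter n L phi x; set Y := iter n L phi y in Y0 YM *.
move=> hX.
have es : expR s <= expR D by rewrite ler_expR /s ler_piMr.
have e1 : expR s - 1 <= s * expR s.
  have := expR_ge1Dx (- s); rewrite expRN.
  rewrite -(ler_pM2r (expR_gt0 s)) mulVf ?gt_eqF ?expR_gt0//; lra.
have e2 : (expR s - 1) * Y <= s * expR D * M.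
  apply: (@le_trans _ _ (s * expR s * Y)); first exact: ler_wpM2r.
  by apply: ler_pM => //; [rewrite mulr_ge0// expR_ge0|exact: ler_wpM2l].
have e3 : expR s * (K * t ^+ p) <= expR D * (K * t ^+ p).
  by rewrite ler_wpM2r// mulr_ge0// ltW.
have -> : expR D * (D * M + K) * t ^+ p = s * expR D * M + expR D * (K * t ^+ p).
  by rewrite /s; ring.
lra.
Qed.

(** Adding a bound M makes phi nonnegative, and the iterates fix constants, so differences are
    unaffected. *)
Lemma iter_transfer_lip K phi : lip t K phi ->
  exists K', forall n, lip t K' (iter n L phi).
Proof.
move=> hK; set M := `|phi (fun=> ord0)| + K.
have hM z : `|phi z| <= M by exact: lip_bounded hK _.
clearbody M; exists (expR D * (D * (2 * M) + (K + 0))) => n.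
have h : lip t (expR D * (D * (2 * M) + (K + 0))) (iter n L (fun z => phi z + M)).
  apply: iter_transfer_lip_ge0; last by apply: lipD => //; exact: lip_cst.
  by move=> z; have := hM z; rewrite ler_norml; lra.
move=> p x y /h; rewrite !iter_transferD !iter_transfer_cst//.
by rewrite opprD addrACA subrr addr0.
Qed.

(** Doeblin's argument. The branches over x weigh at least exp (- D) times those over y; applied to
    the nonnegative function m + o - g, this leaves only the fraction 1 - exp (- D) of the
    oscillation. The term K t^n pays for g being evaluated at paired points rather than at equal
    ones. *)
Lemma transfer_contraction n m o K g x y :
  (forall z, m <= g z <= m + o) -> lip t K g ->
  iter n L g x - iter n L g y <= (1 - expR (- D)) * o + K * t ^+ n.
Proof.
move=> hg hK; have D0 := distortion_ge0; have /andP[tn0 tn1] := tn n.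
have K0 := lip_ge0 hK; have o0 : 0 <= o.
  by have /andP[h1 h2] := hg (fun=> ord0); have := le_trans h1 h2; rewrite lerDl.
have e1 : expR (- D) <= 1 by rewrite -[leRHS]expR0 ler_expR oppr_le0.
have e0 := expR_ge0 (- D).
have : expR (- D) * ((m + o - K * t ^+ n) + (-1) * iter n L g y) <=
    (m + o) + (-1) * iter n L g x.
  rewrite -[m + o - _](iter_transfer_cst n _ y nA) -[X in _ <= X + _](iter_transfer_cst n _ x nA).
  rewrite -!iter_transferZ -!iter_transferD -iter_transferZ.
  apply: transfer_le => z z' zy zx zz.
  have h1 : m + o - K * t ^+ n + -1 * g z <= m + o + -1 * g z'.
    by have := hK _ _ _ zz; rewrite ler_norml => /andP[? ?]; lra.
  have h2 : 0 <= m + o + -1 * g z' by have /andP[? ?] := hg z'; lra.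
  rewrite mulrA -expRD.
  apply: (@le_trans _ _ (expR (birkhoff A n z - D) * (m + o + -1 * g z'))).
    by apply: ler_wpM2l => //; exact: expR_ge0.
  rewrite ler_wpM2r// ler_expR.
  by have := distortion zz; rewrite ler_norml; lra.
have /andP[] := iter_transfer_bounds n y hg.
have : 0 <= K * t ^+ n by rewrite mulr_ge0// ltW.
nra.
Qed.

Lemma osc_inf o (g : Omega k -> R) : (forall x y, g x - g y <= o) ->
  forall z : Omega k, inf (range g) <= g z <= inf (range g) + o.
Proof.
move=> ho z; apply/andP; split.
  apply: ge_inf; last by exists z.
  by exists (g z - o) => _ [y _ <-]; have := ho z y; lra.
rewrite -lerBlDr; apply: lb_le_inf; first by exists (g z), z.
by move=> _ [y _ <-]; have := ho z y; lra.
Qed.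

Lemma transfer_osc K phi : lip t K phi -> forall e, 0 < e ->
  exists N, forall n x y, (N <= n)%N -> iter n L phi x - iter n L phi y <= e.
Proof.
move=> hK e e0; have [K' hK'] := iter_transfer_lip hK.
have K'0 := lip_ge0 (hK' 0%N).
have mono o N : (forall x y, iter N L phi x - iter N L phi y <= o) ->
    forall n x y, (N <= n)%N -> iter n L phi x - iter n L phi y <= o.
  move=> /osc_inf h n x y Nn; rewrite -(subnK Nn) iterD.
  have := iter_transfer_bounds (n - N) x h; have := iter_transfer_bounds (n - N) y h.
  by lra.
(* Half of the gain exp (- D) is given up to absorb the error K' t^n. *)
pose q := 1 - expR (- D) / 2.
have ee : 0 < expR (- D) <= 1.
  by rewrite expR_gt0 -[leRHS]expR0 ler_expR oppr_le0 distortion_ge0.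
suff [N hN] : exists N, forall x y, iter N L phi x - iter N L phi y <= e.
  by exists N; exact: mono hN.
(* K + 1 in place of K keeps the bound positive, so that n can be chosen in the inductive step. *)
have step j : exists N, forall x y, iter N L phi x - iter N L phi y <= q ^+ j * (K + 1).
  elim: j => [|j [N hN]].
    exists 0%N => x y /=; rewrite expr0 mul1r.
    have := hK 0%N x y (agree0 x y).
    by rewrite expr0 ler_norml; lra.
  have q0 : 0 < q ^+ j * (K + 1).
    by rewrite mulr_gt0 ?exprn_gt0 /q//; have := lip_ge0 hK; lra.
  have [n hn] : exists n, K' * t ^+ n <= expR (- D) / 2 * (q ^+ j * (K + 1)).
    have : K' *: t ^+ n @[n --> \oo] --> K' *: (0 : R).
      apply: cvgZr; apply: cvg_expr; rewrite ger0_norm// ltW//.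
    rewrite scaler0 => /cvgrPdist_le /(_ (expR (- D) / 2 * (q ^+ j * (K + 1)))).
    have -> : 0 < expR (- D) / 2 * (q ^+ j * (K + 1)) by rewrite mulr_gt0//; lra.
    move=> /(_ isT) [n _ /(_ n (leqnn n))]; rewrite sub0r normrN => h.
    by exists n; apply: le_trans h; exact: ler_norm.
  exists (n + N)%N => x y; rewrite !iterD.
  apply: le_trans (transfer_contraction n x y (osc_inf hN) (hK' N)) _.
  rewrite exprS /q; nra.
have : q ^+ j * (K + 1) @[j --> \oo] --> 0 * (K + 1).
  by apply: cvgMl; apply: cvg_expr; rewrite /q ger0_norm; lra.
rewrite mul0r => /cvgrPdist_le /(_ e e0) [j _ /(_ j (leqnn j))].
rewrite sub0r normrN => hj; have [N hN] := step j; exists N => x y.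
by apply: le_trans (hN x y) _; apply: le_trans (ler_norm _) hj.
Qed.

(** The fixed functional of the dual operator. The iterates become constant, so any other base point
    would give the same limit. *)
Definition gibbs_functional phi : R := limn (fun n => iter n L phi (fun=> ord0)).
Local Notation Lam := gibbs_functional.

Lemma gibbs_functional_cvg K phi : lip t K phi ->
  iter n L phi (fun=> ord0) @[n --> \oo] --> Lam phi.
Proof.
move=> hK; apply: cauchy_cvg; apply: cauchy_exP => e e0.
have e2 : 0 < e / 2 by rewrite divr_gt0.
have [N hN] := transfer_osc hK e2.
exists (iter N L phi (fun=> ord0)); exists N => // n /= Nn.
rewrite /ball /= -(subnK Nn) iterD.
have hN' x y : iter N L phi x - iter N L phi y <= e / 2 by exact: hN.
have := iter_transfer_bounds (n - N) (fun=> ord0) (osc_inf hN').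
have := osc_inf hN' (fun=> ord0).
by move: (iter (n - N) _ _ _) (iter N _ _ _) (inf _) => u v w; rewrite ltr_norml; lra.
Qed.

Lemma gibbs_functional_bounds K m M phi : lip t K phi ->
  (forall z, m <= phi z <= M) -> m <= Lam phi <= M.
Proof.
move=> hK h; have c := gibbs_functional_cvg hK; apply/andP; split.
  by apply: limr_ge; [apply/cvg_ex; exists (Lam phi)|
    near=> n; case/andP: (iter_transfer_bounds n (fun=> ord0) h)].
by apply: limr_le; [apply/cvg_ex; exists (Lam phi)|
    near=> n; case/andP: (iter_transfer_bounds n (fun=> ord0) h)].
Unshelve. all: by end_near. Qed.

Lemma gibbs_functionalD K K' phi psi : lip t K phi -> lip t K' psi ->
  Lam (fun z => phi z + psi z) = Lam phi + Lam psi.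
Proof.
move=> hK hK'; apply/cvg_lim => //.
under eq_fun do rewrite iter_transferD.
by apply: cvgD; [exact: gibbs_functional_cvg hK|exact: gibbs_functional_cvg hK'].
Qed.

Lemma gibbs_functional_transfer K phi : lip t K phi -> Lam (L phi) = Lam phi.
Proof.
move=> hK; apply/cvg_lim => //.
under eq_fun do rewrite -iterSr.
by have := gibbs_functional_cvg hK; rewrite -cvg_shiftS.
Qed.

(** Since L (phi o sh) = phi, composing with the shift only delays the sequence of iterates by one
    index. *)
Lemma gibbs_functional_shift K phi : lip t K phi -> Lam (phi \o sh) = Lam phi.
Proof.
move=> hK; apply/cvg_lim => //; rewrite -cvg_shiftS.
rewrite (_ : (fun n => _) = (fun n => iter n L phi (fun=> ord0))).
  exact: gibbs_functional_cvg hK.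
apply/funext => n /=; rewrite -iterS iterSr.
by apply: eq_iter_transfer => x; exact: transfer_shift.
Qed.

End Contraction.

(** * Cylinders and integration *)

Lemma measurable_iter d (T : measurableType d) (f : T -> T) n :
  measurable_fun setT f -> measurable_fun setT (iter n f).
Proof.
move=> mf; elim: n => [|n IH]; first exact: measurable_id.
rewrite (_ : iter n.+1 f = f \o iter n f)//; exact: measurableT_comp mf IH.
Qed.

Section Cylinders.
Context {k : nat}.
Implicit Types (x y z : Omega k) (n p : nat) (U B : set (Omega k)).

Local Notation sh := (@shift_map k).

Definition cylinder_set n B := forall x y, agree n x y -> B x -> B y.

(* The open sets of Omega. *)
Definition locally_cylinder U := forall x, U x -> exists n, agree n x `<=` U.

Lemma cylinder_set_locally n B : cylinder_set n B -> locally_cylinder B.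
Proof. by move=> h x Bx; exists n => y /h; exact. Qed.

Lemma cylinder_setC n B : cylinder_set n B -> cylinder_set n (~` B).
Proof. by move=> h x y xy Bx By; apply: Bx; apply: h By; exact: agree_sym. Qed.

Lemma cylinder_setW n p B : (n <= p)%N -> cylinder_set n B -> cylinder_set p B.
Proof. by move=> np h x y xy; apply: h; exact: agreeW xy. Qed.

Lemma cylinder_set_agree n x : cylinder_set n (agree n x).
Proof. by move=> y z yz xy; exact: agree_trans xy yz. Qed.

Lemma agree_setE n x y : agree n x y -> agree n x = agree n y :> set (Omega k).
Proof.
move=> xy; apply/seteqP; split => z h; first exact: agree_trans (agree_sym xy) h.
exact: agree_trans xy h.
Qed.

Lemma open_agree n x : open (agree n x : set (Omega k)).
Proof.
elim: n => [|n IH].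
  rewrite (_ : agree 0 x = setT); first exact: openT.
  by apply/seteqP; split.
rewrite (_ : agree n.+1 x = agree n x `&` (fun y : Omega k => y n) @^-1` [set x n]).
  apply: openI => //; apply: open_comp; last exact: discrete_open.
  by move=> y _; exact: (@proj_continuous _ (fun _ : nat => letter k) n y).
apply/seteqP; split => y /=.
  by move=> h; split; [apply: agreeW h|rewrite -(h n)].
by move=> [h e] i; rewrite ltnS leq_eqVlt => /orP[/eqP->//|]; exact: h.
Qed.

(** If no cylinder about x fits in U, there are points y_n outside U that agree with x on n letters;
    they converge to x in the product topology, hence enter U. *)
Lemma open_locally_cylinder U : open U -> locally_cylinder U.
Proof.
move=> oU x Ux; apply: contrapT => /forallNP nU.
have {}nU n : exists y, agree n x y /\ ~ U y.
  have := nU n; case/existsNP => w /not_implyP xU; exists w.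
  by case: xU.
pose y n : Omega k := projT1 (cid (nU n)).
have xy n : agree n x (y n) /\ ~ U (y n) := projT2 (cid (nU n)).
have : y n @[n --> \oo] --> x.
  apply/cvg_sup => i B [V [[W oW <-] Vx] VB].
  exists i.+1 => // n /= ni; apply: VB => /=.
  by move: Vx => /=; rewrite (proj1 (xy n)).
move=> /(_ U); rewrite nbhsE /= => /(_ (ex_intro2 _ _ U (conj oU Ux) (fun _ => id))).
by move=> [n _ /(_ n (leqnn n))] /= Uy; case: (xy n).
Qed.

Lemma locally_cylinder_open U : locally_cylinder U -> open U.
Proof.
move=> h; rewrite openE => x /h [n nU]; rewrite /interior.
apply: filterS nU _; have := open_agree n x; rewrite openE => /(_ x (@agreexx _ _ _)).
by [].
Qed.

Lemma measurable_locally_cylinder U : locally_cylinder U -> measurable U.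
Proof. by move=> /locally_cylinder_open oU; exact: sub_sigma_algebra. Qed.

Lemma measurable_cylinder_set n B : cylinder_set n B -> measurable B.
Proof. by move=> /cylinder_set_locally/measurable_locally_cylinder. Qed.

Lemma measurable_agree n x : measurable (agree n x : set (Omega k)).
Proof. exact: measurable_cylinder_set (@cylinder_set_agree n x). Qed.

(** The index is a finite word w, which makes the union countable; F w is the cylinder of w if it
    lies in U, and is empty otherwise. *)
Lemma locally_cylinder_bigcup U : locally_cylinder U ->
  exists2 F : seq 'I_k.+2 -> set (Omega k),
    (forall w, F w = set0 \/ exists n x, F w = agree n x) & U = \bigcup_w F w.
Proof.
move=> hU; pose pt (w : seq 'I_k.+2) : Omega k := nth ord0 w.
exists (fun w => if `[< agree (size w) (pt w) `<=` U >]
  then agree (size w) (pt w) else set0).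
  by move=> w; case: asboolP => _; [right; exists (size w), (pt w)|left].
apply/seteqP; split => x /=; last by move=> [w _]; case: asboolP => // h /h.
move=> /hU [n nU]; exists (mkseq x n) => //.
have e : agree n x (pt (mkseq x n)) by move=> i ni; rewrite /pt nth_mkseq.
rewrite size_mkseq; case: asboolP => [_|]; first exact: agree_sym.
by move=> nn; exfalso; apply: nn => y h; apply: nU; exact: agree_trans e h.
Qed.

Lemma measurable_from_open {d} {T : measurableType d} (h : T -> Omega k) :
  (forall U, locally_cylinder U -> measurable (h @^-1` U)) -> measurable_fun setT h.
Proof.
move=> hU; apply: (@measurability _ _ _ _ setT h (@open (Omega k))) => //.
move=> _ [U oU <-]; rewrite setTI; apply: hU; exact: open_locally_cylinder.
Qed.

Lemma measurable_from_agree {d} {T : measurableType d} (h : T -> Omega k) :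
  (forall n x, measurable (h @^-1` agree n x)) -> measurable_fun setT h.
Proof.
move=> hag; apply: measurable_from_open => U /locally_cylinder_bigcup [F hF ->].
rewrite preimage_bigcup; apply: countable_bigcupT_measurable; first exact: countableP.
by move=> w; have [->|[n [x ->]]] := hF w; [rewrite preimage_set0|].
Qed.

Lemma measurable_shift : measurable_fun setT sh.
Proof.
apply: measurable_from_open => U hU; apply: measurable_locally_cylinder => x /= /hU [n h].
by exists n.+1 => y xy; apply: h => i ni; exact: xy.
Qed.

Lemma measurable_iter_shift n : measurable_fun setT (iter n sh).
Proof. exact: measurable_iter measurable_shift. Qed.

Lemma measurable_lip {R : realType} (t C : R) (phi : Omega k -> R) : 0 < t < 1 -> lip t C phi ->
  measurable_fun setT phi.
Proof.
move=> /andP[t0 t1] hC.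
apply: (measurability _ (RGenOInfty.measurableE R)) => //.
move=> _ [_ [a ->] <-]; rewrite setTI.
apply: measurable_locally_cylinder => x /=; rewrite in_itv/= andbT => ax.
have : C * t ^+ n @[n --> \oo] --> C * 0.
  by apply: cvgMr; apply: cvg_expr; rewrite ger0_norm// ltW.
rewrite mulr0 => /cvgrPdist_lt /(_ (phi x - a)); rewrite subr_gt0 => /(_ ax).
move=> [n _ /(_ n (leqnn n))]; rewrite sub0r normrN => hn.
exists n => y /hC h; rewrite /= in_itv/= andbT.
have := ler_norm (C * t ^+ n); have := ler_norm (phi x - phi y); lra.
Qed.

End Cylinders.

(** * Integration of bounded measurable functions *)

Section BoundedIntegral.
Context {d : measure_display} {T : measurableType d} {R : realType}.
Variable mu : probability T R.
Implicit Types (f g : T -> R) (B : set T).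

Definition bounded_measurable f :=
  measurable_fun setT f /\ exists M, forall x, `|f x| <= M.

Local Notation bm := bounded_measurable.

Lemma bounded_measurable_cst c : bm (fun=> c).
Proof. by split; [exact: measurable_cst|exists `|c|]. Qed.

Lemma bounded_measurableD f g : bm f -> bm g -> bm (fun x => f x + g x).
Proof.
move=> [mf [M hM]] [mg [N hN]]; split; first exact: measurable_funD.
by exists (M + N) => x; apply: (le_trans (ler_normD _ _)); exact: lerD.
Qed.

Lemma bounded_measurableM f g : bm f -> bm g -> bm (fun x => f x * g x).
Proof.
move=> [mf [M hM]] [mg [N hN]]; split; first exact: measurable_funM.
by exists (M * N) => x; rewrite normrM ler_pM.
Qed.

Lemma bounded_measurableZ c f : bm f -> bm (fun x => c * f x).
Proof. exact: (bounded_measurableM (bounded_measurable_cst c)). Qed.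

Lemma bounded_measurableB f g : bm f -> bm g -> bm (fun x => f x - g x).
Proof.
move=> hf /(bounded_measurableZ (-1)) hg; have := bounded_measurableD hf hg.
by under eq_fun do rewrite mulN1r.
Qed.

Lemma bounded_measurable_sum I (r : seq I) (F : I -> T -> R) :
  (forall i, bm (F i)) -> bm (fun x => \sum_(i <- r) F i x).
Proof.
move=> h; elim: r => [|i r IH].
  by under eq_fun do rewrite big_nil; exact: bounded_measurable_cst.
by under eq_fun do rewrite big_cons; exact: bounded_measurableD.
Qed.

Lemma bounded_measurable_indic B : measurable B -> bm (\1_B : T -> R).
Proof.
move=> mB; split; first exact: measurable_indic.
by exists 1 => x; rewrite indicE; case: (_ \in _); rewrite ?normr1 ?normr0.
Qed.

Lemma bounded_measurable_comp f (h : T -> T) :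
  measurable_fun setT h -> bm f -> bm (f \o h).
Proof.
move=> mh [mf [M hM]]; split; first exact: measurableT_comp mf mh.
by exists M => x; exact: hM.
Qed.

Lemma bounded_measurable_integrable f : bm f -> mu.-integrable setT (EFin \o f).
Proof.
move=> [mf [M hM]]; apply: measurable_bounded_integrable => //.
  exact: le_lt_trans (probability_le1 mu measurableT) (ltry _).
exists M; split; first exact: num_real.
by move=> N MN x _ /=; apply: le_trans (hM x) (ltW MN).
Qed.

Lemma EFin_Rintegral f : bm f -> (\int[mu]_x f x)%:E = (\int[mu]_x (f x)%:E)%E.
Proof.
move=> /bounded_measurable_integrable h; rewrite /Rintegral fineK//.
exact: integrable_fin_num.
Qed.

Lemma integralD_bm f g : bm f -> bm g ->
  \int[mu]_x (f x + g x) = \int[mu]_x f x + \int[mu]_x g x.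
Proof. by move=> hf hg; rewrite RintegralD//; exact: bounded_measurable_integrable. Qed.

Lemma integralB_bm f g : bm f -> bm g ->
  \int[mu]_x (f x - g x) = \int[mu]_x f x - \int[mu]_x g x.
Proof. by move=> hf hg; rewrite RintegralB//; exact: bounded_measurable_integrable. Qed.

Lemma integralZ_bm c f : bm f -> \int[mu]_x (c * f x) = c * \int[mu]_x f x.
Proof. by move=> hf; rewrite RintegralZl//; exact: bounded_measurable_integrable. Qed.

Lemma integral_cst_prob c : \int[mu]_x c = c.
Proof.
rewrite Rintegral_cst//; have /= -> := probability_setT mu.
exact: mulr1.
Qed.

Lemma le_integral_bm f g : bm f -> bm g -> (forall x, f x <= g x) ->
  \int[mu]_x f x <= \int[mu]_x g x.
Proof.
by move=> hf hg fg; apply: le_Rintegral => //; exact: bounded_measurable_integrable.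
Qed.

Lemma eq_integral_bm f g : f =1 g -> \int[mu]_x f x = \int[mu]_x g x.
Proof. by move=> fg; congr (Rintegral _ _ _); apply/funext. Qed.

Lemma integral_bounds m M f : bm f -> (forall x, m <= f x <= M) ->
  m <= \int[mu]_x f x <= M.
Proof.
move=> hf h; rewrite -{1}(integral_cst_prob m) -(integral_cst_prob M).
by apply/andP; split; apply: le_integral_bm => //;
  [exact: bounded_measurable_cst|move=> x; case/andP: (h x)|
   exact: bounded_measurable_cst|move=> x; case/andP: (h x)].
Qed.

Lemma integral_sum_bm I (r : seq I) (F : I -> T -> R) : (forall i, bm (F i)) ->
  \int[mu]_x (\sum_(i <- r) F i x) = \sum_(i <- r) \int[mu]_x F i x.
Proof.
move=> h; elim: r => [|i r IH].
  by rewrite big_nil -[RHS]integral_cst_prob; apply: eq_integral_bm => x; rewrite big_nil.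
rewrite big_cons -IH -integralD_bm//; last exact: bounded_measurable_sum.
by apply: eq_integral_bm => x; rewrite big_cons.
Qed.

Lemma integral_indic_bm B : measurable B -> \int[mu]_x (\1_B x : R) = fine (mu B).
Proof. by move=> mB; rewrite /Rintegral integral_indic// setIT. Qed.

Lemma fine_prob_ge0 B : 0 <= fine (mu B).
Proof. exact: fine_ge0. Qed.

Lemma fine_probK B : measurable B -> (fine (mu B))%:E = mu B.
Proof. by move=> mB; rewrite fineK// fin_num_measure. Qed.

Lemma le_fine_prob A B : measurable A -> measurable B -> A `<=` B ->
  fine (mu A) <= fine (mu B).
Proof.
by move=> mA mB AB; rewrite -lee_fin !fine_probK// le_measure// inE.
Qed.

Lemma fine_prob_le1 B : measurable B -> fine (mu B) <= 1.
Proof. by move=> mB; rewrite -lee_fin fine_probK// probability_le1. Qed.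

Lemma integral_finite_valued (F : finType) (X : T -> F) (G : F -> R) :
  (forall a, measurable (X @^-1` [set a])) ->
  bm (G \o X) /\ \int[mu]_x G (X x) = \sum_a G a * fine (mu (X @^-1` [set a])).
Proof.
move=> mX; pose H a (x : T) : R := G a * \1_(X @^-1` [set a]) x.
have hH a : bm (H a) by apply: bounded_measurableZ; exact: bounded_measurable_indic.
have e x : G (X x) = \sum_a H a x.
  rewrite (bigD1 (X x))//= big1 ?addr0 /H ?indicE ?mem_set ?mulr1// => a ax.
  by rewrite indicE memNset ?mulr0// => /= Xa; rewrite Xa eqxx in ax.
split.
  rewrite (_ : G \o X = fun x => \sum_a H a x); last exact/funext.
  exact: bounded_measurable_sum.
rewrite (eq_integral_bm e) integral_sum_bm//; apply: eq_bigr => a _.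
by rewrite integralZ_bm ?integral_indic_bm//; exact: bounded_measurable_indic.
Qed.

Lemma finite_valued_sum1 (F : finType) (X : T -> F) :
  (forall a, measurable (X @^-1` [set a])) -> \sum_a fine (mu (X @^-1` [set a])) = 1.
Proof.
move=> mX; have [_] := integral_finite_valued (fun=> 1) mX.
rewrite integral_cst_prob => e; rewrite [RHS]e.
by apply: eq_bigr => a _; rewrite mul1r.
Qed.

Lemma integral_invariant (h : T -> T) f : measurable_fun setT h ->
  invariant_measure mu h -> bm f -> \int[mu]_x f (h x) = \int[mu]_x f x.
Proof.
move=> mh inv hf; have hfh := bounded_measurable_comp mh hf.
apply/eqP; rewrite -eqe !EFin_Rintegral//; apply/eqP.
rewrite -[LHS](@integral_pushforward _ _ _ _ _ _ mh mu setT (EFin \o f))//.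
- by apply: eq_measure_integral => A mA _ /=; exact: inv.
- exact: measurableT_comp (hf.1).
- exact: bounded_measurable_integrable hfh.
Qed.

End BoundedIntegral.

(** * Gibbs measures *)

Section CylinderMeasure.
Context {R : realType} {k : nat}.
Local Notation letters := 'I_k.+2.
Implicit Types (x y : Omega k) (w : seq letters) (a b : letters) (n : nat).

Definition first_letters n x : seq letters := mkseq x n.

Lemma agree_first_letters n x y : agree n x y <-> first_letters n x = first_letters n y.
Proof.
split=> [h|h i ni].
  by apply/eq_in_map => i; rewrite mem_iota => /andP[_]; exact: h.
by have := congr1 (fun s : seq letters => nth ord0 s i) h; rewrite !nth_mkseq.
Qed.

Lemma first_lettersSr n x : first_letters n.+1 x = rcons (first_letters n x) (x n).
Proof. by rewrite /first_letters /mkseq -[n.+1]addn1 iotaD map_cat cats1. Qed.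

Variable m : seq letters -> R.
Hypotheses (m_ge0 : forall w, 0 <= m w) (m_nil : m [::] = 1).
Hypothesis m_rcons : forall w, \sum_a m (rcons w a) = m w.

(* The word w is assigned the interval [lo w, lo w + m w) of [0, 1); these
   intervals are nested, and ordered lexicographically at each length. *)
Fixpoint lo_rev (r : seq letters) : R :=
  if r is a :: r' then lo_rev r' + \sum_(b < k.+2 | (b < a)%N) m (rcons (rev r') b)
  else 0.
Definition lo w := lo_rev (rev w).
Definition in_cell t w := lo w <= t < lo w + m w.
Definition next_letter t w : letters :=
  odflt ord0 [pick a | in_cell t (rcons w a)].
Fixpoint address t n : seq letters :=
  if n is n'.+1 then rcons (address t n') (next_letter t (address t n')) else [::].
(** The digit expansion of t with respect to the nested intervals. The constant value outside [0, 1)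
    only makes the map total; the uniform distribution does not charge that region. *)
Definition point_of t : Omega k :=
  if (0 <= t < 1) then (fun n => next_letter t (address t n)) else (fun=> ord0).

Let lo_rcons w a : lo (rcons w a) = lo w + \sum_(b < k.+2 | (b < a)%N) m (rcons w b).
Proof. by rewrite /lo rev_rcons /= revK. Qed.

Let cell_next_sum w a : \sum_(b < k.+2 | (b < a)%N) m (rcons w b) + m (rcons w a) <= m w.
Proof.
rewrite -(m_rcons w) [leRHS](bigID (fun b : letters => (b < a)%N))/= lerD2l.
rewrite (bigD1 a) ?ltnn//= lerDl; exact: sumr_ge0.
Qed.

Let lo_rcons_lt w a a' : (a < a')%N -> lo (rcons w a) + m (rcons w a) <= lo (rcons w a').
Proof.
move=> aa; rewrite !lo_rcons -addrA lerD2l [leRHS](bigD1 a)//= addrC lerD2l.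
rewrite [leRHS]big_mkcond [leLHS]big_mkcond; apply: ler_sum => b _.
case: ifP => ba; last by case: ifP.
by rewrite (ltn_trans ba aa)/= (_ : b != a)// neq_ltn ba.
Qed.

Let in_cell_rcons t w a : in_cell t (rcons w a) -> in_cell t w.
Proof.
rewrite /in_cell lo_rcons => /andP[h1 h2]; apply/andP; split.
  by apply: le_trans h1; rewrite lerDl; exact: sumr_ge0.
by apply: (lt_le_trans h2); rewrite -addrA lerD2l.
Qed.

(** The children tile the interval of w from left to right. If t were in none of them, induction on
    the letter would push it past the right end of each child, and the last right end is that of w
    itself. *)
Let next_letter_in t w : in_cell t w -> in_cell t (rcons w (next_letter t w)).
Proof.
move=> tw; rewrite /next_letter; case: pickP => //= none; exfalso.
have {}none a : lo (rcons w a) <= t -> lo (rcons w a) + m (rcons w a) <= t.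
  by move=> h; have := none a; rewrite /in_cell h /= => /negbT; rewrite -leNgt.
have h n (nk : (n <= k.+1)%N) : lo (rcons w (inord n)) <= t.
  elim: n nk => [_|n IH nk].
    rewrite lo_rcons big_pred0 ?addr0; first by case/andP: tw.
    by move=> b; rewrite inordK.
  apply: le_trans (none _ (IH (ltnW nk))); rewrite !lo_rcons -addrA lerD2l.
  rewrite (bigD1 (inord n)) /=; last by rewrite !inordK// ltnW.
  rewrite addrC lerD2r le_eqVlt; apply/orP; left; apply/eqP; apply: eq_bigl => b.
  rewrite !inordK//; last exact: ltnW.
  have -> : (b == inord n) = (nat_of_ord b == n).
    by rewrite -(inj_eq val_inj) /= inordK// ltnW.
  by rewrite ltnS leq_eqVlt; case: ltngtP.
have := none _ (h k.+1 (leqnn _)); apply/negP; rewrite -ltNge.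
have /andP[_ h2] := tw; apply: lt_le_trans h2 _.
rewrite lo_rcons -addrA lerD2l -(m_rcons w) (bigD1 (inord k.+1))//= addrC lerD2r.
rewrite le_eqVlt; apply/orP; left; apply/eqP; apply: eq_bigl => b.
have -> : (b == inord k.+1) = (nat_of_ord b == k.+1).
  by rewrite -(inj_eq val_inj) /= inordK.
by rewrite inordK//; have := ltn_ord b; rewrite ltnS; case: ltngtP.
Qed.

Let address_in t n : 0 <= t < 1 -> in_cell t (address t n).
Proof.
move=> t01; elim: n => [|n IH] /=; last exact: next_letter_in.
by rewrite /in_cell /lo /= m_nil add0r.
Qed.

Let in_cell_address t w : in_cell t w -> address t (size w) = w.
Proof.
elim/last_ind: w => [//|w a IH] tw; have := in_cell_rcons tw => tw'.
rewrite size_rcons /= (IH tw'); congr (rcons _ _).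
have /andP[h1 h2] := next_letter_in tw'; case/andP: tw => h3 h4.
apply/val_inj; have [/(lo_rcons_lt w)|/(lo_rcons_lt w)|//] := ltngtP (next_letter t w) a.
  by move=> h; have := lt_le_trans h2 (le_trans h h3); rewrite ltxx.
by move=> h; have := lt_le_trans h4 (le_trans h h1); rewrite ltxx.
Qed.

Let first_letters_point_of t n : 0 <= t < 1 -> first_letters n (point_of t) = address t n.
Proof.
by move=> t01; elim: n => [//|n IH]; rewrite first_lettersSr IH /= /point_of t01.
Qed.

Let lo_bounds w : 0 <= lo w /\ lo w + m w <= 1.
Proof.
elim/last_ind: w => [|w a [h1 h2]]; first by rewrite /lo /= m_nil add0r.
split; first by rewrite lo_rcons addr_ge0// sumr_ge0.
by apply: le_trans h2; rewrite lo_rcons -addrA lerD2l.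
Qed.

Let point_of_agree n x t : 0 <= t < 1 ->
  agree n x (point_of t) <-> in_cell t (first_letters n x).
Proof.
move=> t01; rewrite agree_first_letters first_letters_point_of//; split=> [->|h].
  exact: address_in.
by have := in_cell_address h; rewrite size_mkseq.
Qed.

Let measurable_point_of :
  measurable_fun setT (point_of : measurableTypeR R -> Omega k).
Proof.
apply: (@measurable_from_agree _ _ (measurableTypeR R)) => n x.
have -> : point_of @^-1` agree n x =
    ([set` `[0, 1[%R] `&` [set` `[lo (first_letters n x), lo (first_letters n x) + m (first_letters n x)[%R])
    `|` (~` [set` `[0, 1[%R] `&` [set t | agree n x (fun=> ord0)]).
  apply/seteqP; split => t /=; rewrite !in_itv /=.
    have [t01 /point_of_agree|t01] := boolP (0 <= t < 1).
      by move=> /(_ t01); left.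
    by rewrite /point_of (negbTE t01); right; split => //; exact/negP.
  move=> [[t01 h]|[/negP t01]]; first exact/point_of_agree.
  by rewrite /point_of (negbTE t01).
apply: measurableU; apply: measurableI => //; first exact: measurableC.
have [h|h] := pselect (agree n x (fun=> ord0)).
  by rewrite (_ : [set t | _] = setT) //; apply/seteqP; split.
by rewrite (_ : [set t | _] = set0) //; apply/seteqP; split.
Qed.

Let mfun_point_of : {mfun measurableTypeR R >-> Omega k} :=
  HB.pack point_of (isMeasurableFun.Build _ _ _ _ _ measurable_point_of).

Let unit_uniform : probability (measurableTypeR R) R := uniform_prob (@ltr01 R).

Let unit_uniform_itv (a b : R) : 0 <= a -> a <= b -> b <= 1 ->
  unit_uniform [set` `[a, b[%R] = (b - a)%:E.
Proof.
move=> a0 ab b1; rewrite /unit_uniform /= /uniform_prob integral_uniform_pdf.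
rewrite setIidl; last first.
  by move=> t /=; rewrite !in_itv /=; lra.
rewrite (eq_integral (cst 1%:E)); last first.
  move=> t /set_mem /=; rewrite in_itv /= /uniform_pdf => /andP[h1 h2].
  by rewrite ifT ?subr0 ?invr1//; lra.
rewrite integral_cst//= mul1e lebesgue_measure_itv /= lte_fin.
case: ltP => // ba; congr (_%:E); lra.
Qed.

(** nu is the law of [point_of] under the uniform distribution on [0, 1): the parameters whose
    address begins with w fill the interval of w, which has length m w. *)
Lemma cylinder_measure_exists : exists nu : probability (Omega k) R,
  forall n x, nu (agree n x) = (m (first_letters n x))%:E.
Proof.
exists (distribution unit_uniform mfun_point_of) => n x.
rewrite /distribution /pushforward /=.
have mB : measurable (point_of @^-1` agree n x : set (measurableTypeR R)).
  by rewrite -[X in measurable X]setTI; apply: measurable_point_of => //; exact: measurable_agree.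
have mI : measurable ([set` `[0, 1[%R] : set (measurableTypeR R)) by exact: measurable_itv.
have := unit_uniform_itv (lexx 0) ler01 (lexx 1); rewrite subr0 => u01.
have u0 : unit_uniform (~` [set` `[0, 1[%R]) = 0%E.
  by rewrite probability_setC// u01 subee.
have -> : unit_uniform (point_of @^-1` agree n x) =
    unit_uniform ((point_of @^-1` agree n x) `&` [set` `[0, 1[%R]).
  rewrite -[X in unit_uniform X = _](setUIDK _ [set` `[0, 1[%R]).
  have mAI := measurableI _ _ mB mI; have mAD := measurableD mB mI.
  rewrite (measureU unit_uniform mAI mAD); last first.
    by apply/seteqP; split => t // [[_ ?] [_ ?]].
  rewrite [X in (_ + X)%E = _](_ : _ = 0%E); first exact: adde0.
  apply: (@subset_measure0 _ _ _ unit_uniform _ (~` [set` `[0, 1[%R])) => //.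
  exact: measurableC.
have [l0 l1] := lo_bounds (first_letters n x).
rewrite (_ : _ `&` _ = [set` `[lo (first_letters n x), lo (first_letters n x) + m (first_letters n x)[%R]).
  rewrite unit_uniform_itv// ?lerDl//; congr (_%:E); lra.
apply/seteqP; split => t /=; rewrite !in_itv /=.
  by move=> [/point_of_agree h /h].
move=> h; have t01 : 0 <= t < 1 by case/andP: h; lra.
by split => //; exact/point_of_agree.
Qed.

End CylinderMeasure.

Section CylinderUnique.
Context {R : realType} {k : nat}.
Implicit Types (x y z : Omega k) (n p : nat).

(** Two cylinders are nested or disjoint, so together with the empty set they form a pi-system, on
    which finite measures are determined. *)
Lemma agree_setI_closed :
  setI_closed [set B : set (Omega k) | B = set0 \/ exists n x, B = agree n x].
Proof.
have h n p x y : (p <= n)%N -> agree n x `&` agree p y = set0 \/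
    exists n' x', agree n x `&` agree p y = agree n' x'.
  move=> pn; have [yx|yx] := pselect (agree p y x).
    right; exists n, x; apply/setIidl => z xz; apply: agree_trans yx _.
    exact: agreeW xz.
  left; apply/seteqP; split => // z [xz yz]; apply: yx.
  by apply: agree_trans yz _; apply: agree_sym; exact: agreeW xz.
move=> A B [->|[n [x ->]]]; first by rewrite set0I; left.
move=> [->|[p [y ->]]]; first by rewrite setI0; left.
by have [pn|/ltnW np] := leqP p n; [exact: h|rewrite setIC; exact: h].
Qed.

Lemma measure_eq_agree (m1 m2 : {measure set (Omega k) -> \bar R}) :
  (m1 setT < +oo)%E -> (forall n x, m1 (agree n x) = m2 (agree n x)) ->
  forall B, measurable B -> m1 B = m2 B.
Proof.
move=> fm1 m12 B mB.
pose G := [set B : set (Omega k) | B = set0 \/ exists n x, B = agree n x].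
have aT : agree 0 (fun=> ord0) = [set: Omega k] by apply/seteqP; split.
apply: (@measure_unique _ _ _ G (fun=> setT)) => //.
- apply/seteqP; split; apply: smallest_sub; try exact: smallest_sigma_algebra.
    move=> U /open_locally_cylinder/locally_cylinder_bigcup[F hF ->].
    apply: (@countable_bigcupT_measurable _ (g_sigma_algebraType G)).
      exact: countableP.
    by move=> w; apply: sub_sigma_algebra; exact: hF.
  move=> U [->|[n [x ->]]]; first exact: (@measurable0 _ (Omega k)).
  exact: measurable_agree.
- exact: agree_setI_closed.
- by move=> i; right; exists 0%N, (fun=> ord0).
- by rewrite bigcup_const.
- by move=> A [->|[n [x ->]]]; rewrite ?measure0.
Qed.

End CylinderUnique.

Section CylinderIndicators.
Context {R : realType} {k : nat}.
Implicit Types (B : set (Omega k)).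

Lemma indic_cylinder n B : cylinder_set n B ->
  forall x y, agree n x y -> \1_B x = \1_B y :> R.
Proof.
move=> cB x y xy; rewrite !indicE; congr (nat_of_bool _)%:R.
by apply/idP/idP => /set_mem h; apply/mem_set; [exact: cB h|exact: cB (agree_sym xy) h].
Qed.

Lemma lip_indic t n B : 0 < t < 1 -> cylinder_set n B -> exists K, lip t K (\1_B : Omega k -> R).
Proof.
move=> /andP[t0 t1] cB; exists (2 * 1 / t ^+ n); apply: lip_cylinder.
- by rewrite t0 ltW.
- by move=> z; rewrite indicE; case: (_ \in _); rewrite ?normr1 ?normr0.
- exact: indic_cylinder.
Qed.

End CylinderIndicators.

(** * The Gibbs measure of a normalized potential *)

Section GibbsMeasure.
Context {R : realType} {k : nat}.
Variables (t C : R) (A : Omega k -> R).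
Hypotheses (t01 : 0 < t < 1) (lipA : lip t C A) (nA : normalized A).
Implicit Types (f phi psi : Omega k -> R) (x y z : Omega k) (n p : nat).

Local Notation sh := (@shift_map k).
Local Notation L := (transfer A).
Local Notation Lam := (gibbs_functional A).
Local Notation D := (C / (1 - t)).

Definition splice n x z : Omega k := fun i => if (i < n)%N then x i else z (i - n)%N.

Lemma agree_splice n x z : agree n x (splice n x z).
Proof. by move=> i ni; rewrite /splice ni. Qed.

Lemma spliceS n x z : splice n.+1 x z = scons (x 0%N) (splice n (sh x) z).
Proof. by apply/funext => -[|i]. Qed.

Lemma agreeSP n x y : agree n.+1 x y <-> x 0%N = y 0%N /\ agree n (sh x) (sh y).
Proof.
by split=> [h|[h0 h] [|i]//]; [split=> [|i ni]; exact: h|rewrite ltnS; exact: h].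
Qed.

Lemma lip_agree n x : exists K, lip t K (\1_(agree n x) : Omega k -> R).
Proof. exact: lip_indic t01 (@cylinder_set_agree _ n x). Qed.

(** Exactly one inverse branch of length n over z meets the cylinder of x, namely [splice n x z]. *)
Lemma iter_transfer_agree n x (g : Omega k -> R) z :
  iter n L (fun y => g y * \1_(agree n x) y) z =
  expR (birkhoff A n (splice n x z)) * g (splice n x z).
Proof.
elim: n x g => [|n IH] x g.
  rewrite birkhoff0 expR0 mul1r /= indicE mem_set// mulr1; congr (g _).
  by apply/funext => i; rewrite /splice subn0.
(* The weight of the first letter goes into g', which leaves a cylinder of length n about [sh x]. *)
pose g' y := expR (A (scons (x 0%N) y)) * g (scons (x 0%N) y).
rewrite iterSr (@eq_iter_transfer _ _ _ _ _ (fun y => g' y * \1_(agree n (sh x)) y)).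
  rewrite IH /g' -spliceS mulrA -expRD -[n.+1]add1n birkhoffD.
  rewrite [birkhoff A 1 _]birkhoffSr birkhoff0 add0r add1n /= spliceS.
  by rewrite addrC.
move=> y; rewrite /transfer (bigD1 (x 0%N))//= big1 ?addr0; last first.
  move=> a ax; rewrite indicE memNset ?mulr0// => /agreeSP[/= xa _].
  by rewrite -xa eqxx in ax.
rewrite -mulrA; congr (_ * (_ * _)); rewrite !indicE; congr (nat_of_bool _)%:R.
by apply/idP/idP => /set_mem h; apply/mem_set; [case/agreeSP: h|exact/agreeSP].
Qed.

Lemma gibbs_functional_sum I (r : seq I) (F : I -> Omega k -> R) :
  (forall i, exists K, lip t K (F i)) ->
  Lam (fun z => \sum_(i <- r) F i z) = \sum_(i <- r) Lam (F i).
Proof.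
move=> hF; suff [K [hK ->//]] : exists K, lip t K (fun z => \sum_(i <- r) F i z) /\
    Lam (fun z => \sum_(i <- r) F i z) = \sum_(i <- r) Lam (F i).
elim: r => [|i r [K [hK IH]]].
  exists 0; rewrite (_ : (fun z => _) = fun=> 0).
    rewrite big_nil; split; first exact: lip_cst.
    have /andP[h1 h2] : 0 <= Lam (fun=> 0) <= 0.
      by apply: (gibbs_functional_bounds t01 lipA nA (@lip_cst R k t 0)) => z; rewrite lexx.
    by apply/eqP; rewrite eq_le h1 h2.
  by apply/funext => z; rewrite big_nil.
have [K' hK'] := hF i; exists (K' + K).
rewrite (_ : (fun z => _) = fun z => F i z + \sum_(i <- r) F i z).
  split; first exact: lipD.
  by rewrite big_cons -IH; exact: (gibbs_functionalD t01 lipA nA hK' hK).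
by apply/funext => z; rewrite big_cons.
Qed.

(** The functional does not change under L^n, and L^n maps the indicator to exp (S_n A) along the
    single branch in the cylinder, which distortion compares with the value at y. *)
Lemma gibbs_functional_agree n x y : agree n x y ->
  expR (birkhoff A n y - D) <= Lam (\1_(agree n x)) <= expR (birkhoff A n y + D).
Proof.
move=> xy; have [K hK] := lip_agree n x.
have /(_ n) <- : forall j, Lam (iter j L (\1_(agree n x))) = Lam (\1_(agree n x)).
  elim=> [//|j IH]; rewrite iterS -IH.
  have [K' hK'] := iter_transfer_lip t01 lipA nA hK.
  exact: (gibbs_functional_transfer t01 lipA nA (hK' j)).
have [K' hK'] := iter_transfer_lip t01 lipA nA hK.
apply: (gibbs_functional_bounds t01 lipA nA (hK' n)) => z.
have := iter_transfer_agree n x (fun=> 1) z; rewrite mulr1.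
rewrite (@eq_iter_transfer _ _ _ _ _ (\1_(agree n x))); last by move=> u; rewrite mul1r.
move=> ->; rewrite !ler_expR.
have h : agree n y (splice n x z).
  by apply: (agree_trans (agree_sym xy)); exact: agree_splice.
by have := distortion t01 lipA h; rewrite ler_norml; lra.
Qed.

Lemma indic_agreeSr n x y :
  \1_(agree n x) y = \sum_a (\1_(agree n.+1 (splice n x (fun=> a))) y : R).
Proof.
rewrite (bigD1 (y n))//= big1 ?addr0; last first.
  move=> a ay; rewrite indicE memNset// => /(_ n (ltnSn _)).
  by rewrite /splice ltnn => ya; rewrite ya eqxx in ay.
rewrite !indicE; congr (nat_of_bool _)%:R.
apply/idP/idP => /set_mem h; apply/mem_set; last first.
  apply: agree_trans (@agree_splice n x (fun=> y n)) _; exact: agreeW h.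
move=> i; rewrite ltnS leq_eqVlt => /orP[/eqP->|ni]; first by rewrite /splice ltnn.
by rewrite /splice ni h.
Qed.

(** Prepending a letter serves the shift invariance of the measure, as appending one in
    [indic_agreeSr] serves the consistency of its weights. *)
Lemma indic_agree_shift n x y :
  \1_(agree n x) (sh y) = \sum_a (\1_(agree n.+1 (scons a x)) y : R).
Proof.
rewrite (bigD1 (y 0%N))//= big1 ?addr0; last first.
  move=> a ay; rewrite indicE memNset// => /(_ 0%N isT) /= ya.
  by rewrite ya eqxx in ay.
rewrite !indicE; congr (nat_of_bool _)%:R.
by apply/idP/idP => /set_mem h; apply/mem_set; [exact/agreeSP|case/agreeSP: h].
Qed.

Lemma gibbs_measure_exists : exists nu : probability (Omega k) R,
  invariant_measure nu sh /\
  forall n x y, agree n x y ->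
    expR (birkhoff A n y - D) <= fine (nu (agree n x)) <= expR (birkhoff A n y + D).
Proof.
(* The word w is represented by the point [nth ord0 w], which continues it with the letter 0. *)
pose m (w : seq 'I_k.+2) := Lam (\1_(agree (size w) (nth ord0 w))).
have agree_pt n x : agree n x (nth ord0 (first_letters n x)).
  by move=> i ni; rewrite nth_mkseq.
have mE n x : m (first_letters n x) = Lam (\1_(agree n x)).
  by rewrite /m size_mkseq -(agree_setE (agree_pt n x)).
have m0 w : 0 <= m w.
  by have /andP[h _] := gibbs_functional_agree (@agreexx _ (size w) (nth ord0 w));
    apply: le_trans h; exact: expR_ge0.
have m1 : m [::] = 1.
  rewrite /m (_ : \1_ _ = fun=> 1); last by apply/funext => y; rewrite indicE mem_set.
  have /andP[h1 h2] : 1 <= Lam (fun=> 1) <= 1.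
    by apply: (gibbs_functional_bounds t01 lipA nA (@lip_cst R k t 1)) => z; rewrite lexx.
  by apply/eqP; rewrite eq_le h1 h2.
have mr w : \sum_a m (rcons w a) = m w.
  rewrite {2}/m (_ : \1_ _ = fun y => \sum_a \1_(agree (size w).+1
    (splice (size w) (nth ord0 w) (fun=> a))) y); last first.
    by apply/funext => y; exact: indic_agreeSr.
  rewrite gibbs_functional_sum; last by move=> a; exact: lip_agree.
  apply: eq_bigr => a _; rewrite /m size_rcons; congr (Lam (\1_ _)).
  apply: agree_setE => i ni; rewrite nth_rcons /splice.
  by case: ltnP => // wi; rewrite ifT// eqn_leq wi andbT -ltnS.
have [nu hnu] := cylinder_measure_exists m0 m1 mr; exists nu; split; last first.
  by move=> n x y xy; rewrite hnu mE /=; exact: gibbs_functional_agree.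
have msh : measurable_fun setT sh := measurable_shift.
pose msh' : {mfun Omega k >-> Omega k} :=
  HB.pack sh (isMeasurableFun.Build _ _ _ _ sh msh).
have fnu : (nu setT < +oo)%E by exact: le_lt_trans (probability_le1 nu measurableT) (ltry _).
move=> B mB; apply/esym.
apply: (@measure_eq_agree R k nu (distribution nu msh')) => // n x.
rewrite /distribution /pushforward /=.
have mpre : measurable (sh @^-1` agree n x).
  by rewrite -[X in measurable X]setTI; apply: measurable_shift => //; exact: measurable_agree.
rewrite -[RHS](fine_probK nu)// hnu; congr (_%:E).
rewrite mE -integral_indic_bm//.
rewrite (@eq_integral_bm _ _ _ _ _ (fun y => \sum_a \1_(agree n.+1 (scons a x)) y)); last first.
  by move=> y; rewrite -indic_agree_shift !indicE.
rewrite integral_sum_bm; last first.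
  by move=> a; apply: bounded_measurable_indic; exact: measurable_agree.
have [K hK] := lip_agree n x.
rewrite -(gibbs_functional_shift t01 lipA nA hK).
rewrite (_ : _ \o _ = fun y => \sum_a (\1_(agree n.+1 (scons a x)) y : R)); last first.
  by apply/funext => y; exact: indic_agree_shift.
rewrite gibbs_functional_sum; last by move=> a; exact: lip_agree.
apply: eq_bigr => a _; rewrite integral_indic_bm; last exact: measurable_agree.
by rewrite hnu mE.
Qed.

End GibbsMeasure.

(** * Entropy and pressure *)

Section CylinderApproximation.
Context {R : realType} {k : nat}.
Variable mu : probability (Omega k) R.
Implicit Types (B U : set (Omega k)).

Let sdiff B B' := (B `\` B') `|` (B' `\` B).

Let msdiff B B' : measurable B -> measurable B' -> measurable (sdiff B B').
Proof. by move=> mB mB'; apply: measurableU; exact: measurableD. Qed.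

Let approximable := [set B | measurable B /\ forall e, 0 < e ->
  exists n B', cylinder_set n B' /\ fine (mu (sdiff B B')) <= e].

Let le_fine_probU B1 B2 : measurable B1 -> measurable B2 ->
  fine (mu (B1 `|` B2)) <= fine (mu B1) + fine (mu B2).
Proof.
move=> m1 m2; rewrite -lee_fin EFinD !fine_probK//; last exact: measurableU.
exact: measureU2.
Qed.

Let approximable_limit (F : (set (Omega k))^nat) :
  nondecreasing_seq F -> (forall n, approximable (F n)) -> approximable (\bigcup_n F n).
Proof.
move=> ndF hF; have mF n : measurable (F n) by case: (hF n).
have mU : measurable (\bigcup_n F n) by exact: bigcupT_measurable.
split=> // e e0.
have : fine (mu (F n)) @[n --> \oo] --> fine (mu (\bigcup_n F n)).
  apply: fine_cvg; rewrite fine_probK//; exact: nondecreasing_cvg_mu.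
move=> /cvgrPdist_le /(_ (e / 2)); rewrite divr_gt0// => /(_ isT).
move=> [N _ /(_ N (leqnn N))] hN.
have [_ /(_ (e / 2))] := hF N; rewrite divr_gt0// => /(_ isT) [n [B' [cB' hB']]].
have mB' := measurable_cylinder_set cB'.
exists n, B'; split=> //.
have sub : sdiff (\bigcup_n F n) B' `<=` ((\bigcup_n F n) `\` F N) `|` sdiff (F N) B'.
  move=> x [[[i _ Fi] nB']|[Bx nU]].
    by have [FN|FN] := pselect (F N x); [right; left|left; split => //; exists i].
  by right; right; split=> // FN; apply: nU; exists N.
apply: le_trans (le_fine_prob mu _ _ sub) _; [exact: msdiff| |].
  by apply: measurableU; [exact: measurableD|exact: msdiff].
apply: le_trans (le_fine_probU _ _) _; [exact: measurableD|exact: msdiff|].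
have -> : fine (mu ((\bigcup_n F n) `\` F N)) = fine (mu (\bigcup_n F n)) - fine (mu (F N)).
  apply/eqP; rewrite eq_sym subr_eq -eqe EFinD !fine_probK//; last exact: measurableD.
  rewrite -measureU//; last 2 first.
  - exact: measurableD.
  - by apply/seteqP; split => x // [[_ h] /h].
  by rewrite setUC setDUK// => x Fx; exists N.
by have := le_trans (ler_norm _) hN; lra.
Qed.

Let approximableC B : approximable B -> approximable (~` B).
Proof.
move=> [mB hB]; split; first exact: measurableC.
move=> e /hB [n [B' [cB' h]]]; exists n, (~` B'); split; first exact: cylinder_setC.
suff -> : sdiff (~` B) (~` B') = sdiff B B' by [].
apply/seteqP; split => x [[h1 h2]|[h1 h2]]; [right|left|right|left]; split => //;
  by [exact: contrapT|move=> h; exact: h].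
Qed.

Let approximableU B1 B2 : approximable B1 -> approximable B2 -> approximable (B1 `|` B2).
Proof.
move=> [m1 h1] [m2 h2]; split; first exact: measurableU.
move=> e e0; have e2 : 0 < e / 2 by rewrite divr_gt0.
have [n [B1' [c1 s1]]] := h1 _ e2; have [p [B2' [c2 s2]]] := h2 _ e2.
have m1' := measurable_cylinder_set c1; have m2' := measurable_cylinder_set c2.
exists (maxn n p), (B1' `|` B2'); split.
  move=> x y xy [/(cylinder_setW (leq_maxl n p) c1 xy)|]; first by left.
  by move=> /(cylinder_setW (leq_maxr n p) c2 xy); right.
have sub : sdiff (B1 `|` B2) (B1' `|` B2') `<=` sdiff B1 B1' `|` sdiff B2 B2'.
  by move=> x [[[h|h] nh]|[[h|h] nh]]; [left; left|right; left|left; right|right; right];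
    split=> // h'; apply: nh; [left|right|left|right].
apply: le_trans (le_fine_prob mu _ _ sub) _.
- by apply: msdiff; exact: measurableU.
- by apply: measurableU; exact: msdiff.
by apply: le_trans (le_fine_probU _ _) _; [exact: msdiff|exact: msdiff|lra].
Qed.

Let approximable_cylinder n B : cylinder_set n B -> approximable B.
Proof.
move=> cB; split; first exact: measurable_cylinder_set cB.
move=> e e0; exists n, B; split=> //.
by rewrite /sdiff setDv setU0 measure0 ltW.
Qed.

(** The approximable sets form a sigma-algebra that contains the open sets. Countable unions are
    reduced to increasing ones, where continuity of mu from below gives one half of the error and a
    single member of the sequence the other half. *)
Lemma cylinder_approximation B : measurable B -> forall e, 0 < e ->
  exists n B', cylinder_set n B' /\
    fine (mu ((B `\` B') `|` (B' `\` B))) <= e.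
Proof.
suff h : <<s @open (Omega k) >> `<=` approximable by move=> /h[_ hB] e /hB.
apply: smallest_sub; last first.
  move=> U /open_locally_cylinder hU.
  have -> : U = \bigcup_n [set x | agree n x `<=` U].
    apply/seteqP; split => x; first by move=> /hU [n h]; exists n.
    by move=> [n _]; apply; exact: agreexx.
  apply: approximable_limit => [n p np|n].
    by apply/subsetPset => x h y xy; apply: h; exact: agreeW xy.
  apply: (@approximable_cylinder n) => x y xy h z yz; apply: h; exact: agree_trans xy yz.
split.
- by apply: (@approximable_cylinder 0).
- by move=> U; rewrite setTD; exact: approximableC.
move=> F hF; rewrite -bigcup_bigsetU_bigcup.
apply: approximable_limit => [n p np|n]; first exact/subsetPset/subset_bigsetU.
elim: n => [|n IH] /=; last by rewrite big_ord_recr/=; exact: approximableU.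
by rewrite big_ord1; exact: hF.
Qed.

(** Each atom is replaced by a cylinder set up to measure e / m, and eta x is some j whose cylinder
    set contains x. Off the m symmetric differences the only such j is xi x, so the default letter
    and the choice of j matter only inside B. *)
Lemma partition_approximation m (xi : Omega k -> 'I_m) :
  (forall j, measurable (xi @^-1` [set j])) -> forall e, 0 < e ->
  exists n (eta : Omega k -> 'I_m), (forall x y, agree n x y -> eta x = eta y) /\
    exists2 B, measurable B & (forall x, ~ B x -> xi x = eta x) /\ fine (mu B) <= e.
Proof.
move=> mxi e e0.
have m0 : (0 < m)%N by exact: leq_ltn_trans (leq0n _) (ltn_ord (xi (fun=> ord0))).
have em : 0 < e / m%:R by rewrite divr_gt0 ?ltr0n.
have h j := cylinder_approximation (mxi j) em.
pose n j := projT1 (cid (h j)).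
pose B' j := projT1 (cid (projT2 (cid (h j)))).
have hB' j : cylinder_set (n j) (B' j) /\
    fine (mu (sdiff (xi @^-1` [set j]) (B' j))) <= e / m%:R.
  exact: (projT2 (cid (projT2 (cid (h j))))).
pose N := (\max_j n j)%N.
exists N, (fun x => odflt (Ordinal m0) [pick j | `[< B' j x >]]); split.
  move=> x y xy; congr (odflt _ _); apply: eq_pick => j /=; apply/asbool_equiv_eq.
  have c := cylinder_setW (leq_bigmax j : n j <= N)%N (hB' j).1.
  by split; apply: c => //; exact: agree_sym.
exists (\big[setU/set0]_j sdiff (xi @^-1` [set j]) (B' j)).
  apply: bigsetU_measurable => j _; apply: msdiff => //.
  exact: measurable_cylinder_set (hB' j).1.
split.
  move=> x nx; have hx j : ~ sdiff (xi @^-1` [set j]) (B' j) x.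
    by move=> hj; apply: nx; rewrite -bigcup_seq; exists j => //=; rewrite mem_index_enum.
  have xB : B' (xi x) x by apply: contrapT => nB; apply: (hx (xi x)); left.
  case: pickP => /= [j /asboolP Bj|/(_ (xi x))]; last by move/asboolP.
  by apply: contrapT => nj; apply: (hx j); right; split => //= e'; apply: nj.
have sub (s : seq 'I_m) : fine (mu (\big[setU/set0]_(j <- s) sdiff (xi @^-1` [set j]) (B' j)))
   <= \sum_(j <- s) e / m%:R.
  elim: s => [|j s IH]; first by rewrite !big_nil measure0.
  have mj i : measurable (sdiff (xi @^-1` [set i]) (B' i)).
    apply: msdiff => //; exact: measurable_cylinder_set (hB' i).1.
  rewrite !big_cons; apply: le_trans (le_fine_probU _ _) _ => //.
    exact: bigsetU_measurable.
  by apply: lerD => //; case: (hB' j).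
apply: le_trans (sub _) _; rewrite sumr_const card_ord -[leLHS]mulr_natr divfK//.
by rewrite pnatr_eq0 -lt0n.
Qed.

End CylinderApproximation.

Section ItineraryEntropy.
Context {d : measure_display} {T : measurableType d} {R : realType}.
Variables (mu : probability T R) (f : T -> T).
Hypothesis mf : measurable_fun setT f.

Definition itinerary_of m (xi : T -> 'I_m) n (x : T) : {ffun 'I_n -> 'I_m} :=
  [ffun i : 'I_n => xi (iter i f x)].

Lemma itineraryE m (xi : T -> 'I_m) n (w : {ffun 'I_n -> 'I_m}) :
  itinerary f xi w = itinerary_of xi n @^-1` [set w].
Proof.
apply/seteqP; split => x /=; first by move=> h; apply/ffunP => i; rewrite ffunE h.
by move=> <- i; rewrite ffunE.
Qed.

Lemma measurable_itinerary m (xi : T -> 'I_m) n (w : {ffun 'I_n -> 'I_m}) :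
  (forall j, measurable (xi @^-1` [set j])) ->
  measurable (itinerary_of xi n @^-1` [set w]).
Proof.
move=> mxi; rewrite -itineraryE.
rewrite (_ : itinerary f xi w = \bigcap_(i in [set: 'I_n]) (iter i f @^-1` (xi @^-1` [set w i]))).
  apply: fin_bigcap_measurable => [|i _]; first exact: finite_finset.
  by rewrite -[X in measurable X]setTI; exact: measurable_iter.
by apply/seteqP; split => x; [move=> h i _; exact: h|move=> h i; exact: h].
Qed.

Lemma join_entropyE m (xi : T -> 'I_m) n : (forall j, measurable (xi @^-1` [set j])) ->
  join_entropy mu f xi n =
  - (\int[mu]_x ln (fine (mu (itinerary f xi (itinerary_of xi n x))))).
Proof.
move=> mxi.
have [_ ->] := integral_finite_valued mu (fun w => ln (fine (mu (itinerary f xi w))))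
  (fun w => @measurable_itinerary m xi n w mxi).
by rewrite /join_entropy; congr (- _); apply: eq_bigr => w _; rewrite -itineraryE mulrC.
Qed.

(* The entropy of X is at most that of (X, Y), so a sub-probability q on the pairs bounds it. *)
Lemma gibbs_inequality (F G : finType) (X : T -> F) (Y : T -> G) (q : F * G -> R) :
  (forall a, measurable (X @^-1` [set a])) -> (forall b, measurable (Y @^-1` [set b])) ->
  (forall c, 0 < q c) -> \sum_c q c <= 1 ->
  - (\int[mu]_x ln (fine (mu (X @^-1` [set X x])))) <= - (\int[mu]_x ln (q (X x, Y x))).
Proof.
move=> mX mY q0 q1; pose Z x := (X x, Y x).
have ZE c : Z @^-1` [set c] = X @^-1` [set c.1] `&` Y @^-1` [set c.2].
  apply/seteqP; split => x /=; first by move=> <-.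
  by rewrite /Z => -[-> ->]; case: c.
have mZ c : measurable (Z @^-1` [set c]) by rewrite ZE; exact: measurableI.
have [_ h1] := integral_finite_valued mu (fun c => ln (fine (mu (X @^-1` [set c.1])))) mZ.
have [_ h2] := integral_finite_valued mu (fun c => ln (q c)) mZ.
have -> := h1 : \int[mu]_x ln (fine (mu (X @^-1` [set X x]))) = _.
have -> := h2 : \int[mu]_x ln (q (X x, Y x)) = _.
rewrite lerN2 -subr_le0 -sumrB.
have s1 := finite_valued_sum1 mu mZ.
apply: (@le_trans _ _ (\sum_c (q c - fine (mu (Z @^-1` [set c]))))).
  apply: ler_sum => c _; rewrite -mulrBl.
  set p := fine (mu (Z @^-1` [set c])); set r := fine (mu (X @^-1` [set c.1])).
  have pr : p <= r by apply: le_fine_prob => //; rewrite ZE; exact: subIsetl.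
  have p0 : 0 <= p by exact: fine_prob_ge0.
  have [->|pn0] := eqVneq p 0; first by rewrite mulr0 subr0 ltW.
  have pp : 0 < p by rewrite lt_neqAle eq_sym pn0.
  have rp : 0 < r by exact: lt_le_trans pr.
  rewrite -ln_div ?posrE//.
  (* ln v <= v - 1 at v = q c / r; since p <= r, the resulting bound is at most q c - p, and these
     differences have a sum <= 0. *)
  have /le_trans : ln (q c / r) * p <= (q c / r - 1) * p.
    rewrite ler_wpM2r// lerBrDr addrC; apply: le_trans (expR_ge1Dx _) _.
    by rewrite lnK// posrE divr_gt0.
  apply; rewrite mulrBl mul1r lerD2r mulrAC ler_pdivrMr//.
  by rewrite ler_wpM2l// ltW.
by rewrite sumrB s1 subr_le0.
Qed.

End ItineraryEntropy.

Section Pressure.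
Context {R : realType} {k : nat}.
Implicit Types (f phi psi A : Omega k -> R) (x y z : Omega k) (n p : nat).
Implicit Types mu : probability (Omega k) R.

Local Notation sh := (@shift_map k).
Local Notation bm := bounded_measurable.

Lemma bounded_measurable_lip t C phi : 0 < t < 1 -> lip t C phi -> bm phi.
Proof.
move=> t01 h; split; first exact: measurable_lip h.
exists (`|phi (fun=> ord0)| + C) => x; exact: lip_bounded h x.
Qed.

Lemma bounded_measurable_iter_shift phi n : bm phi -> bm (fun x => phi (iter n sh x)).
Proof. exact: (bounded_measurable_comp (measurable_iter_shift n)). Qed.

Lemma bounded_measurable_birkhoff phi n : bm phi -> bm (birkhoff phi n).
Proof.
by move=> h; apply: bounded_measurable_sum => i; exact: bounded_measurable_iter_shift.
Qed.

Lemma integral_iter_shift mu phi n : invariant_measure mu sh -> bm phi ->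
  \int[mu]_x phi (iter n sh x) = \int[mu]_x phi x.
Proof.
move=> inv h; elim: n => [//|n IH]; rewrite -IH.
rewrite -(integral_invariant measurable_shift inv (bounded_measurable_iter_shift n h)).
by apply: eq_integral_bm => x; rewrite -iterSr.
Qed.

Lemma integral_birkhoff mu phi n : invariant_measure mu sh -> bm phi ->
  \int[mu]_x birkhoff phi n x = n%:R * \int[mu]_x phi x.
Proof.
move=> inv h; rewrite /birkhoff integral_sum_bm; last first.
  by move=> i; exact: bounded_measurable_iter_shift.
rewrite (eq_bigr (fun=> \int[mu]_x phi x)).
  by rewrite sumr_const card_ord mulr_natl.
by move=> i _; exact: integral_iter_shift.
Qed.

Definition letters n x : {ffun 'I_n -> 'I_k.+2} := [ffun i : 'I_n => x i].

Lemma letters_agree n x y : letters n x = letters n y <-> agree n x y.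
Proof.
split=> [h i ni|h]; last by apply/ffunP => i; rewrite !ffunE h.
by have := congr1 (fun w : {ffun 'I_n -> 'I_k.+2} => w (Ordinal ni)) h; rewrite !ffunE.
Qed.

Definition extend n (w : {ffun 'I_n -> 'I_k.+2}) : Omega k :=
  fun i => if insub i is Some j then w j else ord0.

Lemma lettersK n w : letters n (extend w) = w.
Proof. by apply/ffunP => i; rewrite ffunE /extend valK. Qed.

Lemma letters_preimage n w : letters n @^-1` [set w] = agree n (extend w).
Proof.
apply/seteqP; split => x /=; last by move/letters_agree; rewrite lettersK.
by move=> h; apply/letters_agree; rewrite lettersK.
Qed.

Lemma measurable_letters n w : measurable (letters n @^-1` [set w]).
Proof. rewrite letters_preimage; exact: measurable_agree. Qed.

Section Bounds.
Variables (t C : R) (A : Omega k -> R).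
Hypotheses (t01 : 0 < t < 1) (lipA : lip t C A) (nA : normalized A).
Local Notation D := (C / (1 - t)).

Let bA : bm A. Proof. exact: bounded_measurable_lip t01 lipA. Qed.

Lemma normalized_le0 x : A x <= 0.
Proof.
rewrite -[A x]expRK -[leRHS]ln1 ler_ln ?posrE ?expR_gt0//.
rewrite (_ : x = scons (x 0%N) (sh x)); last by apply/funext => -[|].
rewrite -(nA (sh x)) (bigD1 (x 0%N))//= lerDl.
by apply: sumr_ge0 => a _; exact: expR_ge0.
Qed.

Let gibbs_lower (nu : probability (Omega k) R) := forall n x y, agree n x y ->
  expR (birkhoff A n y - D) <= fine (nu (agree n x)) <= expR (birkhoff A n y + D).

(** The partition by the first letter suffices: its n-th join consists of the cylinders of length n,
    where - ln nu equals - S_n A up to D, so the join entropy is - n int A dnu up to D. *)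
Lemma ks_entropy_gibbs nu : invariant_measure nu sh -> gibbs_lower nu ->
  ((- (\int[nu]_x A x))%:E <= ks_entropy nu sh)%E.
Proof.
move=> inv hnu; apply: ereal_sup_ubound.
pose xi (x : Omega k) : 'I_k.+2 := x 0%N.
have mxi j : measurable (xi @^-1` [set j]).
  rewrite (_ : xi @^-1` [set j] = agree 1 (fun=> j)); first exact: measurable_agree.
  apply/seteqP; split => x /=; last by move=> /(_ 0%N isT).
  by move=> <- [|].
exists k.+2, xi; split => //; congr (_%:E); apply/esym/cvg_lim => //.
have h n : `|join_entropy nu sh xi n - n%:R * - (\int[nu]_x A x)| <= D.
  rewrite join_entropyE//; last exact: measurable_shift.
  rewrite mulrN opprK addrC -integral_birkhoff// -integralB_bm//; last 2 first.
  - exact: bounded_measurable_birkhoff.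
  - by have [] := integral_finite_valued nu
      (fun w => ln (fine (nu (itinerary sh xi w))))
      (fun w => @measurable_itinerary _ _ sh measurable_shift _ xi n w mxi).
  have e x : itinerary sh xi (itinerary_of sh xi n x) = agree n x.
    apply/seteqP; split => y /=.
      by move=> h i ni; have := h (Ordinal ni); rewrite ffunE /xi !iter_shiftE !addn0.
    by move=> h i; rewrite ffunE /xi !iter_shiftE !addn0 h.
  rewrite ler_norml; apply: integral_bounds.
    apply: bounded_measurableB; first exact: bounded_measurable_birkhoff.
    by have [] := integral_finite_valued nu
      (fun w => ln (fine (nu (itinerary sh xi w))))
      (fun w => @measurable_itinerary _ _ sh measurable_shift _ xi n w mxi).
  move=> x; rewrite e; have /andP[h1 h2] := hnu n x x (@agreexx _ _ _).
  have p0 : 0 < fine (nu (agree n x)) by exact: lt_le_trans (expR_gt0 _) h1.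
  have l1 : birkhoff A n x - D <= ln (fine (nu (agree n x))) by rewrite -ler_expR lnK.
  have l2 : ln (fine (nu (agree n x))) <= birkhoff A n x + D by rewrite -ler_expR lnK.
  lra.
apply/cvgrPdist_le => e e0; near=> n.
have n0 : 0 < n%:R :> R by rewrite ltr0n; near: n; exact: nbhs_infty_gt.
have n1 : n%:R != 0 :> R by rewrite gt_eqF.
have -> : - (\int[nu]_x A x) - n%:R^-1 * join_entropy nu sh xi n =
    n%:R^-1 * (n%:R * - (\int[nu]_x A x) - join_entropy nu sh xi n).
  by rewrite mulrBr mulKf.
rewrite normrM distrC ger0_norm ?invr_ge0 ?(ltW n0)// ler_pdivrMl//.
apply: le_trans (h n) _; rewrite -ler_pdivrMr//.
by near: n; exact: nbhs_infty_ger.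
Unshelve. all: by end_near. Qed.


Let exp_half_lt1 (tau : R) : 0 < tau -> 0 < expR (- (tau / 2)) < 1.
Proof. by move=> h; rewrite expR_gt0 -[ltRHS]expR0 ltr_expR oppr_lt0 divr_gt0. Qed.

(* The code of a pair (w, b) with w a xi-itinerary and b a word of n + N letters:
   b is weighted by a Gibbs measure, and w by guessing that xi = eta. *)
Lemma join_entropy_le mu m (xi : Omega k -> 'I_m) (tau : R) :
  invariant_measure mu sh -> (forall j, measurable (xi @^-1` [set j])) -> 0 < tau ->
  exists N, forall n, join_entropy mu sh xi n <=
    n%:R * (- (\int[mu]_x A x) + tau) + (D - N%:R * \int[mu]_x A x).
Proof.
move=> inv mxi tau0.
have m0 : (0 < m)%N by exact: leq_ltn_trans (leq0n _) (ltn_ord (xi (fun=> ord0))).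
have /andP[u0 u1] := exp_half_lt1 tau0.
set u := expR (- (tau / 2)) in u0 u1.
have em0 : 0 < (1 - u) / m%:R by rewrite divr_gt0 ?subr_gt0 ?ltr0n.
have em1 : (1 - u) / m%:R <= 1.
  rewrite ler_pdivrMr ?ltr0n// mul1r; apply: (@le_trans _ _ 1); first lra.
  by rewrite ler1n.
(* A right guess has weight u and costs tau / 2; a wrong one has weight (1 - u) / m and costs M.
   Guessing wrongly only on a set of measure at most tau / 2 / (M + 1) keeps the expected cost per
   step below tau; M + 1 avoids a division by zero. *)
pose M := - ln ((1 - u) / m%:R).
have M0 : 0 <= M by rewrite /M oppr_ge0 -ln1 ler_ln ?posrE.
have dt : 0 < tau / 2 / (M + 1) by rewrite !divr_gt0//; lra.
have [N [eta [heta [B mB [hB muB]]]]] := partition_approximation mu mxi dt.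
pose g y : R := tau / 2 + M * \1_B y.
have bg : bm g.
  apply: bounded_measurableD; first exact: bounded_measurable_cst.
  by apply: bounded_measurableZ; exact: bounded_measurable_indic.
have ig : \int[mu]_x g x <= tau.
  rewrite integralD_bm ?integral_cst_prob ?integralZ_bm ?integral_indic_bm//.
  - have : M * fine (mu B) <= M * (tau / 2 / (M + 1)) by rewrite ler_wpM2l.
    have : M * (tau / 2 / (M + 1)) <= tau / 2.
      by rewrite mulrA ler_pdivrMr; [|lra]; rewrite mulrC ler_wpM2l//; lra.
    lra.
  - exact: bounded_measurable_indic.
  - exact: bounded_measurable_cst.
  - by apply: bounded_measurableZ; exact: bounded_measurable_indic.
have [nu [_ hnu]] := gibbs_measure_exists t01 lipA nA.
exists N => n.
pose X := itinerary_of sh xi n; pose Y := letters (n + N).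
pose theta (j j' : 'I_m) := if j == j' then u else (1 - u) / m%:R.
have theta0 j j' : 0 < theta j j' by rewrite /theta; case: ifP.
have theta1 j' : \sum_j theta j j' <= 1.
  rewrite (bigD1 j')//= /theta eqxx -lerBrDl.
  rewrite (eq_bigr (fun=> (1 - u) / m%:R)); last by move=> j /negbTE ->.
  apply: (@le_trans _ _ (\sum_(j < m) (1 - u) / m%:R)).
    rewrite [leRHS](bigD1 j')//= lerDr; exact: ltW.
  by rewrite sumr_const card_ord -[leLHS]mulr_natr divfK// pnatr_eq0 -lt0n.
(* Since eta reads N letters, the n + N letters of b determine eta along the first n shifts. *)
pose q (c : {ffun 'I_n -> 'I_m} * {ffun 'I_(n + N) -> 'I_k.+2}) :=
  fine (nu (agree (n + N) (extend c.2))) *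
  \prod_(i < n) theta (c.1 i) (eta (iter i sh (extend c.2))).
have nu0 x : 0 < fine (nu (agree (n + N) x)).
  by have /andP[h _] := hnu _ x x (@agreexx _ (n + N) x); apply: lt_le_trans h; exact: expR_gt0.
have q0 c : 0 < q c by rewrite mulr_gt0// prodr_gt0.
have q1 : \sum_c q c <= 1.
  rewrite (eq_bigr (fun c => q (c.1, c.2))); last by case.
  rewrite -(pair_bigA _ (fun w b => q (w, b)))/= exchange_big/=.
  rewrite -(finite_valued_sum1 nu (@measurable_letters (n + N))).
  apply: ler_sum => b _; rewrite letters_preimage /q/= -mulr_sumr ler_piMr ?(ltW (nu0 _))//.
  rewrite -(bigA_distr_bigA (fun (i : 'I_n) j => theta j (eta (iter i sh (extend b)))))/=.
  by apply: prodr_ile1 => i _; rewrite theta1 sumr_ge0// => j _; exact: ltW.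
have mX w : measurable (X @^-1` [set w]).
  exact: (@measurable_itinerary _ _ sh measurable_shift _ xi n w mxi).
have mY b : measurable (Y @^-1` [set b]) by exact: measurable_letters.
rewrite join_entropyE//; last exact: measurable_shift.
rewrite (@eq_integral_bm _ _ _ mu _ (fun x => ln (fine (mu (X @^-1` [set X x]))))); last first.
  by move=> x; rewrite itineraryE.
apply: le_trans (gibbs_inequality mu mX mY q0 q1) _.
rewrite lerNl.
have -> : - (n%:R * (- (\int[mu]_x A x) + tau) + (D - N%:R * \int[mu]_x A x)) =
    \int[mu]_x (birkhoff A (n + N) x - D) - n%:R * tau.
  rewrite integralB_bm ?integral_birkhoff ?integral_cst_prob ?natrD//; first ring.
    exact: bounded_measurable_birkhoff.
  exact: bounded_measurable_cst.
have bq : bm (fun x => ln (q (X x, Y x))).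
  pose Z x := (X x, Y x).
  have mZ c : measurable (Z @^-1` [set c]).
    rewrite (_ : _ @^-1` _ = X @^-1` [set c.1] `&` Y @^-1` [set c.2]).
      exact: measurableI.
    by apply/seteqP; split => x; rewrite /Z /=; [move=> <-|case: c => /= ? ? [-> ->]].
  by have [h _] := integral_finite_valued mu (fun c => ln (q c)) mZ.
apply: (@le_trans _ _ (\int[mu]_x (birkhoff A (n + N) x - D - birkhoff g n x))).
  have bS : bm (fun x => birkhoff A (n + N) x - D).
    by apply: bounded_measurableB; [exact: bounded_measurable_birkhoff|
      exact: bounded_measurable_cst].
  rewrite [leRHS]integralB_bm//; last exact: bounded_measurable_birkhoff.
  by rewrite integral_birkhoff// lerB// ler_wpM2l.
apply: le_integral_bm => //.
  apply: bounded_measurableB; last exact: bounded_measurable_birkhoff.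
  by apply: bounded_measurableB; [exact: bounded_measurable_birkhoff|
      exact: bounded_measurable_cst].
move=> x; rewrite -[leLHS]expRK ler_ln ?posrE ?expR_gt0// expRD.
have ag : agree (n + N) (extend (Y x)) x.
  by apply/letters_agree; rewrite lettersK.
apply: ler_pM; rewrite ?expR_ge0//.
  rewrite /= (agree_setE ag).
  by have /andP[] := hnu _ x x (@agreexx _ (n + N) x).
rewrite /birkhoff -sumrN expR_sum; apply: ler_prod => i _; rewrite expR_ge0 /=.
have -> : eta (iter i sh (extend (Y x))) = eta (iter i sh x).
  apply: heta; apply: agree_iter; apply: agreeW ag.
  by rewrite leq_add2r ltnW.
rewrite /X ffunE /theta; case: eqP => [_|ne].
  rewrite /u ler_expR /g lerN2 lerDl mulr_ge0// indicE; exact: ler0n.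
have Bx : B (iter i sh x) by apply: contrapT => /hB.
rewrite /g indicE mem_set// mulr1 -[leRHS]lnK ?posrE// ler_expR /M.
by have := tau0; lra.
Qed.

Lemma ks_entropy_le mu : invariant_measure mu sh ->
  (ks_entropy mu sh <= (- (\int[mu]_x A x))%:E)%E.
Proof.
move=> inv; apply: ub_ereal_sup => _ [m [xi [mxi ->]]]; rewrite lee_fin.
have A0 : 0 <= - (\int[mu]_x A x).
  rewrite oppr_ge0 -[leRHS](integral_cst_prob mu 0); apply: le_integral_bm => //.
    exact: bounded_measurable_cst.
  exact: normalized_le0.
(* The limit of a divergent sequence is 0 by convention, and 0 <= - int A dmu because A <= 0. *)
have [cv|ncv] := pselect (cvgn (fun n : nat => n%:R^-1 * join_entropy mu sh xi n)); last first.
  by rewrite /partition_entropy dvgP.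
apply/ler_addgt0Pr => tau tau0; have tau2 : 0 < tau / 2 by rewrite divr_gt0.
have [N hN] := join_entropy_le inv mxi tau2.
apply: limr_le => //; near=> n.
have n0 : 0 < n%:R :> R by rewrite ltr0n; near: n; exact: nbhs_infty_gt.
rewrite ler_pdivrMl//; apply: le_trans (hN n) _.
set K := D - _; suff : K <= n%:R * (tau / 2) by lra.
by rewrite -ler_pdivrMr//; near: n; exact: nbhs_infty_ger.
Unshelve. all: by end_near. Qed.

Lemma pressure_normalized_le mu : invariant_measure mu sh ->
  (\int[mu]_x (A x)%:E + ks_entropy mu sh <= 0)%E.
Proof.
move=> inv; rewrite -EFin_Rintegral//.
apply: le_trans (leeD2l _ (ks_entropy_le inv)) _.
by rewrite -EFinD subrr.
Qed.

Lemma pressure_normalized : pressure A = 0%E.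
Proof.
apply/eqP; rewrite eq_le; apply/andP; split.
  by apply: ub_ereal_sup => _ [mu [inv ->]]; exact: pressure_normalized_le.
have [nu [inv hnu]] := gibbs_measure_exists t01 lipA nA.
apply: (@le_trans _ _ (\int[nu]_x (A x)%:E + ks_entropy nu sh)%E); last first.
  by apply: ereal_sup_ubound; exists nu.
rewrite -EFin_Rintegral//.
apply: le_trans (leeD2l _ (ks_entropy_gibbs inv hnu)).
by rewrite -EFinD subrr.
Qed.

End Bounds.
End Pressure.

(** * Equilibrium states *)

Section TransferInvariance.
Context {R : realType} {k : nat}.
Implicit Types (f phi psi : Omega k -> R) (x y z : Omega k) (n p : nat).
Implicit Types mu : probability (Omega k) R.

Local Notation sh := (@shift_map k).
Local Notation bm := bounded_measurable.

Lemma ln_dist_le (u v : R) : 2^-1 <= u -> 2^-1 <= v -> `|ln u - ln v| <= 2 * `|u - v|.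
Proof.
suff h (a b : R) : 2^-1 <= a -> 2^-1 <= b -> ln a - ln b <= 2 * `|a - b|.
  by move=> hu hv; rewrite ler_norml h// andbT lerNl opprB distrC h.
move=> ha hb; have a0 : 0 < a by lra.
have b0 : 0 < b by lra.
rewrite -ln_div ?posrE//; have ab : 0 < a / b by rewrite divr_gt0.
have : ln (a / b) <= a / b - 1.
  rewrite lerBrDr addrC; apply: le_trans (expR_ge1Dx _) _.
  by rewrite lnK// posrE.
move=> /le_trans; apply; rewrite lerBlDr ler_pdivrMr// mulrDl mul1r -lerBlDr.
have := ler_norm (a - b); have := normr_ge0 (a - b); nra.
Qed.

(** From ln w <= w - 1 at w = 1 / (1 + v). The quadratic error is what makes the tangent argument
    below work. *)
Lemma ln1D_ge (v : R) : `|v| <= 2^-1 -> v - 2 * v ^+ 2 <= ln (1 + v).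
Proof.
rewrite ler_norml => /andP[v1 v2]; have p0 : 0 < 1 + v by lra.
have : ln ((1 + v)^-1) <= (1 + v)^-1 - 1.
  rewrite lerBrDr addrC; apply: le_trans (expR_ge1Dx _) _.
  by rewrite lnK// posrE invr_gt0.
rewrite lnV ?posrE// => h; suff : (1 + v)^-1 - 1 <= 2 * v ^+ 2 - v by lra.
rewrite lerBlDr -[leLHS]mul1r ler_pdivrMr//; have := sqr_ge0 v; nra.
Qed.

Section Potential.
Variables (t C : R) (A : Omega k -> R).
Hypotheses (t01 : 0 < t < 1) (lipA : lip t C A) (nA : normalized A).
Local Notation D := (C / (1 - t)).
Local Notation L := (transfer A).
Local Notation Lam := (gibbs_functional A).

Lemma lip_shift K phi : lip t K phi -> lip t (K / t) (phi \o sh).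
Proof.
have /andP[t0 t1] := t01.
move=> hK [|n] x y xy /=.
  rewrite expr0 mulr1; have := hK 0%N (sh x) (sh y) (agree0 _ _).
  rewrite expr0 mulr1 => /le_trans; apply.
  by rewrite ler_pdivlMr// ler_piMr ?(lip_ge0 hK)// ltW.
have /hK : agree n (sh x) (sh y) by case/agreeSP: xy.
by rewrite exprS mulrA divfK ?gt_eqF.
Qed.

Lemma lip_transfer K phi : lip t K phi -> exists K', lip t K' (L phi).
Proof. by move=> /(iter_transfer_lip t01 lipA nA)[K' /(_ 1%N)]; exists K'. Qed.

(** The fixed-point equation of the dual operator, tested on Hölder functions. *)
Definition transfer_invariant mu :=
  forall K phi, lip t K phi -> \int[mu]_x L phi x = \int[mu]_x phi x.

(* Tangent functional argument: A + ln (1 + s psi) is normalized, so its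
   pressure vanishes too, and the derivative of s |-> int ln (1 + s psi) at 0
   must vanish. *)
Lemma transfer_invariant_of_equilibrium mu : invariant_measure mu sh ->
  (0 <= \int[mu]_x (A x)%:E + ks_entropy mu sh)%E -> transfer_invariant mu.
Proof.
move=> inv heq K phi hK; have /andP[t0 t1] := t01.
have [K1 hK1] := lip_transfer hK.
(* This choice gives L psi = 0, so that multiplying exp A by 1 + s psi keeps its sums over the
   letters equal to 1; and int psi = int phi - int L phi because mu is shift invariant. *)
pose psi x := phi x - (L phi \o sh) x.
have lpsi : lip t (K + K1 / t) psi by apply: lipB hK _; exact: lip_shift.
have bphi := bounded_measurable_lip t01 hK.
have bL := bounded_measurable_lip t01 hK1.
have bpsi : bm psi := bounded_measurable_lip t01 lpsi.
have bA : bm A := bounded_measurable_lip t01 lipA.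
suff i0 : \int[mu]_x psi x = 0.
  move: i0; rewrite integralB_bm//; last exact: bounded_measurable_comp measurable_shift bL.
  rewrite (integral_invariant measurable_shift inv bL) => /eqP.
  by rewrite subr_eq0 => /eqP.
have [_ [M' hM']] := bpsi; pose M := M' + 1.
have hM x : `|psi x| <= M by apply: le_trans (hM' x) _; rewrite /M lerDl.
have M0 : 0 < M by have := le_trans (normr_ge0 _) (hM' (fun=> ord0)); rewrite /M; lra.
have key s : `|s| * M <= 2^-1 -> s * \int[mu]_x psi x <= 2 * s ^+ 2 * M ^+ 2.
  move=> sM; have hs x : `|s * psi x| <= 2^-1.
    by rewrite normrM; apply: le_trans sM; rewrite ler_wpM2l.
  have ps x : 2^-1 <= 1 + s * psi x by have := hs x; rewrite ler_norml; lra.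
  pose As x := A x + ln (1 + s * psi x).
  have nAs : normalized As.
    move=> x; rewrite /As -[RHS](nA x).
    have e a : expR (A (scons a x) + ln (1 + s * psi (scons a x))) =
       expR (A (scons a x)) + s * (expR (A (scons a x)) * phi (scons a x)
         - expR (A (scons a x)) * L phi x).
      rewrite expRD lnK ?posrE; last by have := ps (scons a x); lra.
      by rewrite /psi /=; have -> : sh (scons a x) = x by []; ring.
    rewrite (eq_bigr _ (fun a _ => e a)) big_split -[RHS]addr0; congr (_ + _).
    by rewrite -mulr_sumr sumrB -mulr_suml nA mul1r subrr mulr0.
  have lAs : lip t (C + 2 * (`|s| * (K + K1 / t))) As.
    apply: lipD lipA _ => n x y xy.
    apply: le_trans (ln_dist_le (ps x) (ps y)) _.
    rewrite opprD addrACA subrr add0r -mulrA ler_wpM2l//.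
    exact: lipZ lpsi _ _ _ xy.
  have := pressure_normalized_le t01 lAs nAs inv.
  have bAs : bm As := bounded_measurable_lip t01 lAs.
  rewrite -EFin_Rintegral//; move: heq; rewrite -EFin_Rintegral//.
  case: (ks_entropy mu sh) => [h| |] //=; rewrite -!EFinD !lee_fin => h1 h2.
  have bl : bm (fun x => ln (1 + s * psi x)).
    have := bounded_measurableB bAs bA; rewrite /As.
    by under eq_fun do rewrite addrAC subrr add0r.
  have : \int[mu]_x ln (1 + s * psi x) <= 0.
    by move: h2; rewrite /As integralD_bm//; lra.
  have le1 : \int[mu]_x (s * psi x - 2 * s ^+ 2 * M ^+ 2) <= \int[mu]_x ln (1 + s * psi x).
    apply: le_integral_bm => //.
      apply: bounded_measurableB; last exact: bounded_measurable_cst.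
      exact: bounded_measurableZ.
    move=> x; apply: le_trans (ln1D_ge (hs x)).
    have hp : psi x ^+ 2 <= M ^+ 2.
      by have := hM x; rewrite ler_norml => /andP[p1 p2]; rewrite -subr_ge0 subr_sqr mulr_ge0//; lra.
    rewrite exprMn lerD2l lerN2 -mulrA ler_wpM2l//.
    by rewrite ler_wpM2l// sqr_ge0.
  move: le1; rewrite integralB_bm ?integral_cst_prob ?integralZ_bm//; first lra.
    exact: bounded_measurableZ.
  exact: bounded_measurable_cst.
set I := \int[mu]_x psi x in key *.
apply/eqP; apply: contrapT => /negP I0.
have aI : 0 < `|I| by rewrite normr_gt0.
(* With the sign of s that makes s I positive, [key] gives |I| <= 2 s0 M^2, while the second entry
   of the minimum makes this at most |I| / 2. *)
pose s0 := Num.min (2 * M)^-1 (`|I| / (4 * M ^+ 2)).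
have M20 : 0 < M ^+ 2 by rewrite exprn_gt0.
have s00 : 0 < s0 by rewrite lt_min invr_gt0 mulr_gt0//= divr_gt0// mulr_gt0.
have s1 : s0 * M <= 2^-1.
  have /(ler_wpM2r (ltW M0)) : s0 <= (2 * M)^-1 by rewrite ge_min lexx.
  by rewrite invfM -mulrA mulVf ?gt_eqF// mulr1.
have s2 : s0 * (4 * M ^+ 2) <= `|I|.
  by rewrite -ler_pdivlMr ?mulr_gt0// ge_min lexx orbT.
have : s0 * `|I| <= s0 * (2 * s0 * M ^+ 2).
  rewrite -[s0 * (_ * _)]/(s0 * (2 * s0 * M ^+ 2)).
  have -> : s0 * (2 * s0 * M ^+ 2) = 2 * s0 ^+ 2 * M ^+ 2 by ring.
  have [I1|I1] := leP 0 I.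
    by rewrite ger0_norm//; apply: key; rewrite ger0_norm// ltW.
  rewrite ltr0_norm// mulrN -mulNr -(sqrrN s0); apply: key.
  by rewrite normrN ger0_norm// ltW.
by rewrite ler_pM2l//; lra.
Qed.

Section Consequences.
Variable mu : probability (Omega k) R.
Hypothesis tmu : transfer_invariant mu.

Lemma integral_iter_transfer K phi n : lip t K phi ->
  \int[mu]_x iter n L phi x = \int[mu]_x phi x.
Proof.
move=> /(iter_transfer_lip t01 lipA nA)[K' hK'].
by elim: n => [//|n IH]; rewrite -IH -(tmu (hK' n)).
Qed.

(** All iterates of phi have the same mu-integral, and they converge uniformly to the constant Lam
    phi. *)
Lemma integral_gibbs_functional K phi : lip t K phi -> \int[mu]_x phi x = Lam phi.
Proof.
move=> hK; have [K' hK'] := iter_transfer_lip t01 lipA nA hK.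
have Lamn n : Lam (iter n L phi) = Lam phi.
  elim: n => [//|n IH]; rewrite iterS -IH.
  exact: (gibbs_functional_transfer t01 lipA nA (hK' n)).
have h e : 0 < e -> `|\int[mu]_x phi x - Lam phi| <= e.
  move=> e0; have [N hN] := transfer_osc t01 lipA nA hK e0.
  have hN' : forall z, inf (range (iter N L phi)) <= iter N L phi z <=
      inf (range (iter N L phi)) + e by apply: osc_inf => x y; exact: hN.
  have := integral_bounds mu (bounded_measurable_lip t01 (hK' N)) hN'.
  have := gibbs_functional_bounds t01 lipA nA (hK' N) hN'.
  rewrite Lamn (integral_iter_transfer _ hK) ler_norml; lra.
apply/eqP; rewrite -subr_eq0 -normr_eq0 eq_le normr_ge0 andbT.
by apply/ler_addgt0Pr => e e0; rewrite add0r; exact: h.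
Qed.

Lemma transfer_invariant_agree n x : fine (mu (agree n x)) = Lam (\1_(agree n x)).
Proof.
have [K hK] := lip_agree t01 n x.
by rewrite -(integral_gibbs_functional hK) integral_indic_bm//; exact: measurable_agree.
Qed.

Lemma transfer_invariant_gibbs n x y : agree n x y ->
  expR (birkhoff A n y - D) <= fine (mu (agree n x)) <= expR (birkhoff A n y + D).
Proof. by move=> xy; rewrite transfer_invariant_agree; exact: gibbs_functional_agree. Qed.

Lemma transfer_invariant_agree_gt0 n x : 0 < fine (mu (agree n x)).
Proof.
have /andP[h _] := transfer_invariant_gibbs (@agreexx _ n x).
by apply: lt_le_trans h; exact: expR_gt0.
Qed.

End Consequences.

Lemma transfer_invariant_unique mu nu : transfer_invariant mu -> transfer_invariant nu ->
  forall B, measurable B -> mu B = nu B.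
Proof.
move=> hmu hnu; apply: measure_eq_agree.
  exact: le_lt_trans (probability_le1 mu measurableT) (ltry _).
move=> n x; have mx := @measurable_agree k n x.
have := transfer_invariant_agree hmu n x; rewrite -(transfer_invariant_agree hnu).
by move=> e; rewrite -[LHS](fine_probK mu mx) -[RHS](fine_probK nu mx) e.
Qed.

End Potential.
End TransferInvariance.

(** * Large deviations *)

Section Supermultiplicative.
Context {R : realType}.
Variables (q : nat -> R -> R) (kappa M : R).
Hypotheses (kappa0 : 0 < kappa) (M0 : 0 <= M).
Hypothesis q_le1 : forall n c, q n c <= 1.
Hypothesis q_anti : forall n c c', c <= c' -> q n c' <= q n c.
Hypothesis q_super : forall n m c c', q n c * q m c' <= q (n + m) (c + c').
Hypothesis q_low : forall n, kappa <= q n (- (n%:R * M)).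

(* [q n c] is, up to a constant, the probability that a sum of n terms exceeds c;
   [rate a u] says that for some n it decays at slope a no faster than exp (- n u). *)
Definition rate a u := exists2 n, (0 < n)%N & expR (- (n%:R * u)) <= q n (n%:R * a).

Definition eventual_rate a u :=
  exists n0, forall n, (n0 <= n)%N -> expR (- (n%:R * u)) <= q n (n%:R * a).

Lemma eventual_rate_rate a u : eventual_rate a u -> rate a u.
Proof. by move=> [n0 h]; exists (maxn 1 n0); rewrite ?leq_max ?h ?leq_maxr. Qed.

Lemma rateW a a' u u' : a' <= a -> u <= u' -> rate a u -> rate a' u'.
Proof.
move=> aa uu [n n0 h]; exists n => //.
apply: (@le_trans _ _ (expR (- (n%:R * u)))).
  by rewrite ler_expR lerN2 ler_wpM2l.
by apply: (le_trans h); apply: q_anti; rewrite ler_wpM2l.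
Qed.

Lemma rate_ge0 a u : rate a u -> 0 <= u.
Proof.
move=> [n n0 h]; have := le_trans h (q_le1 _ _).
by rewrite -[leRHS]expR0 ler_expR oppr_le0 pmulr_rge0// ltr0n.
Qed.

(** The factor kappa is the price for allowing j = 0; [q_scale] does without it for positive
    multiples. *)
Let q_pow n c u j : expR (- u) <= q n c ->
  kappa * expR (- (j%:R * u)) <= q (j * n) (j%:R * c).
Proof.
move=> h; elim: j => [|j IH].
  rewrite !mul0r oppr0 expR0 mulr1 mul0n.
  by have := q_low 0; rewrite mul0r oppr0.
have jE (x : R) : j.+1%:R * x = x + j%:R * x by rewrite -[j.+1]add1n natrD mulrDl mul1r.
rewrite mulSn !jE; apply: le_trans (q_super _ _ _ _).
rewrite opprD expRD mulrCA.
by apply: ler_pM => //; rewrite ?expR_ge0// mulr_ge0 ?expR_ge0 ?ltW.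
Qed.

Let q_scale n c u j : expR (- u) <= q n c ->
  expR (- (j.+1%:R * u)) <= q (j.+1 * n) (j.+1%:R * c).
Proof.
move=> h; elim: j => [|j IH]; first by rewrite !mul1r mul1n.
have jE (x : R) : j.+2%:R * x = x + j.+1%:R * x by rewrite -[j.+2]add1n natrD mulrDl mul1r.
rewrite mulSn !jE; apply: le_trans (q_super _ _ _ _); rewrite opprD expRD.
by apply: ler_pM => //; exact: expR_ge0.
Qed.

(* n letters are filled with about theta n / N blocks of the first kind,
   (1 - theta) n / N blocks of the second kind, and fewer than 2 N letters. *)
Lemma rate_convex b b' u u' theta a v : rate b u -> rate b' u' ->
  0 <= theta <= 1 -> a < theta * b + (1 - theta) * b' ->
  theta * u + (1 - theta) * u' < v -> eventual_rate a v.
Proof.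
move=> [N1 N10 h1] [N2 N20 h2] /andP[th0 th1] ha hv.
(* A common length for both kinds of blocks. *)
pose N := (N1 * N2)%N.
have N0 : 0 < N%:R :> R by rewrite ltr0n muln_gt0 N10.
have {}h1 : expR (- (N%:R * u)) <= q N (N%:R * b).
  have := q_scale N2.-1 h1; rewrite prednK// mulnC /N natrM.
  by rewrite !mulrA ![N2%:R * _]mulrC.
have {}h2 : expR (- (N%:R * u')) <= q N (N%:R * b').
  have := q_scale N1.-1 h2; rewrite prednK// /N natrM.
  by rewrite !mulrA.
pose G := theta * b + (1 - theta) * b' - a.
pose W := v - (theta * u + (1 - theta) * u').
have G0 : 0 < G by rewrite subr_gt0.
have W0 : 0 < W by rewrite subr_gt0.
(* Rounding the two block counts shifts the threshold by at most N |b| + N |b'|, and at most 2 N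
   filler letters lose M each. In the rate, kappa^3 comes from two uses of [q_pow] and one filler.
   These losses are bounded, so the gains n G and n W overtake them. *)
pose K1 := N%:R * (`|b| + `|b'| + 2 * M).
pose K2 := N%:R * (`|u| + `|u'|) - ln (kappa ^+ 3).
have [n0 hn0] : exists n0, forall n, (n0 <= n)%N -> K1 <= n%:R * G /\ K2 <= n%:R * W.
  have : \forall n \near \oo, K1 <= n%:R * G /\ K2 <= n%:R * W.
    near=> n; split; rewrite -ler_pdivrMr//; near: n; exact: nbhs_infty_ger.
  by move=> [n0 _ h]; exists n0 => n /h.
exists n0 => n /hn0 [hG hW].
pose j := Num.truncn (theta * n%:R / N%:R).
pose l := Num.truncn ((1 - theta) * n%:R / N%:R).
have hj : j%:R <= theta * n%:R / N%:R < j.+1%:R.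
  by apply: truncn_itv; rewrite divr_ge0 ?mulr_ge0.
have hl : l%:R <= (1 - theta) * n%:R / N%:R < l.+1%:R.
  by apply: truncn_itv; rewrite divr_ge0 ?mulr_ge0 ?subr_ge0.
move: hj hl; rewrite !ler_pdivlMr// !ltr_pdivrMr// -(natr1 j) -(natr1 l) !mulrDl !mul1r.
move=> /andP[j1 j2] /andP[l1 l2].
have jl : (j * N + l * N <= n)%N.
  rewrite -(ler_nat R) natrD (natrM R j) (natrM R l).
  by move: j1 l1; lra.
pose i := (n - (j * N + l * N))%N.
have iE : n%:R = j%:R * N%:R + l%:R * N%:R + i%:R :> R.
  by rewrite -(natrM R j) -(natrM R l) -!natrD subnKC.
have i0 : 0 <= i%:R :> R by [].
have i2 : i%:R <= 2 * N%:R :> R by move: iE j2 l2; lra.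
have low : kappa ^+ 3 * expR (- (j%:R * (N%:R * u) + l%:R * (N%:R * u'))) <=
    q n (j%:R * (N%:R * b) + l%:R * (N%:R * b') + - (i%:R * M)).
  rewrite [X in q X _](_ : n = j * N + l * N + i)%N; last by rewrite subnKC.
  apply: le_trans (q_super _ _ _ _).
  rewrite opprD expRD !exprS expr0 mulr1.
  have -> : kappa * (kappa * kappa) * (expR (- (j%:R * (N%:R * u))) *
      expR (- (l%:R * (N%:R * u')))) = (kappa * expR (- (j%:R * (N%:R * u)))) *
      (kappa * expR (- (l%:R * (N%:R * u')))) * kappa by ring.
  have k0 := ltW kappa0.
  apply: ler_pM => //; first by rewrite !mulr_ge0 ?expR_ge0.
  apply: le_trans (q_super _ _ _ _).
  by apply: ler_pM; rewrite ?mulr_ge0 ?expR_ge0 ?q_pow.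
have dj : `|j%:R * N%:R - theta * n%:R| <= N%:R.
  by rewrite ler_norml; move: j1 j2 N0; lra.
have dl : `|l%:R * N%:R - (1 - theta) * n%:R| <= N%:R.
  by rewrite ler_norml; move: l1 l2 N0; lra.
have mulb (y z : R) : `|z| <= N%:R -> `|z * y| <= N%:R * `|y|.
  by move=> h; rewrite normrM ler_wpM2r.
have iM : i%:R * M <= 2 * N%:R * M by rewrite ler_wpM2r.
apply: le_trans (le_trans low _); last first.
  apply: q_anti.
  have := mulb b _ dj; have := mulb b' _ dl; rewrite !ler_norml => /andP[p1 _] /andP[p2 _].
  move: hG; rewrite /G /K1; move: p1 p2 iM; lra.
rewrite -[kappa ^+ 3]lnK ?posrE ?exprn_gt0// -expRD ler_expR.
have := mulb u _ dj; have := mulb u' _ dl; rewrite !ler_norml => /andP[_ p1] /andP[_ p2].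
move: hW; rewrite /W /K2; move: p1 p2; lra.
Unshelve. all: by end_near. Qed.

(** A small proportion th of blocks at the level b lifts the threshold strictly above a and changes
    the rate by about th (u - r): convexity yields right-continuity as soon as some level beyond a
    has a finite rate. *)
Lemma rate_right_perturb a r b u : a < b -> rate b u ->
  (forall d, 0 < d -> rate (a - d) (r + d)) ->
  forall e, 0 < e -> exists2 d, 0 < d & eventual_rate (a + d) (r + e).
Proof.
move=> ab hb ha e e0; have ba : 0 < b - a by rewrite subr_gt0.
pose K := `|u - r| + 1.
have K0 : 0 < K by rewrite ltr_wpDl.
pose th := Num.min 1 (e / (2 * K)).
have th0 : 0 < th by rewrite lt_min ltr01 divr_gt0// mulr_gt0.
have th1 : th <= 1 by rewrite ge_min lexx.
have thK : th * K <= e / 2.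
  have : th <= e / (2 * K) by rewrite ge_min lexx orbT.
  by rewrite ler_pdivlMr ?mulr_gt0//; lra.
pose d := Num.min (th * (b - a) / 3) (e / 3).
have d0 : 0 < d by rewrite lt_min !divr_gt0// mulr_gt0.
have d1 : d <= th * (b - a) / 3 by rewrite ge_min lexx.
have d2 : d <= e / 3 by rewrite ge_min lexx orbT.
exists d => //; apply: (rate_convex hb (ha d d0)) (_ : 0 <= th <= 1) _ _.
- by rewrite (ltW th0).
- have : 0 <= th * d by rewrite mulr_ge0 // ltW.
  have : th * d <= d by rewrite ler_piMl // ltW.
  by move: d1 d0; lra.
have : th * (u - r) <= th * K.
  by rewrite ler_wpM2l ?(ltW th0)// /K; apply: le_trans (ler_norm _) _; rewrite lerDl.
have : 0 <= th * d by rewrite mulr_ge0 // ltW.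
by move: thK d2 e0; lra.
Qed.

Variable e : R.
Hypotheses (e0 : 0 < e) (rate_e : forall d, 0 < d -> rate (e - d) (e + d)).
Variables (b u : R).
Hypotheses (eb : e < b) (rate_b : rate b u).

Lemma eventual_rate_right : forall eps, 0 < eps ->
  exists2 d, 0 < d & eventual_rate (e + d) (e + eps).
Proof. exact: rate_right_perturb eb rate_b rate_e. Qed.

Let rate_low a eta : a <= - M -> 0 < eta -> rate a eta.
Proof.
move=> aM eta0.
have [n n0 hn] : exists2 n, (0 < n)%N & - ln kappa <= n%:R * eta.
  have : \forall n \near \oo, (0 < n)%N /\ - ln kappa <= n%:R * eta.
    near=> n; split; first by near: n; exact: nbhs_infty_gt.
    by rewrite -ler_pdivrMr//; near: n; exact: nbhs_infty_ger.
  by move=> [n _ /(_ n (leqnn n))] /= [? ?]; exists n.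
exists n => //; apply: (@le_trans _ _ kappa).
  by rewrite -[leRHS]lnK ?posrE// ler_expR lerNl.
by apply: le_trans (q_low n) _; apply: q_anti; rewrite -mulrN ler_wpM2l.
Unshelve. all: by end_near. Qed.

(** r is the infimum of the rates attained at E. It is below e because E lies to the left of a
    mixture of the level e with a level below - M, where the decay is subexponential. The lower
    estimate is the right perturbation at E. If the upper estimate failed, the rate r - eps would be
    attained at levels arbitrarily close to E from below, and the same perturbation would yield the
    rate r - eps / 2 at E. *)
Lemma rate_function_exists E : E < e -> exists r, [/\ r < e,
  forall eps, 0 < eps -> exists2 d, 0 < d & eventual_rate (E + d) (r + eps) &
  forall eps, 0 < eps -> exists2 d, 0 < d & forall n, (0 < n)%N ->
    q n (n%:R * (E - d)) <= expR (- (n%:R * (r - eps)))].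
Proof.
move=> Ee; pose r := inf [set v | rate E v].
have [v0 v0e hv0] : exists2 v, v < e & rate E v.
  pose a0 := Num.min (- M) E - 1.
  have a01 : a0 <= - M by rewrite /a0 lerBlDr ge_min lerDl ler01.
  have a02 : a0 < E.
    have : Num.min (- M) E <= E by rewrite ge_min lexx orbT.
    by rewrite /a0; lra.
  have ea0 : 0 < e - a0 by lra.
  (* The mixture th e + (1 - th) a0 is the midpoint of E and e. Allotting the rate e / 2 to a0 makes
     the combined rate e - (1 - th) e / 2 up to th d, hence smaller than e. *)
  pose th := (1 + (E - a0) / (e - a0)) / 2.
  have thE : th * (e - a0) = (e + E) / 2 - a0.
    by rewrite /th mulrAC mulrDl divfK ?gt_eqF//; lra.
  have th0 : 0 <= th.
    by rewrite divr_ge0// addr_ge0// divr_ge0 ?ltW//; lra.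
  have th1 : th < 1.
    by rewrite -(ltr_pM2r ea0) mul1r thE; lra.
  have p0 : 0 < (1 - th) * e by rewrite mulr_gt0// subr_gt0.
  pose d := Num.min ((e - E) / 4) ((1 - th) * e / 4).
  have d0 : 0 < d by rewrite lt_min !divr_gt0// subr_gt0.
  have d1 : d <= (e - E) / 4 by rewrite ge_min lexx.
  have d2 : d <= (1 - th) * e / 4 by rewrite ge_min lexx orbT.
  have thd : th * d <= d by rewrite ler_piMl // ltW.
  have e2 : 0 < e / 2 by rewrite divr_gt0.
  exists (e - (1 - th) * e / 8); first lra.
  apply: eventual_rate_rate; apply: (@rate_convex _ _ _ _ th _ _ (rate_e d0) (rate_low a01 e2)).
  - by rewrite th0 ltW.
  - by move: thE d1 thd Ee; lra.
  - by move: thd d2 p0; lra.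
have hr : has_inf [set v | rate E v].
  by split; [exists v0|exists 0 => v; exact: rate_ge0].
have rinf v : rate E v -> r <= v by move=> h; apply: ge_inf => //; case: hr.
have Eb : E < b := lt_trans Ee eb.
have lim d : 0 < d -> rate (E - d) (r + d).
  move=> d0; have [v hv vr] := inf_adherent d0 hr.
  by apply: rateW hv; [rewrite gerBl ltW|exact: ltW].
exists r; split; first exact: le_lt_trans (rinf _ hv0) v0e.
  exact: rate_right_perturb Eb rate_b lim.
move=> eps eps0; apply: contrapT => nex.
have lim' d : 0 < d -> rate (E - d) (r - eps + d).
  move=> d0; apply: contrapT => nr; apply: nex; exists d => // n n0.
  rewrite leNgt; apply/negP => h; apply: nr.
  apply: (@rateW (E - d) _ (r - eps)) => //; first by rewrite lerDl ltW.
  by exists n => //; exact: ltW.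
have eps2 : 0 < eps / 2 by rewrite divr_gt0.
have [d d0 /eventual_rate_rate hd] := rate_right_perturb Eb rate_b lim' eps2.
have /rinf : rate E (r - eps + eps / 2) by apply: rateW hd => //; rewrite lerDl ltW.
lra.
Qed.

End Supermultiplicative.

(** * Concatenation and mixing for one Gibbs measure *)

Section CylinderEstimates.
Context {R : realType} {k : nat}.
Implicit Types (f phi psi : Omega k -> R) (x y z : Omega k) (n p : nat).
Implicit Types (mu : probability (Omega k) R) (B : set (Omega k)).

Local Notation sh := (@shift_map k).
Local Notation bm := bounded_measurable.

Lemma agree_iter_eq n x y : agree n x y -> iter n sh x = iter n sh y -> x = y.
Proof.
move=> xy e; apply/funext => i; have [/xy//|ni] := ltnP i n.
by have := congr1 (fun z : Omega k => z (i - n)%N) e; rewrite !iter_shiftE subnKC.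
Qed.

(** The event S_n f >= c shrunk to the n-cylinders contained in it (S_n being the Birkhoff sum): it
    is a cylinder set and concatenates without loss, while distortion bounds the change of
    threshold. *)
Definition robust f n (c : R) : set (Omega k) :=
  [set y | forall z, agree n y z -> c <= birkhoff f n z].

Lemma cylinder_robust f n c : cylinder_set n (robust f n c).
Proof. by move=> x y xy hx z yz; apply: hx; exact: agree_trans xy yz. Qed.

Lemma robust_birkhoff f n c y : robust f n c y -> c <= birkhoff f n y.
Proof. by apply; exact: agreexx. Qed.

Lemma robust_anti f n c c' : c <= c' -> robust f n c' `<=` robust f n c.
Proof. by move=> cc y h z /h; exact: le_trans. Qed.

Lemma robust_super f n m c c' y : robust f n c y -> robust f m c' (iter n sh y) ->
  robust f (n + m) (c + c') y.
Proof.
move=> h1 h2 z /agree_catP[yz1 yz2]; rewrite birkhoffD.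
by apply: lerD; [exact: h1|exact: h2].
Qed.

Lemma lipM t K K' M M' phi psi : (forall x, `|phi x| <= M) -> (forall x, `|psi x| <= M') ->
  lip t K phi -> lip t K' psi -> lip t (M * K' + M' * K) (fun x => phi x * psi x).
Proof.
move=> hM hM' hK hK' n x y xy.
have -> : phi x * psi x - phi y * psi y = phi x * (psi x - psi y) + psi y * (phi x - phi y).
  by ring.
apply: le_trans (ler_normD _ _) _; rewrite !normrM mulrDl -!mulrA.
by apply: lerD; apply: ler_pM => //; [exact: hK'|exact: hK].
Qed.

Lemma lip_iter_shift t K phi n : 0 < t < 1 -> lip t K phi ->
  exists K', lip t K' (fun x => phi (iter n sh x)).
Proof.
move=> t01 hK; elim: n => [|n [K' hK']]; first by exists K.
exists (K' / t); apply: lip_eq (lip_shift t01 hK') => x /=.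
by rewrite -iterS iterSr.
Qed.

(** psi o sh^n is constant, equal to psi x, on the inverse branches of length n over x. *)
Lemma iter_transfer_mul_shift A n phi psi x :
  iter n (transfer A) (fun y => phi y * psi (iter n sh y)) x =
  iter n (transfer A) phi x * psi x.
Proof.
elim: n phi x => [//|n IH] phi x; rewrite !iterSr -IH.
apply: eq_iter_transfer => y; rewrite [in RHS]/transfer mulr_suml.
by apply: eq_bigr => a _; rewrite mulrA iterSr.
Qed.

Section OneMeasure.
Variables (t C : R) (A : Omega k -> R).
Hypotheses (t01 : 0 < t < 1) (lipA : lip t C A) (nA : normalized A).
Local Notation D := (C / (1 - t)).
Local Notation L := (transfer A).
Variable mu : probability (Omega k) R.
Hypothesis tmu : transfer_invariant t A mu.

Lemma fine_prob_transfer n B : cylinder_set n B ->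
  fine (mu B) = \int[mu]_x iter n L \1_B x.
Proof.
move=> cB; have [K hK] := lip_indic t01 cB.
rewrite (integral_iter_transfer t01 lipA nA tmu n hK) integral_indic_bm//.
exact: measurable_cylinder_set cB.
Qed.

Lemma bounded_measurable_iter_transfer K phi n : lip t K phi -> bm (iter n L phi).
Proof.
move=> hK; have [K' hK'] := iter_transfer_lip t01 lipA nA hK.
exact: bounded_measurable_lip t01 (hK' n).
Qed.

(** Under L^n the indicator of the intersection becomes L^n 1_A' times 1_B, and by comparability of
    base points L^n 1_A' is everywhere at least exp (- D) times its own mean mu A'. *)
Lemma quasi_bernoulli n m A' B : cylinder_set n A' -> cylinder_set m B ->
  expR (- D) * (fine (mu A') * fine (mu B)) <= fine (mu (A' `&` iter n sh @^-1` B)).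
Proof.
move=> cA cB.
have cAB : cylinder_set (n + m) (A' `&` iter n sh @^-1` B).
  move=> x y /agree_catP[xy1 xy2] [Ax Bx]; split; first exact: cA xy1 Ax.
  exact: cB xy2 Bx.
have [KA hA] := lip_indic t01 cA; have [KB hB] := lip_indic t01 cB.
have [KAB hAB] := lip_indic t01 cAB.
have mA := measurable_cylinder_set cA; have mB := measurable_cylinder_set cB.
have mAB := measurable_cylinder_set cAB.
have bA := bounded_measurable_iter_transfer n hA.
have bB : bm (\1_B : Omega k -> R) by exact: bounded_measurable_indic.
have e x : iter n L \1_(A' `&` iter n sh @^-1` B) x = iter n L \1_A' x * \1_B x.
  rewrite -iter_transfer_mul_shift; apply: eq_iter_transfer => y.
  by rewrite indicI.
have -> : fine (mu (A' `&` iter n sh @^-1` B)) = \int[mu]_x (iter n L \1_A' x * \1_B x).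
  rewrite -integral_indic_bm// -(integral_iter_transfer t01 lipA nA tmu n hAB).
  exact: eq_integral_bm.
have h x : expR (- D) * fine (mu A') <= iter n L \1_A' x.
  rewrite (fine_prob_transfer cA) -integralZ_bm//.
  have -> : iter n L \1_A' x = \int[mu]_y (iter n L \1_A' x) by rewrite integral_cst_prob.
  apply: le_integral_bm; [exact: bounded_measurableZ|exact: bounded_measurable_cst|].
  move=> y; rewrite expRN ler_pdivrMl ?expR_gt0//.
  apply: transfer_comparable; first by move=> z z'; exact: distortion.
    by move=> z; rewrite indicE.
  exact: indic_cylinder.
rewrite mulrA -[fine (mu B)](integral_indic_bm mu mB) -integralZ_bm//.
apply: le_integral_bm; [exact: bounded_measurableZ|exact: bounded_measurableM|].
by move=> x; rewrite ler_wpM2r// indicE.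
Qed.

(** Applying L^n under the integral turns the correlation into int (L^n g) g dmu, and L^n g tends
    uniformly to its mean 0. *)
Lemma correlation_decay g K : lip t K g -> \int[mu]_x g x = 0 ->
  forall e, 0 < e -> exists N, forall n, (N <= n)%N ->
    `|\int[mu]_x (g x * g (iter n sh x))| <= e.
Proof.
move=> hK g0 e e0; have bg := bounded_measurable_lip t01 hK.
have [_ [M hM]] := bg.
have M0 : 0 <= M := le_trans (normr_ge0 _) (hM (fun=> ord0)).
have eM : 0 < e / (M + 1) by rewrite divr_gt0// ltr_wpDl.
have [N hN] := transfer_osc t01 lipA nA hK eM.
exists N => n Nn; have bL := bounded_measurable_iter_transfer n hK.
have hL x : `|iter n L g x| <= e / (M + 1).
  have [] := (osc_inf (fun x y => hN n x y Nn) x, integral_bounds mu bL (osc_inf (fun x y => hN n x y Nn))).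
  by rewrite (integral_iter_transfer t01 lipA nA tmu n hK) g0 ler_norml; lra.
have [K' hK'] := lip_iter_shift n t01 hK.
have hMn x : `|g (iter n sh x)| <= M by exact: hM.
have hp := lipM hM hMn hK hK'.
rewrite -(integral_iter_transfer t01 lipA nA tmu n hp).
rewrite (eq_integral_bm _ (iter_transfer_mul_shift A n g g)).
rewrite ler_norml; apply: integral_bounds; first exact: bounded_measurableM.
move=> x; rewrite -ler_norml normrM.
apply: (@le_trans _ _ (e / (M + 1) * M)); first exact: ler_pM.
by rewrite mulrAC ler_pdivrMr ?ltr_wpDl// ler_wpM2l ?(ltW e0)// lerDl.
Qed.

(** Peeling off the first term adds g^2 and twice the correlations with the n later terms: at most N
    of them are bounded by M^2, the others by e / 2. The increment is thus at most V + n e, which n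
    V + n^2 e accommodates; this suffices for a weak law of large numbers. *)
Lemma variance_birkhoff g K : invariant_measure mu sh -> lip t K g ->
  \int[mu]_x g x = 0 -> forall e, 0 < e ->
  exists V, forall n, \int[mu]_x (birkhoff g n x) ^+ 2 <= n%:R * V + n%:R ^+ 2 * e.
Proof.
move=> inv hK g0 e e0; have bg := bounded_measurable_lip t01 hK.
have [_ [M hM]] := bg.
have M0 : 0 <= M := le_trans (normr_ge0 _) (hM (fun=> ord0)).
have e2 : 0 < e / 2 by rewrite divr_gt0.
have [N hN] := correlation_decay hK g0 e2.
pose c j := \int[mu]_x (g x * g (iter j sh x)).
have bgj j : bm (fun x => g x * g (iter j sh x)).
  by apply: bounded_measurableM => //; exact: bounded_measurable_iter_shift.
have cM j : c j <= M ^+ 2.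
  have /andP[_ h] : - M ^+ 2 <= c j <= M ^+ 2; last exact: h.
  apply: integral_bounds => // x; rewrite -ler_norml normrM expr2.
  by apply: ler_pM; rewrite ?hM.
have cs n : \sum_(j < n) c j.+1 <= (minn n N)%:R * M ^+ 2 + n%:R * (e / 2).
  elim: n => [|n IH]; first by rewrite big_ord0 min0n !mul0r addr0.
  rewrite big_ord_recr /= -[in n.+1%:R * (e / 2)]natr1 mulrDl mul1r.
  have [nN|Nn] := ltnP n N.
    rewrite (minn_idPl nN) -natr1 mulrDl mul1r.
    move: IH; rewrite (minn_idPl (ltnW nN)) => IH.
    by have := cM n.+1; lra.
  rewrite (minn_idPr (leqW Nn)); move: IH; rewrite (minn_idPr Nn) => IH.
  by have := le_trans (ler_norm _) (hN n.+1 (leqW Nn)); rewrite -/(c n.+1); lra.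
exists (M ^+ 2 + 2 * N%:R * M ^+ 2); elim=> [|n IH].
  rewrite (@eq_integral_bm _ _ _ _ _ (fun=> 0)) ?integral_cst_prob; last first.
    by move=> x; rewrite birkhoff0 expr0n.
  by rewrite mul0r add0r mulr_ge0 ?sqr_ge0 ?ltW.
have bS := bounded_measurable_birkhoff n bg.
have e1 x : birkhoff g n.+1 x ^+ 2 = (g x * g x + (birkhoff g n (sh x)) ^+ 2) +
    2 * \sum_(j < n) (g x * g (iter j.+1 sh x)).
  rewrite -[n.+1]add1n birkhoffD birkhoffSr birkhoff0 add0r /= -mulr_sumr.
  rewrite (eq_bigr (fun j : 'I_n => g (iter j sh (sh x)))); last first.
    by move=> j _; rewrite -iterSr.
  by rewrite -/(birkhoff g n (sh x)); ring.
have bS2 : bm (fun x => birkhoff g n x ^+ 2).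
  by under eq_fun do rewrite expr2; exact: bounded_measurableM.
have bS2s : bm (fun x => birkhoff g n (sh x) ^+ 2).
  exact: (bounded_measurable_comp measurable_shift bS2).
have bgg : bm (fun x => g x * g x) := bounded_measurableM bg bg.
have bsum : bm (fun x => \sum_(j < n) (g x * g (iter j.+1 sh x))).
  by apply: bounded_measurable_sum => j; exact: bgj.
rewrite (eq_integral_bm _ e1) integralD_bm ?integralD_bm ?integralZ_bm//; last 2 first.
- exact: bounded_measurableD.
- exact: bounded_measurableZ.
rewrite (integral_invariant measurable_shift inv bS2) integral_sum_bm; last first.
  by move=> j; exact: bgj.
have := cM 0%N; have := cs n; rewrite /c /= => h1 h2.
have h3 : (minn n N)%:R * M ^+ 2 <= N%:R * M ^+ 2.
  by rewrite ler_wpM2r ?sqr_ge0// ler_nat geq_minr.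
have n0 : 0 <= n%:R :> R by [].
have ne : 0 <= n%:R * e by rewrite mulr_ge0// ltW.
by rewrite -natr1; lra.
Qed.

End OneMeasure.
End CylinderEstimates.

(** * Comparison of two Gibbs measures *)

Section LargeDeviations.
Context {R : realType} {k : nat}.
Implicit Types (phi psi : Omega k -> R) (x y z : Omega k) (n p : nat).
Implicit Types (B : set (Omega k)).

Local Notation sh := (@shift_map k).
Local Notation bm := bounded_measurable.

Variables (t C0 C1 : R) (A0 A1 : Omega k -> R) (mu0 mu1 : probability (Omega k) R).
Hypotheses (t01 : 0 < t < 1) (lip0 : lip t C0 A0) (lip1 : lip t C1 A1).
Hypotheses (nA0 : normalized A0) (nA1 : normalized A1).
Hypotheses (tmu0 : transfer_invariant t A0 mu0) (tmu1 : transfer_invariant t A1 mu1).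
Hypothesis inv0 : invariant_measure mu0 sh.

Local Notation D0 := (C0 / (1 - t)).
Local Notation D1 := (C1 / (1 - t)).
Local Notation D := ((C0 + C1) / (1 - t)).

Definition log_ratio x := A0 x - A1 x.
Local Notation f := log_ratio.

Let lipf : lip t (C0 + C1) f. Proof. exact: lipB. Qed.
Let bf : bm f. Proof. exact: bounded_measurable_lip lipf. Qed.
Let D_ge0 : 0 <= D. Proof. exact: distortion_ge0 lipf. Qed.

Let fD n z z' : agree n z z' -> birkhoff f n z - birkhoff f n z' <= D.
Proof. by move=> /(distortion t01 lipf); rewrite ler_norml; lra. Qed.

(** The two operators are compared at independent base points x and y, since x is then integrated
    against mu0 and y against mu1; moving the sum of A0 between paired branches costs D0. *)
Lemma change_of_measure n B c : cylinder_set n B -> (forall y, B y -> birkhoff f n y <= c) ->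
  fine (mu0 B) <= expR (c + D0) * fine (mu1 B).
Proof.
move=> cB hB.
have [K hK] := lip_indic t01 cB.
have b0 := bounded_measurable_iter_transfer t01 lip0 nA0 n hK.
have b1 := bounded_measurable_iter_transfer t01 lip1 nA1 n hK.
have h x y : iter n (transfer A0) \1_B x <= expR (c + D0) * iter n (transfer A1) \1_B y.
  rewrite -iter_transferZ; apply: transfer_le => z z' _ _ zz.
  rewrite (indic_cylinder cB zz) mulrA indicE.
  have [/set_mem Bz'|] := boolP (z' \in B); last by rewrite !mulr0.
  rewrite !mulr1 -expRD ler_expR.
  have := distortion t01 lip0 zz; have := hB z' Bz'; rewrite birkhoffB ler_norml; lra.
rewrite (fine_prob_transfer t01 lip0 nA0 tmu0 cB) (fine_prob_transfer t01 lip1 nA1 tmu1 cB).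
rewrite -integralZ_bm//.
have hy y : \int[mu0]_x iter n (transfer A0) \1_B x <= expR (c + D0) * iter n (transfer A1) \1_B y.
  rewrite -[leRHS](integral_cst_prob mu0); apply: le_integral_bm => //.
  exact: bounded_measurable_cst.
rewrite -[leLHS](integral_cst_prob mu1); apply: le_integral_bm => //.
  exact: bounded_measurable_cst.
exact: bounded_measurableZ.
Qed.

(** Here both iterates are taken at the same base point, so nothing is lost to distortion: on B one
    has exp (S_n A1) <= exp (- c) exp (S_n A0), and the weights exp (S_n A0) over a base point sum
    to 1. *)
Lemma likelihood_ratio_bound n B c : cylinder_set n B -> (forall y, B y -> c <= birkhoff f n y) ->
  fine (mu1 B) <= expR (- c).
Proof.
move=> cB hB; have [K hK] := lip_indic t01 cB.
have b1 := bounded_measurable_iter_transfer t01 lip1 nA1 n hK.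
rewrite (fine_prob_transfer t01 lip1 nA1 tmu1 cB) -[leRHS](integral_cst_prob mu1).
apply: le_integral_bm => //; first exact: bounded_measurable_cst.
move=> x; rewrite -[leRHS](iter_transfer_cst n _ x nA0).
apply: transfer_le => z z' zx z'x zz.
have <- : z = z' by apply: agree_iter_eq zz _; rewrite zx z'x.
rewrite indicE; have [/set_mem Bz|_] := boolP (z \in B); last first.
  by rewrite mulr0 mulr_ge0 ?expR_ge0.
by rewrite mulr1 -expRD ler_expR; have := hB z Bz; rewrite birkhoffB; lra.
Qed.

Local Notation kappa := (expR (- D1)).
(** The factor kappa turns the quasi-Bernoulli inequality into exact supermultiplicativity. *)
Definition tail n c := kappa * fine (mu1 (robust f n c)).

Let mrob n c : measurable (robust f n c).
Proof. exact: measurable_cylinder_set (@cylinder_robust _ _ f n c). Qed.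

Let kappa_le1 : kappa <= 1.
Proof. by rewrite -[leRHS]expR0 ler_expR oppr_le0; exact: distortion_ge0 lip1. Qed.

Lemma tail_le n c : tail n c <= fine (mu1 (robust f n c)).
Proof. by rewrite ler_piMl ?fine_prob_ge0. Qed.

Lemma tail_le1 n c : tail n c <= 1.
Proof. by apply: le_trans (tail_le n c) _; exact: fine_prob_le1. Qed.

Lemma tail_anti n c c' : c <= c' -> tail n c' <= tail n c.
Proof.
by move=> cc; rewrite ler_wpM2l ?expR_ge0// le_fine_prob//; exact: robust_anti.
Qed.

Lemma tail_super n m c c' : tail n c * tail m c' <= tail (n + m) (c + c').
Proof.
rewrite /tail mulrACA -mulrA ler_wpM2l ?expR_ge0//.
apply: le_trans (quasi_bernoulli t01 lip1 nA1 tmu1 (@cylinder_robust _ _ f n c)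
  (@cylinder_robust _ _ f m c')) _.
apply: le_fine_prob => //; last by move=> y [h1 h2]; exact: robust_super h1 h2.
apply: measurableI => //; rewrite -[X in measurable X]setTI.
exact: measurable_iter_shift.
Qed.

Lemma tail_robustT n c : robust f n c = setT -> tail n c = kappa.
Proof. by move=> e; rewrite /tail e; have /= -> := probability_setT mu1; rewrite mulr1. Qed.

Local Notation M := (`|f (fun=> ord0)| + (C0 + C1)).

Lemma log_ratio_bound_ge0 : 0 <= M.
Proof. by rewrite addr_ge0// (lip_ge0 lipf). Qed.

Let hM x : `|f x| <= M. Proof. exact: lip_bounded lipf x. Qed.

Lemma tail_low n : kappa <= tail n (- (n%:R * M)).
Proof.
rewrite tail_robustT//; apply/seteqP; split => // y _ z _.
by have := birkhoff_bound n z hM; rewrite ler_norml -[_ *+ n]mulr_natl => /andP[]. 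
Qed.

Local Notation e := (\int[mu0]_x f x).
Hypothesis e0 : 0 < e.

(** By Chebyshev, the cylinders that meet the event |S_n f - n e| <= n d / 4 have mu0-mass at least
    1/2. On them the likelihood ratio is at most exp (n e + n d / 2) up to a constant, which bounds
    their mu1-mass from below. *)
Lemma tail_rate_mean d : 0 < d -> rate tail (e - d) (e + d).
Proof.
move=> d0; pose g x := f x - e.
have lg : lip t (C0 + C1 + 0) g by apply: lipB => //; exact: lip_cst.
have bg : bm g := bounded_measurable_lip t01 lg.
have ig : \int[mu0]_x g x = 0.
  rewrite integralB_bm ?integral_cst_prob ?subrr//; exact: bounded_measurable_cst.
have d64 : 0 < d ^+ 2 / 64 by rewrite divr_gt0 ?exprn_gt0.
have [V hV] := variance_birkhoff t01 lip0 nA0 tmu0 inv0 lg ig d64.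
have gE n y : birkhoff g n y = birkhoff f n y - n%:R * e.
  by rewrite /birkhoff sumrB sumr_const card_ord mulr_natl.
(* The first bound on n, with the constant d^2 / 64 above, makes both terms of the Chebyshev bound
   at most 1/4; the second puts the distortion D below n d / 4; the third absorbs D0, kappa and the
   mass 1/2 into n d / 2. *)
have [n [n0 hn1 hn2 hn3]] : exists n, [/\ (0 < n)%N, 64 * V / d ^+ 2 <= n%:R,
    4 * D / d <= n%:R & (D0 + D1 + ln 2) / (d / 2) <= n%:R].
  have : \forall n \near \oo, [/\ (0 < n)%N, 64 * V / d ^+ 2 <= n%:R,
    4 * D / d <= n%:R & (D0 + D1 + ln 2) / (d / 2) <= n%:R].
    near=> n; split; near: n; [exact: nbhs_infty_gt|exact: nbhs_infty_ger..].
  by move=> [n _ /(_ n (leqnn n))]; exists n.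
exists n => //.
have nR : 0 < n%:R :> R by rewrite ltr0n.
move: hn1 hn2 hn3; rewrite !ler_pdivrMr ?exprn_gt0 ?divr_gt0// => hn1 hn2 hn3.
pose B := [set y | exists2 z, agree n y z & `|birkhoff g n z| <= n%:R * d / 4].
have cB : cylinder_set n B.
  by move=> x y xy [z xz hz]; exists z => //; exact: agree_trans (agree_sym xy) xz.
have mB := measurable_cylinder_set cB.
have hB y : B y -> forall z, agree n y z -> `|birkhoff f n z - n%:R * e| <= n%:R * d / 2.
  move=> [w yw]; rewrite gE ler_norml => /andP[w1 w2] z yz.
  have zw : agree n z w by exact: agree_trans (agree_sym yz) yw.
  have := fD zw; have := fD (agree_sym zw); rewrite ler_norml; lra.
have B2 : 2^-1 <= fine (mu0 B).
  have ge : forall y, 1 - \1_B y <= 16 / (n%:R ^+ 2 * d ^+ 2) * birkhoff g n y ^+ 2.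
    move=> y; rewrite indicE; have [|/negP nB] := boolP (y \in B).
      by rewrite subrr => _; rewrite mulr_ge0 ?sqr_ge0// divr_ge0// mulr_ge0// sqr_ge0.
    rewrite subr0 mulrAC ler_pdivlMr ?mulr_gt0 ?exprn_gt0// mul1r.
    have : n%:R * d / 4 < `|birkhoff g n y|.
      rewrite ltNge; apply/negP => h; apply: nB; apply/mem_set.
      by exists y => //; exact: agreexx.
    move=> /ltW h; have nd : 0 <= n%:R * d / 4 by rewrite divr_ge0// mulr_ge0// ltW.
    have := ler_pM nd nd h h; rewrite -!expr2 real_normK ?num_real// => h2.
    have -> : n%:R ^+ 2 * d ^+ 2 = 16 * (n%:R * d / 4) ^+ 2 by field.
    by rewrite ler_wpM2l.
  have bS2 : bm (fun x => birkhoff g n x ^+ 2).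
    by under eq_fun do rewrite expr2; apply: bounded_measurableM; exact: bounded_measurable_birkhoff.
  have : \int[mu0]_y (1 - \1_B y) <=
      \int[mu0]_y (16 / (n%:R ^+ 2 * d ^+ 2) * birkhoff g n y ^+ 2).
    apply: le_integral_bm ge; last exact: bounded_measurableZ.
    apply: bounded_measurableB; first exact: bounded_measurable_cst.
    exact: bounded_measurable_indic.
  rewrite integralB_bm ?integral_cst_prob ?integral_indic_bm ?integralZ_bm//; last 2 first.
  - exact: bounded_measurable_cst.
  - exact: bounded_measurable_indic.
  suff : 16 / (n%:R ^+ 2 * d ^+ 2) * \int[mu0]_y (birkhoff g n y ^+ 2) <= 2^-1 by lra.
  rewrite mulrAC ler_pdivrMr ?mulr_gt0 ?exprn_gt0//.
  have := hV n; move: (\int[mu0]_x _) => I.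
  have : n%:R * (64 * V) <= n%:R ^+ 2 * d ^+ 2 by rewrite expr2 -mulrA ler_wpM2l.
  by lra.
have sub : B `<=` robust f n (n%:R * (e - d)).
  move=> y /hB h z /h; rewrite ler_norml mulrBr => /andP[h1 _].
  have nd : 0 < n%:R * d by rewrite mulr_gt0.
  lra.
have := change_of_measure (c := n%:R * e + n%:R * d / 2) cB.
have hBc y : B y -> birkhoff f n y <= n%:R * e + n%:R * d / 2.
  by move=> /hB /(_ y (@agreexx _ _ _)); rewrite ler_norml; lra.
move=> /(_ hBc) /(le_trans B2) hmu.
have hmu2 : fine (mu1 B) <= fine (mu1 (robust f n (n%:R * (e - d)))) by exact: le_fine_prob.
rewrite /tail.
apply: (@le_trans _ _ (kappa * (2^-1 / expR (n%:R * e + n%:R * d / 2 + D0)))); last first.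
  rewrite ler_wpM2l ?expR_ge0// ler_pdivrMr ?expR_gt0// mulrC.
  by apply: le_trans hmu _; rewrite ler_wpM2l ?expR_ge0.
have -> : 2^-1 / expR (n%:R * e + n%:R * d / 2 + D0) =
    expR (- ln 2 - (n%:R * e + n%:R * d / 2 + D0)).
  by rewrite expRB expRN lnK// posrE.
by rewrite -expRD ler_expR mulrDr; move: hn3; lra.
Unshelve. all: by end_near. Qed.

Let tail_gt0_rate n b : (0 < n)%N -> 0 < tail n (n%:R * b) -> exists u, rate tail b u.
Proof.
move=> n0 h; exists (- ln (tail n (n%:R * b)) / n%:R), n => //.
by rewrite mulrC divfK ?pnatr_eq0 -?lt0n// opprK lnK.
Qed.

(* Each visit of the cylinder [agree N y], at times that are multiples of N,
   costs K, while the pieces between visits gain at most D each. *)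
Lemma birkhoff_lower_of_upper (g : Omega k -> R) Kg : lip t Kg g ->
  \int[mu0]_x g x = 0 ->
  (forall n z z', agree n z z' -> birkhoff g n z - birkhoff g n z' <= D) ->
  (forall n y, birkhoff g n y <= D) -> forall n y, - (2 * D) <= birkhoff g n y.
Proof.
move=> lg ig gD gup N y; rewrite leNgt; apply/negP => hlt.
have bg : bm g := bounded_measurable_lip t01 lg.
(* K exceeds D by the choice of y, so a visit outweighs the gain of the piece before it by K - D. *)
pose K := - (birkhoff g N y + D).
have KD : 0 < K - D by rewrite /K; lra.
have hB z : agree N y z -> birkhoff g N z <= - K.
  by move=> yz; have := gD _ _ _ (agree_sym yz); rewrite /K; lra.
pose H m (x : Omega k) : R := \sum_(j < m) \1_(agree N y) (iter (j * N) sh x).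
have HS m x : H m.+1 x = \1_(agree N y) x + H m (iter N sh x).
  rewrite /H big_ord_recl mul0n; congr (_ + _); apply: eq_bigr => j _.
  by rewrite /= /bump /= add1n mulSn addnC iterD.
(* l is the length of the piece since the last visit; generalizing over it lets the induction end a
   piece, at the price D given by [gup], only when a visit occurs. *)
have key m : forall l z, birkhoff g (l + m * N) z + (K - D) * H m (iter l sh z) <= D.
  elim: m => [|m IH] l z; first by rewrite mul0n addn0 /H big_ord0 mulr0 addr0.
  rewrite HS indicE; have [/set_mem Bz|_] := boolP (iter l sh z \in _).
    rewrite mulSn !birkhoffD.
    have := IH 0%N (iter N sh (iter l sh z)); rewrite add0n /=.
    by have := hB _ Bz; have := gup l z; lra.
  rewrite add0r; have := IH (l + N)%N z.
  by rewrite mulSn addnA [(l + N)%N]addnC iterD.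
have mB := @measurable_agree k N y.
have bI : bm (\1_(agree N y) : Omega k -> R) by exact: bounded_measurable_indic.
have bH m : bm (H m).
  by apply: bounded_measurable_sum => j; exact: (bounded_measurable_iter_shift (j * N) bI).
have iH m : \int[mu0]_x H m x = m%:R * fine (mu0 (agree N y)).
  rewrite integral_sum_bm; last by move=> j; exact: (bounded_measurable_iter_shift (j * N) bI).
  rewrite (eq_bigr (fun=> fine (mu0 (agree N y)))).
    by rewrite sumr_const card_ord mulr_natl.
  move=> j _; rewrite -(integral_indic_bm mu0 mB).
  exact: (integral_iter_shift (j * N) inv0 bI).
have p0 := transfer_invariant_agree_gt0 t01 lip0 nA0 tmu0 N y.
(* Integrating [key] at l = 0: the Birkhoff sum has mean 0, while the expected number of visits
   grows linearly in m, which contradicts the bound D. *)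
have im m : (K - D) * (m%:R * fine (mu0 (agree N y))) <= D.
  have bS := bounded_measurable_birkhoff (m * N) bg.
  rewrite -iH -integralZ_bm// -[leLHS]add0r -[X in X + _](mulr0 (m * N)%:R) -ig.
  rewrite -integral_birkhoff// -integralD_bm//; last exact: bounded_measurableZ.
  have [_ //] : 0 <= D /\ \int[mu0]_x (birkhoff g (m * N) x + (K - D) * H m x) <= D.
  split=> //; rewrite -[leRHS](integral_cst_prob mu0); apply: le_integral_bm.
  - by apply: bounded_measurableD => //; exact: bounded_measurableZ.
  - exact: bounded_measurable_cst.
  by move=> x; have := key m 0%N x; rewrite add0n.
have [m hm] : exists m, (D + 1) / ((K - D) * fine (mu0 (agree N y))) <= m%:R.
  have : \forall m \near \oo, (D + 1) / ((K - D) * fine (mu0 (agree N y))) <= m%:R.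
    by near=> m; near: m; exact: nbhs_infty_ger.
  by move=> [m _ /(_ m (leqnn m))]; exists m.
have := im m; rewrite mulrCA leNgt => /negP; apply.
move: hm; rewrite ler_pdivrMr ?mulr_gt0//; apply: lt_le_trans.
by rewrite ltrDl.
Unshelve. all: by end_near. Qed.

(** A nonempty robust event contains a cylinder, so it has positive mu1-mass and a finite rate.
    Without rates above e all these events are empty, whence S_n f <= n e + D and then S_n f >= n e
    - 2 D everywhere; the likelihood ratio would make mu1 of the whole space smaller than 1. *)
Lemma tail_rate_above : exists b u, e < b /\ rate tail b u.
Proof.
apply: contrapT => nex.
have nr b n : (0 < n)%N -> e < b -> robust f n (n%:R * b) = set0.
  move=> n0 eb; apply/seteqP; split => // y hy; apply: nex; exists b.
  have [u hu] : exists u, rate tail b u; last by exists u.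
  apply: (tail_gt0_rate n0); rewrite mulr_gt0 ?expR_gt0//.
  apply: lt_le_trans (transfer_invariant_agree_gt0 t01 lip1 nA1 tmu1 n y) _.
  apply: le_fine_prob => //; first exact: measurable_agree.
  by move=> z yz; exact: cylinder_robust yz hy.
pose g x := f x - e.
have lg : lip t (C0 + C1 + 0) g by apply: lipB => //; exact: lip_cst.
have gE n y : birkhoff g n y = birkhoff f n y - n%:R * e.
  by rewrite /birkhoff sumrB sumr_const card_ord mulr_natl.
have ig : \int[mu0]_x g x = 0.
  rewrite integralB_bm ?integral_cst_prob ?subrr//; exact: bounded_measurable_cst.
have gup n y : birkhoff g n y <= D.
  case: n => [|n]; first by rewrite birkhoff0.
  have n0 : 0 < n.+1%:R :> R by [].
  rewrite gE lerBlDr leNgt; apply/negP => h.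
  (* The slope left after giving up D, so that the whole cylinder of y is robust. *)
  pose b := (birkhoff f n.+1 y - D) / n.+1%:R.
  have eb : e < b by rewrite ltr_pdivlMr// mulrC; lra.
  have : robust f n.+1 (n.+1%:R * b) y.
    move=> z yz; rewrite /b mulrC divfK ?gt_eqF//.
    by have := fD yz; lra.
  by rewrite nr.
have gD n z z' : agree n z z' -> birkhoff g n z - birkhoff g n z' <= D.
  by move=> /fD; rewrite !gE; lra.
have glow := birkhoff_lower_of_upper lg ig gD gup.
have [n hn] : exists n, (2 * D + 1) / e <= n%:R.
  have : \forall n \near \oo, (2 * D + 1) / e <= n%:R by near=> n; near: n; exact: nbhs_infty_ger.
  by move=> [n _ /(_ n (leqnn n))]; exists n.
have : fine (mu1 setT) <= expR (- (n%:R * e - 2 * D)).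
  apply: (@likelihood_ratio_bound n) => // y _.
  by have := glow n y; rewrite gE; lra.
have /= -> := probability_setT mu1; rewrite /= leNgt => /negP; apply.
rewrite -[ltRHS]expR0 ltr_expR; move: hn; rewrite ler_pdivrMr//; lra.
Unshelve. all: by end_near. Qed.

End LargeDeviations.

(** * Exponents of the type II error *)

Section ErrorExponent.
Context {R : realType} {k : nat}.
Local Notation sh := (@shift_map k).
Local Notation bm := bounded_measurable.

Lemma log_rate_cvg (mu : probability (Omega k) R) (B : nat -> set (Omega k)) rho :
  (forall n, measurable (B n)) ->
  (forall e, 0 < e -> \forall n \near \oo,
    expR (- (n%:R * (rho + e))) <= fine (mu (B n)) <= expR (- (n%:R * (rho - e)))) ->
  log_rate mu n (B n) @[n --> \oo] --> (- rho)%:E.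
Proof.
move=> mB h.
have hpos : \forall n \near \oo, (0 < n)%N /\ 0 < fine (mu (B n)).
  have := h 1 ltr01; apply: filterS2 (nbhs_infty_gt 0) => n n0 /andP[h1 _].
  by split=> //; apply: lt_le_trans h1; exact: expR_gt0.
have e : \forall n \near \oo, (n%:R^-1 * ln (fine (mu (B n))))%:E = log_rate mu n (B n).
  apply: filterS hpos => n [_ p0]; rewrite /log_rate EFinM.
  by rewrite -(lne_EFin p0) fine_probK.
apply: cvg_trans; first exact: near_eq_cvg e.
apply: cvg_EFin; first by near=> n.
apply/cvgrPdist_le => eps eps0 /=.
have := h eps eps0; apply: filterS2 hpos => n [n0 p0] /andP[h1 h2].
have nR : 0 < n%:R :> R by rewrite ltr0n.
have {}h1 : - (n%:R * (rho + eps)) <= ln (fine (mu (B n))) by rewrite -ler_expR lnK.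
have {}h2 : ln (fine (mu (B n))) <= - (n%:R * (rho - eps)) by rewrite -ler_expR lnK.
have n1 : n%:R != 0 :> R by rewrite gt_eqF.
rewrite (_ : - rho - _ = n%:R^-1 * (n%:R * - rho - ln (fine (mu (B n))))); last first.
  by rewrite mulrBr mulKf.
rewrite normrM ger0_norm ?invr_ge0 ?(ltW nR)// ler_pdivrMl// ler_norml.
by apply/andP; split; lra.
Unshelve. all: by end_near. Qed.

Variables (t C0 C1 : R) (A0 A1 : Omega k -> R) (mu0 mu1 : probability (Omega k) R).
Hypotheses (t01 : 0 < t < 1) (lip0 : lip t C0 A0) (lip1 : lip t C1 A1).
Hypotheses (nA0 : normalized A0) (nA1 : normalized A1).
Hypotheses (tmu0 : transfer_invariant t A0 mu0) (tmu1 : transfer_invariant t A1 mu1).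
Hypothesis inv0 : invariant_measure mu0 sh.
Local Notation D1 := (C1 / (1 - t)).
Local Notation D := ((C0 + C1) / (1 - t)).
Local Notation f := (log_ratio A0 A1).
Local Notation tail := (tail t C1 A0 A1 mu1).
Local Notation e := (\int[mu0]_x f x).
Hypothesis e0 : 0 < e.

Let lipf : lip t (C0 + C1) f. Proof. exact: lipB. Qed.

Definition exceed (w : nat -> R) n : set (Omega k) :=
  [set y | w n < n%:R^-1 * birkhoff f n y].

Lemma measurable_exceed w n : measurable (exceed w n).
Proof.
have bf := bounded_measurable_birkhoff n (bounded_measurable_lip t01 lipf).
have [mS _] := bounded_measurableZ n%:R^-1 bf.
have -> : exceed w n = (fun y => n%:R^-1 * birkhoff f n y) @^-1` [set` `]w n, +oo[].
  by apply/seteqP; split => y /=; rewrite in_itv/= andbT.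
by rewrite -[X in measurable X]setTI; apply: mS => //; exact: measurable_itv.
Qed.

(** For large n the event lies between the robust events at slopes E + d and E - d'; the distortion
    D and the factor kappa hidden in [tail] are absorbed by terms linear in n. *)
Lemma exceed_rate (w : nat -> R) E rho : w n @[n --> \oo] --> E ->
  (forall eps, 0 < eps -> exists2 d, 0 < d & eventual_rate tail (E + d) (rho + eps)) ->
  (forall eps, 0 < eps -> exists2 d, 0 < d & forall n, (0 < n)%N ->
    tail n (n%:R * (E - d)) <= expR (- (n%:R * (rho - eps)))) ->
  log_rate mu1 n (exceed w n) @[n --> \oo] --> (- rho)%:E.
Proof.
move=> wE lower upper; apply: log_rate_cvg => [n|eps eps0]; first exact: measurable_exceed.
have mrob n c : measurable (robust f n c).
  exact: measurable_cylinder_set (@cylinder_robust _ _ f n c).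
have eps2 : 0 < eps / 2 by rewrite divr_gt0.
have [d d0 [n0 hlow]] := lower eps eps0.
have [d' d'0 hup] := upper _ eps2.
have d'2 : 0 < d' / 2 by rewrite divr_gt0.
move/cvgrPdist_lt : wE => wE.
near=> n.
have n1 : (0 < n)%N by near: n; exact: nbhs_infty_gt.
have nR : 0 < n%:R :> R by rewrite ltr0n.
have w1 : `|E - w n| < d by near: n; exact: wE.
have w2 : `|E - w n| < d' / 2 by near: n; exact: wE.
have nD : D <= n%:R * (d' / 2).
  by rewrite -ler_pdivrMr//; near: n; exact: nbhs_infty_ger.
have nD1 : D1 <= n%:R * (eps / 2).
  by rewrite -ler_pdivrMr//; near: n; exact: nbhs_infty_ger.
have exceedP y : exceed w n y <-> n%:R * w n < birkhoff f n y.
  by rewrite /exceed /= [_^-1 * _]mulrC ltr_pdivlMr// mulrC.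
apply/andP; split.
  have hn0 : (n0 <= n)%N by near: n; exact: nbhs_infty_ge.
  apply: le_trans (hlow n hn0) _; apply: le_trans (tail_le A0 mu1 t01 lip1 n _) _.
  apply: le_fine_prob => //; first exact: measurable_exceed.
  move=> y /robust_birkhoff h; apply/exceedP; apply: lt_le_trans h.
  by rewrite ltr_pM2l//; move: w1; rewrite ltr_norml; lra.
have sub : exceed w n `<=` robust f n (n%:R * (E - d')).
  move=> y /exceedP hy z yz.
  have := distortion t01 lipf yz; rewrite ler_norml => /andP[_ h].
  have : n%:R * (E - d' / 2) <= n%:R * w n.
    by rewrite ler_wpM2l// ?ltW//; move: w2; rewrite ltr_norml; lra.
  have : n%:R * (E - d' / 2) = n%:R * (E - d') + n%:R * (d' / 2) by field.
  lra.
apply: le_trans (le_fine_prob mu1 _ _ sub) _ => //; first exact: measurable_exceed.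
have := hup n n1; rewrite /tail mulrC -ler_pdivlMr ?expR_gt0// => /le_trans; apply.
rewrite -expRN opprK -expRD ler_expR.
have : n%:R * (rho - eps) = n%:R * (rho - eps / 2) - n%:R * (eps / 2) by field.
lra.
Unshelve. all: by end_near. Qed.

Let kappa_gt0 : 0 < expR (- D1) := expR_gt0 _.
Let M_ge0 := log_ratio_bound_ge0 lip0 lip1.
Let t_le1 := tail_le1 A0 mu1 t01 lip1.
Let t_anti := @tail_anti R k t C1 A0 A1 mu1.
Let t_super := tail_super A0 t01 lip1 nA1 tmu1.
Let t_low := tail_low mu1 lip0 lip1.
Let t_mean := @tail_rate_mean R k t C0 C1 A0 A1 mu0 mu1 t01 lip0 lip1 nA0 nA1 tmu0 tmu1 inv0.

Lemma exceed_mean_rate (w : nat -> R) : w n @[n --> \oo] --> e ->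
  log_rate mu1 n (exceed w n) @[n --> \oo] --> (- e)%:E.
Proof.
move=> we; apply: exceed_rate we _ _.
  have [b [u [eb hb]]] := tail_rate_above t01 lip0 lip1 nA0 nA1 tmu0 tmu1 inv0 e0.
  exact: (eventual_rate_right kappa_gt0 M_ge0 t_anti t_super t_low t_mean eb hb).
move=> eps eps0; exists eps => // n n0.
apply: le_trans (tail_le A0 mu1 t01 lip1 n _) _.
apply: (likelihood_ratio_bound (A0 := A0) (c := n%:R * (e - eps)) t01 lip1 nA0 nA1 tmu1 (n := n)).
  exact: cylinder_robust.
by move=> y; exact: robust_birkhoff.
Qed.

Lemma exceed_lower_rate (w : nat -> R) E : w n @[n --> \oo] --> E -> E < e ->
  exists2 L, - e < L & log_rate mu1 n (exceed w n) @[n --> \oo] --> L%:E.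
Proof.
move=> wE Ee.
have [b [u [eb hb]]] := tail_rate_above t01 lip0 lip1 nA0 nA1 tmu0 tmu1 inv0 e0.
have [r [re lower upper]] := rate_function_exists kappa_gt0 M_ge0 t_le1 t_anti t_super
  t_low e0 t_mean eb hb Ee.
by exists (- r); [rewrite ltrN2|exact: exceed_rate wE lower upper].
Qed.

End ErrorExponent.

(** * Comparison of tests *)

Section HolderLip.
Context {R : realType} {k : nat}.

Lemma dist_agree n (x y : Omega k) : agree n x y -> dist x y <= 2 ^- n :> R.
Proof.
move=> xy; rewrite /dist; case: pselect => [_|ne]; first by rewrite invr_ge0 exprn_ge0.
case: ex_minnP => m xm _; rewrite lef_pV2 ?posrE ?exprn_gt0//.
apply: ler_weXn2l; first by rewrite ler1n.
by rewrite leqNgt; apply/negP => /xy h; rewrite h eqxx in xm.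
Qed.

Lemma dist_ge0 (x y : Omega k) : 0 <= dist x y :> R.
Proof.
by rewrite /dist; case: pselect => // ?; rewrite invr_ge0 exprn_ge0.
Qed.

Lemma holder_lip (A : Omega k -> R) : holder A -> exists t C, 0 < t < 1 /\ lip t C A.
Proof.
move=> [C [alpha [C0 a0 hA]]]; exists (2 `^ (- alpha)), C; split.
  rewrite powR_gt0//= /powR pnatr_eq0/= -[ltRHS]expR0 ltr_expR mulNr oppr_lt0.
  by rewrite mulr_gt0// ln_gt0// ltr1n.
move=> n x y xy; apply: le_trans (hA x y) _; rewrite ler_wpM2l//.
have -> : (2 `^ (- alpha)) ^+ n = (2 ^- n) `^ alpha :> R.
  rewrite -powR_mulrn ?powR_ge0// -powRrM mulrC.
  by rewrite -powR_invn// -powRrM mulrN mulNr.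
apply: ge0_ler_powR; rewrite ?nnegrE ?dist_ge0 ?(ltW a0)//.
exact: dist_agree.
Qed.

End HolderLip.

(** * Levels reached below the largest slope of the pressure *)

Section Separation.
Context {R : realType} {k : nat}.
Implicit Types (x y z : Omega k) (n : nat).
Local Notation sh := (@shift_map k).
Local Notation bm := bounded_measurable.
Variables (t C0 C1 : R) (A0 A1 : Omega k -> R) (mu0 : probability (Omega k) R).
Hypotheses (t01 : 0 < t < 1) (lip0 : lip t C0 A0) (lip1 : lip t C1 A1).
Hypotheses (nA0 : normalized A0) (nA1 : normalized A1).
Hypothesis tmu0 : transfer_invariant t A0 mu0.
Hypothesis inv0 : invariant_measure mu0 sh.
Hypothesis eq0 : (\int[mu0]_x (A0 x)%:E + ks_entropy mu0 sh = 0)%E.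

Local Notation D := ((C0 + C1) / (1 - t)).
Local Notation f := (log_ratio A0 A1).
Let lipf : lip t (C0 + C1) f. Proof. exact: lipB. Qed.
Let bf : bm f. Proof. exact: bounded_measurable_lip lipf. Qed.
Let b0 : bm A0. Proof. exact: bounded_measurable_lip lip0. Qed.
Let b1 : bm A1. Proof. exact: bounded_measurable_lip lip1. Qed.
Local Notation e := (\int[mu0]_x f x).

Let press s : \bar R := pressure (fun x => s * f x + A1 x).

(** The entropy bound for the constant normalized potential - ln d. *)
Lemma ks_entropy_le_ln (nu : probability (Omega k) R) : invariant_measure nu sh ->
  (ks_entropy nu sh <= (ln k.+2%:R)%:E)%E.
Proof.
move=> inv.
have nU : normalized (fun _ : Omega k => - ln (k.+2%:R) : R).
  move=> x; rewrite sumr_const card_ord expRN lnK ?posrE// -[LHS]mulr_natl divff//.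
have := ks_entropy_le t01 (@lip_cst R k t (- ln (k.+2%:R))) nU inv.
by rewrite integral_cst_prob opprK.
Qed.

Let bpot s : bm (fun x => s * f x + A1 x).
Proof. by apply: bounded_measurableD => //; exact: bounded_measurableZ. Qed.

Lemma ks_entropy_equilibrium : ks_entropy mu0 sh = (- (\int[mu0]_x A0 x))%:E.
Proof.
move: eq0; rewrite -EFin_Rintegral//; case: (ks_entropy mu0 sh) => [h| |] //=.
by rewrite -EFinD => -[h0]; congr (_%:E); lra.
Qed.

Let press_fin s : press s \is a fin_num.
Proof.
rewrite fin_numE; apply/andP; split; apply/eqP => hp.
  have : (\int[mu0]_x (s * f x + A1 x)%:E + ks_entropy mu0 sh <= press s)%E.
    by apply: ereal_sup_ubound; exists mu0.
  by rewrite hp -EFin_Rintegral// ks_entropy_equilibrium -EFinD leeNy_eq.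
have [_ [M hM]] := bpot s.
have : (press s <= (M + ln k.+2%:R)%:E)%E.
  apply: ub_ereal_sup => _ [nu [inv ->]]; rewrite -EFin_Rintegral// EFinD.
  apply: leeD; last exact: ks_entropy_le_ln.
  rewrite lee_fin -[leRHS](integral_cst_prob nu); apply: le_integral_bm => //.
    exact: bounded_measurable_cst.
  by move=> x; exact: le_trans (ler_norm _) (hM x).
by rewrite hp leye_eq.
Qed.

(** Every invariant nu has int f dnu = int S_n f dnu / n <= E, S_n being the Birkhoff sum, so the
    quantities under the two suprema differ by at most h E. *)
Lemma pressure_increment s h n E : (0 < n)%N -> 0 <= h ->
  (forall y, birkhoff f n y <= n%:R * E) ->
  fine (press (s + h)) - fine (press s) <= h * E.
Proof.
move=> n0 h0 hE; rewrite lerBlDl -lee_fin EFinD !fineK//.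
apply: ub_ereal_sup => _ [nu [inv ->]].
have fE : \int[nu]_x f x <= E.
  have nR : 0 < n%:R :> R by rewrite ltr0n.
  rewrite -(ler_pM2l nR) -integral_birkhoff//.
  rewrite -[leRHS](integral_cst_prob nu); apply: le_integral_bm => //.
    exact: bounded_measurable_birkhoff.
  exact: bounded_measurable_cst.
have -> : (\int[nu]_x ((s + h) * f x + A1 x)%:E =
    \int[nu]_x (s * f x + A1 x)%:E + (h * \int[nu]_x f x)%:E)%E.
  rewrite -!EFin_Rintegral// -EFinD -integralZ_bm// -integralD_bm//; last first.
    exact: bounded_measurableZ.
  by congr (_%:E); apply: eq_integral_bm => x; ring.
rewrite addeAC; apply: leeD; last by rewrite lee_fin ler_wpM2l.
by apply: ereal_sup_ubound; exists nu.
Qed.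

Lemma derive1_pressure_gt s E : 0 < E -> E < derive1 (fun s => fine (press s)) s ->
  forall n, (0 < n)%N -> exists y, n%:R * E < birkhoff f n y.
Proof.
move=> E0 hd n n0; apply: contrapT => /forallNP hn.
have {}hn y : birkhoff f n y <= n%:R * E by rewrite leNgt; apply/negP; exact: hn.
move: hd; rewrite /derive1; set F := (X in lim X); move=> hd.
(* Where the difference quotient diverges, [derive1] is 0 by default, which E > 0 excludes. *)
have [cF|ncF] := pselect (cvg F); last first.
  by move: hd; rewrite (dvgP ncF) ltNge (ltW E0).
move/cvgrPdist_lt: cF => /(_ (lim F - E)); rewrite subr_gt0 => /(_ hd).
move=> /nbhs_ballP[d /= d0 hball].
have dh : 0 < d / 2 by rewrite divr_gt0.
have := hball (d / 2); rewrite /ball /= sub0r normrN gtr0_norm// ltr_pdivrMr//.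
rewrite ltr_pMr// ltr1n gt_eqF// => /(_ isT isT) h.
have := pressure_increment s n0 (ltW dh) hn.
have : E < (d / 2)^-1 * (fine (press (d / 2 + s)) - fine (press s)).
  have := le_lt_trans (ler_norm _) h; rewrite /GRing.scale /=; lra.
rewrite [d / 2 + s]addrC ltr_pdivlMl//; lra.
Qed.

(** A discrete intermediate value argument: the letters of a point z with a low sum, which exists
    because the mean is n e, are replaced one by one by those of a high point y. The first hybrid
    whose sum exceeds n a + D has not yet come near n b, and distortion extends this to its
    cylinder. *)
Lemma cylinder_between a b : e < a -> a < b ->
  (forall n, (0 < n)%N -> exists y, n%:R * b < birkhoff f n y) ->
  \forall n \near \oo, exists x, forall z, agree n x z ->
    n%:R * a < birkhoff f n z < n%:R * b.
Proof.
move=> ea ab hb; have [_ [M hM]] := bf.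
have D0 : 0 <= D := distortion_ge0 t01 lipf.
have ba : 0 < b - a by lra.
near=> n.
have n0 : (0 < n)%N by near: n; exact: nbhs_infty_gt.
(* The first hybrid above n a + D is at most n a + 2 D + 2 M, and its cylinder adds another D. *)
have big : 4 * D + 2 * M + 1 <= n%:R * (b - a).
  by rewrite -ler_pdivrMr//; near: n; exact: nbhs_infty_ger.
have big' : 1 <= n%:R * (a - e) by rewrite -ler_pdivrMr ?subr_gt0//; near: n; exact: nbhs_infty_ger.
have [y hy] := hb n n0.
have [z hz] : exists z, birkhoff f n z <= n%:R * e + 1.
  apply: contrapT => /forallNP h.
  have : n%:R * e + 1 <= \int[mu0]_x birkhoff f n x.
    rewrite -[leLHS](integral_cst_prob mu0); apply: le_integral_bm.
    - exact: bounded_measurable_cst.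
    - exact: bounded_measurable_birkhoff.
    - by move=> x; apply: ltW; rewrite ltNge; apply/negP; exact: h.
  by rewrite integral_birkhoff//; lra.
pose x j : Omega k := fun i => if (i < j)%N then y i else z i.
have x0 : x 0%N = z by [].
(* Consecutive hybrids differ in the letter of index j: distortion controls the terms before j, the
   term j changes by at most 2 M, and the later terms coincide. *)
have step j : (j < n)%N -> birkhoff f n (x j.+1) <= birkhoff f n (x j) + (D + 2 * M).
  move=> jn; have nE : n = (j + (1 + (n - j.+1)))%N by rewrite add1n addnS -addSn subnKC.
  rewrite nE !birkhoffD -!iterD.
  have -> : iter (1 + j) sh (x j.+1) = iter (1 + j) sh (x j).
    apply/funext => i; rewrite !iter_shiftE /x add1n.
    by rewrite !ltnNge leq_addr (leq_trans (leqnSn j)) ?leq_addr.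
  have xx : agree j (x j.+1) (x j) by move=> i ij; rewrite /x ij ltnW.
  have := distortion t01 lipf xx; rewrite ler_norml => /andP[_ h1].
  rewrite !birkhoffSr !birkhoff0 !add0r.
  have := hM (iter 0 sh (iter j sh (x j.+1))); have := hM (iter 0 sh (iter j sh (x j))).
  by rewrite !ler_norml => /andP[h2 h3] /andP[h4 h5]; lra.
have xn : n%:R * a + D < birkhoff f n (x n).
  have xy : agree n y (x n) by move=> i ni; rewrite /x ni.
  have := distortion t01 lipf xy; rewrite ler_norml => /andP[_ h1].
  have M0 : 0 <= M := le_trans (normr_ge0 _) (hM (fun=> ord0)).
  lra.
have ex : exists j, n%:R * a + D < birkhoff f n (x j) by exists n.
case: (ex_minnP ex) => [[|j]] hj minj.
  exfalso; move: hj; rewrite x0; lra.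
have jn : (j < n)%N by exact: minj.
have jlow : birkhoff f n (x j) <= n%:R * a + D.
  by rewrite leNgt; apply/negP => /minj; rewrite ltnn.
exists (x j.+1) => w xw; have := distortion t01 lipf xw.
have := step j jn; rewrite ler_norml => h1 /andP[h2 h3].
by apply/andP; split; lra.
Unshelve. all: by end_near. Qed.

End Separation.

(** If the integral were 0, then h(mu0) = - int A0 dmu0 = - int A1 dmu0, so mu0 would attain the
    zero pressure of A1 as well and coincide with mu1 by uniqueness. *)
Lemma relative_entropy_rate_gt0 (R : realType) (k : nat) (t C0 C1 : R)
    (A0 A1 : Omega k -> R) (mu0 mu1 : probability (Omega k) R) :
  0 < t < 1 -> lip t C0 A0 -> lip t C1 A1 -> normalized A1 ->
  invariant_measure mu0 (@shift_map k) ->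
  (\int[mu0]_x (A0 x)%:E + ks_entropy mu0 (@shift_map k) = 0)%E ->
  transfer_invariant t A1 mu1 -> distinct_measures mu0 mu1 ->
  0 < \int[mu0]_x log_ratio A0 A1 x.
Proof.
move=> t01 lip0 lip1 nA1 inv0 eq0 tmu1 [B [mB neB]].
have b0 := bounded_measurable_lip t01 lip0; have b1 := bounded_measurable_lip t01 lip1.
have ks0 := ks_entropy_equilibrium t01 lip0 eq0.
have := pressure_normalized_le t01 lip1 nA1 inv0.
rewrite -EFin_Rintegral// ks0 -EFinD lee_fin => h.
rewrite integralB_bm// lt_neqAle; apply/andP; split; last by lra.
apply/eqP => e0; apply: neB; apply: (transfer_invariant_unique t01 lip1 nA1) => //.
apply: (transfer_invariant_of_equilibrium t01 lip1 nA1 inv0).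
by rewrite -EFin_Rintegral// ks0 -EFinD lee_fin; lra.
Qed.

Theorem theoremA (R : realType) (k : nat) (J0 J1 : Omega k -> R)
    (mu0 mu1 : probability (Omega k) R) (u v : nat -> R) (E : R) :
  gibbs J0 mu0 -> gibbs J1 mu1 -> distinct_measures mu0 mu1 ->
  u n @[n --> \oo] --> E_NP J0 J1 mu0 ->
  (cminus J0 J1 < E%:E)%E -> (E%:E < cplus J0 J1)%E ->
  E <> E_NP J0 J1 mu0 ->
  v n @[n --> \oo] --> E ->
  (forall n : nat, (0 < n)%N ->
    (mu0 [set y | (Sn J0 J1 n y < v n)%R]
      <= mu0 [set y | (Sn J0 J1 n y < u n)%R])%E) ->
  exists L : R,
    [/\ log_rate mu1 n [set y | v n < Sn J0 J1 n y] @[n --> \oo] --> L%:E,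
        log_rate mu1 n [set y | u n < Sn J0 J1 n y] @[n --> \oo]
          --> (- E_NP J0 J1 mu0)%:E &
        - E_NP J0 J1 mu0 < L].
Proof.
move=> [[J0p J0h J0n] [inv0 eq0]] [[J1p J1h J1n] [inv1 eq1]] distinct uE _ Ec EN vE hsize.
pose A0 x := ln (J0 x); pose A1 x := ln (J1 x); pose f := log_ratio A0 A1.
have [t0 [C0 [/andP[t00 t01] lip0]]] := holder_lip J0h.
have [t1 [C1 [/andP[t10 t11] lip1]]] := holder_lip J1h.
pose t := Num.max t0 t1.
have tt : 0 < t < 1 by rewrite lt_max t00 gt_max t01 t11.
have {}lip0 : lip t C0 A0 by apply: lip_le lip0; rewrite (ltW t00) le_max lexx.
have {}lip1 : lip t C1 A1 by apply: lip_le lip1; rewrite (ltW t10) le_max lexx orbT.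
have nA0 : normalized A0.
  by move=> x; rewrite -(J0n x); apply: eq_bigr => a _; rewrite lnK// posrE.
have nA1 : normalized A1.
  by move=> x; rewrite -(J1n x); apply: eq_bigr => a _; rewrite lnK// posrE.
rewrite (pressure_normalized tt lip0 nA0) in eq0.
rewrite (pressure_normalized tt lip1 nA1) in eq1.
have tmu0 : transfer_invariant t A0 mu0.
  by apply: (transfer_invariant_of_equilibrium tt lip0 nA0 inv0); rewrite eq0.
have tmu1 : transfer_invariant t A1 mu1.
  by apply: (transfer_invariant_of_equilibrium tt lip1 nA1 inv1); rewrite eq1.
have SnE n y : Sn J0 J1 n y = n%:R^-1 * birkhoff f n y.
  by congr (_ * _); apply: eq_bigr => i _; rewrite ln_div ?posrE.
have b0 := bounded_measurable_lip tt lip0; have b1 := bounded_measurable_lip tt lip1.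
have eE : E_NP J0 J1 mu0 = \int[mu0]_x f x by rewrite /f integralB_bm.
have e0 := relative_entropy_rate_gt0 tt lip0 lip1 nA1 inv0 eq0 tmu1 distinct.
rewrite eE in uE EN *.
have exceedE (w : nat -> R) : (fun n => [set y | w n < Sn J0 J1 n y]) = exceed A0 A1 w.
  by apply/funext => n; apply/seteqP; split => y /=; rewrite SnE.
have log_rateE (w : nat -> R) :
    (fun n => log_rate mu1 n [set y | w n < Sn J0 J1 n y]) =
    (fun n => log_rate mu1 n (exceed A0 A1 w n)) by rewrite -exceedE.
have [Ee|eE'] := ltP E (\int[mu0]_x f x).
  have [L eL hL] := exceed_lower_rate tt lip0 lip1 nA0 nA1 tmu0 tmu1 inv0 e0 vE Ee.
  exists L; split=> //; rewrite log_rateE//.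
  exact: (exceed_mean_rate tt lip0 lip1 nA0 nA1 tmu0 tmu1 inv0 e0 uE).
exfalso.
have {eE'} Ee : \int[mu0]_x f x < E by rewrite lt_neqAle eE' andbT; apply/eqP => h; exact: EN.
have E0 : 0 < E by exact: lt_trans Ee.
have [_ [s _ <-]] := ereal_sup_gt Ec; rewrite lte_fin => hs.
have hb := derive1_pressure_gt tt lip0 lip1 inv0 eq0 E0 hs.
set e := \int[mu0]_x f x in uE Ee e0 *.
(* A third of the gap leaves room for u_n < e + eta < E - eta < v_n; the window in the middle
   receives the cylinder. *)
pose eta := (E - e) / 3.
have eta0 : 0 < eta by rewrite divr_gt0// subr_gt0.
have hb' n : (0 < n)%N -> exists y, n%:R * (E - eta) < birkhoff f n y.
  move=> n0; have [y hy] := hb n n0; exists y; apply: le_lt_trans hy.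
  by rewrite ler_wpM2l// gerBl ltW.
have ea : e < e + eta by rewrite ltrDl.
have ab : e + eta < E - eta by rewrite /eta; lra.
have hx := cylinder_between tt lip0 lip1 inv0 ea ab hb'.
move/cvgrPdist_lt : uE => /(_ _ eta0) hu; move/cvgrPdist_lt : vE => /(_ _ eta0) hv.
have [n [n0 [x xz] un vn]] : exists n, [/\ (0 < n)%N,
    exists x, forall z, agree n x z -> n%:R * (e + eta) < birkhoff f n z < n%:R * (E - eta),
    `|e - u n| < eta & `|E - v n| < eta].
  have : \forall n \near \oo, [/\ (0 < n)%N,
    exists x, forall z, agree n x z -> n%:R * (e + eta) < birkhoff f n z < n%:R * (E - eta),
    `|e - u n| < eta & `|E - v n| < eta].
    by near=> n; split; near: n => //; exact: nbhs_infty_gt.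
  by move=> [n _ /(_ n (leqnn n))]; exists n.
have nR : 0 < n%:R :> R by rewrite ltr0n.
have bS := bounded_measurable_birkhoff n (bounded_measurable_lip tt (lipB lip0 lip1)).
have mless (w : R) : measurable [set y | Sn J0 J1 n y < w].
  have [mS _] := bounded_measurableZ n%:R^-1 bS.
  have -> : [set y | Sn J0 J1 n y < w] =
      (fun y => n%:R^-1 * birkhoff f n y) @^-1` [set` `]-oo, w[].
    by apply/seteqP; split => y /=; rewrite in_itv/= SnE.
  by rewrite -[X in measurable X]setTI; apply: mS => //; exact: measurable_itv.
have lessP (w : R) y : Sn J0 J1 n y < w <-> birkhoff f n y < n%:R * w.
  by rewrite SnE [_^-1 * _]mulrC ltr_pdivrMr// mulrC.
move: un vn; rewrite !ltr_norml => /andP[un1 un2] /andP[vn1 vn2].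
have mx := @measurable_agree k n x.
have dis : [set y | Sn J0 J1 n y < u n] `&` agree n x = set0.
  apply/seteqP; split => // y [/lessP hy /xz /andP[hy' _]].
  have := lt_trans hy' hy; rewrite ltr_pM2l//; lra.
have sub : [set y | Sn J0 J1 n y < u n] `|` agree n x `<=` [set y | Sn J0 J1 n y < v n].
  move=> y [/lessP hy|/xz /andP[_ hy]]; apply/lessP; apply: (lt_trans hy);
    rewrite ltr_pM2l//; rewrite /eta in un1 un2 vn1 vn2 *; lra.
have := hsize n n0; apply/negP; rewrite -ltNge.
rewrite -(fine_probK mu0 (mless (u n))) -(fine_probK mu0 (mless (v n))) lte_fin.
apply: lt_le_trans (le_fine_prob mu0 _ (mless _) sub); last exact: measurableU.
have -> : fine (mu0 ([set y | Sn J0 J1 n y < u n] `|` agree n x)) =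
    fine (mu0 [set y | Sn J0 J1 n y < u n]) + fine (mu0 (agree n x)).
  by rewrite -fineD ?fin_num_measure// -measureU.
have p0 := transfer_invariant_agree_gt0 tt lip0 nA0 tmu0 n x.
by rewrite ltrDl.
Unshelve. all: by end_near. Qed.
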